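(* Let $u\in C([0,1];H^{4}(\mathbb{R}^{2}))\cap C^{1}([0,1];L^{2}(\mathbb{R}^{2}))$ be a real-valued solution of the Zakharov-Kuznetsov equation \[ \partial_{t}u+\partial_{x}^{3}u+\partial_{x}\partial_{y}^{2}u+u\,\partial_{x}u=0,\qquad (x,y)\in\mathbb{R}^2,\ t\in[0,1], \] such that, for some $B>0$, \[ \operatorname{supp} u(0)\subseteq[-B,B]\times[-B,B]\quad\text{and}\quad \operatorname{supp} u(1)\subseteq[-B,B]\times[-B,B]. \] Then $u\equiv 0$.
   Context: $H^{4}(\mathbb{R}^{2})$ is the usual $L^2$-based Sobolev space, and $u(t)$ denotes the function $(x,y)\mapsto u(x,y,t)$. For $u\in C([0,1];H^{4}(\mathbb{R}^{2}))\cap C^{1}([0,1];L^{2}(\mathbb{R}^{2}))$, being a solution means that the equation holds in $L^2(\mathbb{R}^2)$ for every $t\in[0,1]$, with $\partial_t u$ the derivative of the $C^1$ map $t\mapsto u(t)\in L^2(\mathbb{R}^2)$ (one-sided at the endpoints). Supports are (essential) supports of $L^2$ functions on $\mathbb{R}^2$. *)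

(* Defs.v *)
From mathcomp Require Import all_boot all_order all_algebra.
From mathcomp Require Import all_classical all_reals all_analysis.

Set Implicit Arguments.
Unset Strict Implicit.
Unset Printing Implicit Defensive.
Import Order.TTheory GRing.Theory Num.Theory.
Import numFieldNormedType.Exports.
Local Open Scope classical_set_scope.
Local Open Scope ring_scope.

Section lebesgue_plane.
Context {R : realType}.
Implicit Types f : R * R -> R.

(* Lebesgue measure on the plane, on the product Borel sigma-algebra: every
   Lebesgue-measurable function is a.e. equal to a Borel one, so this gives the
   usual L^2 classes. Elements of L^2 are handled as representatives
   [R * R -> R], compared with [{ae leb2, _}]. *)
Definition leb2 :
    {measure set (measurableTypeR R * measurableTypeR R) -> \bar R} :=
  (lebesgue_measure \x lebesgue_measure)%E.

Definition inL2 f : Prop := f \in Lfun leb2 2%:E.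

Definition L2norm f : \bar R := 'N[leb2]_(2%:E)[EFin \o f].

Definition ess_supp f : set (R * R) :=
  ~` \bigcup_(U in [set U | open U /\ {ae leb2, forall z, U z -> f z = 0}]) U.

End lebesgue_plane.

Section sobolev.
Context {R : realType}.
Implicit Types (f g phi : R * R -> R) (i j k : nat).

Definition Dx phi : R * R -> R := 'D_((1, 0) : R * R) phi.
Definition Dy phi : R * R -> R := 'D_((0, 1) : R * R) phi.

Fixpoint Ck k phi : Prop :=
  continuous phi /\
  if k is k'.+1 then
    [/\ forall z, derivable phi z ((1, 0) : R * R),
        forall z, derivable phi z ((0, 1) : R * R),
        Ck k' (Dx phi) & Ck k' (Dy phi)]
  else True.

Definition test_function phi : Prop :=
  (forall k, Ck k phi) /\ compact (closure [set z | phi z != 0]).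

(* d_x^i d_y^j f = g in the sense of distributions, with g in L^2; the real
   integrals below are meaningful when f is in L^2. *)
Definition is_wderiv i j f g : Prop :=
  inL2 g /\
  forall phi, test_function phi ->
    \int[leb2]_z (f z * iter i Dx (iter j Dy phi) z) =
    (-1) ^+ (i + j) * \int[leb2]_z (g z * phi z).

(* A chosen representative: for f in L^2, the L^2 weak derivative is unique up
   to a.e. equality. Junk value 0 when it does not exist. *)
Definition wD i j f : R * R -> R := xget (cst 0) [set g | is_wderiv i j f g].

Definition inH k f : Prop :=
  inL2 f /\ forall i j, (i + j <= k)%N -> exists g, is_wderiv i j f g.

(* Since [wD] has a junk value, this is the H^k norm only when [inH k f]. *)
Definition Hnorm k f : \bar R :=
  ((\sum_(i < k.+1) \sum_(j < k.+1 | (i + j <= k)%N) L2norm (wD i j f) `^ 2)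
   `^ 2^-1)%E.

End sobolev.

(* Curves in function spaces are parametrized by [0,1]: all limits in time are
   taken within [0,1], hence are one-sided at 0 and 1, and the functions [u t]
   for t outside [0,1] play no role. *)
Section curves.
Context {R : realType}.
Implicit Types u : R -> R * R -> R.

Definition norm_continuous01 (N : (R * R -> R) -> \bar R) u : Prop :=
  forall s : R, s \in `[0, 1] ->
    N (u t \- u s) @[t --> within `[0, 1] (nbhs s)] --> 0%E.

Definition C0H k u : Prop :=
  (forall t : R, t \in `[0, 1] -> inH k (u t)) /\ norm_continuous01 (Hnorm k) u.

Definition C0L2 u : Prop :=
  (forall t : R, t \in `[0, 1] -> inL2 (u t)) /\ norm_continuous01 L2norm u.

Definition is_L2deriv u (t : R) (v : R * R -> R) : Prop :=
  inL2 v /\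
  L2norm (fun z => h^-1 * (u (t + h) z - u t z) - v z)
    @[h --> within [set h | t + h \in `[0, 1]] 0^'] --> 0%E.

(* The time derivative in L^2 (an L^2 limit, unique up to a.e. equality). *)
Definition dt u (t : R) : R * R -> R := xget (cst 0) [set v | is_L2deriv u t v].

Definition C1L2 u : Prop :=
  [/\ C0L2 u,
      forall t : R, t \in `[0, 1] -> exists v, is_L2deriv u t v
    & C0L2 (dt u)].

Definition ZK_solution u : Prop :=
  forall t : R, t \in `[0, 1] ->
    {ae leb2, forall z,
      dt u t z + wD 3 0 (u t) z + wD 1 2 (u t) z + u t z * wD 1 0 (u t) z = 0}.

End curves.

(* Main.v *)
(** Since [u] lies in [H ^ 4], its derivative [d_x u] is bounded, so the nonlinearity acts as a
    bounded potential. The compact supports at the two end times and the sign of the flux of the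
    weighted mass give [u(t)], and by interpolation its derivatives of order at most three,
    decay faster than every [exp (- c |x|)], uniformly in time.
    Conjugating the equation by [w = exp (a x^2 / 2 + b x) u] splits [d_x^3 + d_x d_y^2] into a
    symmetric part [S] and an antisymmetric part [A]. For the phase [theta = q t (1 - t)] the
    energy [e^(2 theta) (<S w, w> - theta' |w|^2)] has, by the commutator identity for
    [<S w, A w>], a derivative at most [e^(2 theta)] times the integral of [w^2] against an explicit
    polynomial in [a x + b], which is negative in the two regimes below, while at the end times
    it only sees the box. With [a = 0] and [b] tending to plus or minus infinity this
    confines [u(t)] to the strip [|x| <= B]; there, with [b = a (B + 1)], [q] proportional to [a]
    and [a] tending to infinity, the factor [e^(2 theta)] inside (0, 1) wins over the boundary
    terms unless [u = 0]. *)

From HB Require Import structures.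
Require Import Defs.
From mathcomp Require Import all_boot all_order all_algebra.
From mathcomp Require Import all_classical all_reals all_analysis.
From mathcomp Require Import measurable_realfun ring lra.
Import Order.TTheory GRing.Theory Num.Theory.
Import numFieldNormedType.Exports.
Local Open Scope classical_set_scope.
Local Open Scope ring_scope.
Set Implicit Arguments.
Unset Strict Implicit.
Unset Printing Implicit Defensive.

(** * The space L^2(R^2) *)

Section L2plane.
Context {R : realType}.
Implicit Types f g h : R * R -> R.

(** A Gaussian weight asks for Gaussian decay, whereas the flux of the mass only yields decay faster
    than every exponential; hence the two regimes. With a linear phase ([a = 0]) exponential decay
    suffices, and the polynomial reduces to the constant [M^2 + 2 q], where [M] bounds [u_x]; it is
    made equal to [-1]. Once [u(t)] lives in the strip, every Gaussian weight is bounded where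
    [u(t)] is nonzero. The shift [b = a (B + 1)] keeps [P = a x + b] above [a] there, so that
    [- 3 a P^4] dominates; near a zero of [P] the positive term [12 a^3] would win. The energy
    contains two space derivatives of [u], while the time derivative exists only in L^2; the
    symmetry of [S] is what makes the energy differentiable. Time is handled by the mean value
    theorem on subintervals, so nothing is ever integrated in time. Integrations by parts are
    recorded as functions of integral zero; after adding suitable multiples of them, each identity
    is a pointwise polynomial identity. *)

Definition integrable2 f : Prop := (@leb2 R).-integrable setT (EFin \o f).

Lemma inL2_measurable f : inL2 f ->
  measurable_fun [set: measurableTypeR R * measurableTypeR R] f.
Proof. by rewrite /inL2 => /andP[]; rewrite !inE. Qed.

Lemma inL2_sqr f : inL2 f -> integrable2 (fun z => f z ^+ 2).
Proof. exact: Lfun2_integrable_sqr. Qed.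

Lemma L2normE f : (L2norm f = (\int[leb2]_z (f z ^+ 2)%:E) `^ 2^-1)%E.
Proof.
rewrite /L2norm unlock; congr (_ `^ _)%E; apply: eq_integral => z _ /=.
by rewrite powR_mulrn// real_normK// num_real.
Qed.

Lemma inL2P f : measurable_fun [set: measurableTypeR R * measurableTypeR R] f ->
  integrable2 (fun z => f z ^+ 2) -> inL2 f.
Proof.
move=> mf if2; rewrite /inL2; apply/andP; rewrite !inE; split => //=.
rewrite /finite_norm -/(L2norm f) L2normE poweR_lty//.
case/integrableP : if2 => _; apply: le_lt_trans; apply: ge0_le_integral => //.
- by move=> z _; rewrite lee_fin sqr_ge0.
- by apply/measurable_EFinP; exact: measurable_funX.
- by apply/measurable_EFinP; apply: measurableT_comp => //; exact: measurable_funX.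
- by move=> z _ /=; rewrite lee_fin ler_norm.
Qed.

Lemma integrable2_le f g :
  measurable_fun [set: measurableTypeR R * measurableTypeR R] f ->
  integrable2 g -> (forall z, `|f z| <= `|g z|) -> integrable2 f.
Proof.
move=> mf ig fg; apply: (le_integrable _ _ _ ig) => //; first exact/measurable_EFinP.
by move=> z _ /=; rewrite lee_fin.
Qed.

Lemma integrable2D f g : integrable2 f -> integrable2 g ->
  integrable2 (fun z => f z + g z).
Proof. by move=> fi gi; exact: (integrableD measurableT fi gi). Qed.

Lemma integrable2Z (c : R) f : integrable2 f -> integrable2 (fun z => c * f z).
Proof. by move=> fi; exact: (integrableZl measurableT c fi). Qed.

Lemma integrable2N f : integrable2 f -> integrable2 (fun z => - f z).
Proof. by move=> /(integrable2Z (-1)); under eq_fun do rewrite mulN1r. Qed.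

Lemma integrable2B f g : integrable2 f -> integrable2 g ->
  integrable2 (fun z => f z - g z).
Proof. by move=> fi gi; apply: integrable2D => //; exact: integrable2N. Qed.

Lemma integrable2M f g : inL2 f -> inL2 g -> integrable2 (fun z => f z * g z).
Proof. by move=> f2 g2; apply/Lfun1_integrable; exact: Lfun2_mul_Lfun1. Qed.

Lemma inL2D f g : inL2 f -> inL2 g -> inL2 (fun z => f z + g z).
Proof. 
move=> f2 g2; apply: inL2P.
  by apply: measurable_funD; exact: inL2_measurable.
under eq_fun do rewrite sqrrD.
apply: integrable2D; last exact: inL2_sqr.
apply: integrable2D; first exact: inL2_sqr.
under eq_fun do rewrite -mulr_natl.
by apply: integrable2Z; exact: integrable2M.
Qed.

Lemma inL2Z (c : R) f : inL2 f -> inL2 (fun z => c * f z).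
Proof.
move=> f2; apply: inL2P.
  by apply: measurable_funM => //; exact: inL2_measurable.
under eq_fun do rewrite exprMn.
by apply: integrable2Z; exact: inL2_sqr.
Qed.

Lemma inL2N f : inL2 f -> inL2 (fun z => - f z).
Proof. by move=> /(inL2Z (-1)); under eq_fun do rewrite mulN1r. Qed.

Lemma inL2B f g : inL2 f -> inL2 g -> inL2 (fun z => f z - g z).
Proof. by move=> fi gi; apply: inL2D => //; exact: inL2N. Qed.

Lemma inL2_0 : inL2 (fun=> 0 : R).
Proof.
apply: inL2P; first exact: measurable_cst.
under eq_fun do rewrite expr0n /=.
exact: integrable0.
Qed.

Lemma inL2_le f g :
  measurable_fun [set: measurableTypeR R * measurableTypeR R] f ->
  inL2 g -> (forall z, `|f z| <= `|g z|) -> inL2 f.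
Proof.
move=> mf g2 fg; apply: inL2P => //.
apply: (integrable2_le _ (inL2_sqr g2)); first exact: measurable_funX.
by move=> z; rewrite !normrX lerXn2r// nnegrE.
Qed.

Lemma int2D f g : integrable2 f -> integrable2 g ->
  \int[leb2]_z (f z + g z) = \int[leb2]_z f z + \int[leb2]_z g z.
Proof. exact: RintegralD. Qed.

Lemma int2B f g : integrable2 f -> integrable2 g ->
  \int[leb2]_z (f z - g z) = \int[leb2]_z f z - \int[leb2]_z g z.
Proof. exact: RintegralB. Qed.

Lemma int2Z (c : R) f : integrable2 f ->
  \int[leb2]_z (c * f z) = c * \int[leb2]_z f z.
Proof. exact: RintegralZl. Qed.

Lemma int2N f : integrable2 f ->
  \int[leb2]_z (- f z) = - \int[leb2]_z f z.
Proof. by move=> fi; under eq_Rintegral do rewrite -mulN1r; rewrite int2Z// mulN1r. Qed.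

Lemma int2_le f g : integrable2 f -> integrable2 g -> (forall z, f z <= g z) ->
  \int[leb2]_z f z <= \int[leb2]_z g z.
Proof. by move=> fi gi fg; exact: le_Rintegral. Qed.

Lemma int2_ge0 f : (forall z, 0 <= f z) -> 0 <= \int[leb2]_z f z.
Proof. by move=> f0; exact: Rintegral_ge0. Qed.

#[local] Instance ae_leb2_filter : Filter (nbhs (almost_everywhere (@leb2 R))).
Proof. exact: ae_filter_ringOfSetsType. Qed.

Lemma ae2_imp (P Q : R * R -> Prop) : (forall z, P z -> Q z) ->
  {ae leb2, forall z, P z} -> {ae leb2, forall z, Q z}.
Proof. by move=> PQ; apply: filterS. Qed.

Lemma ae2_imp2 (P Q S : R * R -> Prop) : (forall z, P z -> Q z -> S z) ->
  {ae leb2, forall z, P z} -> {ae leb2, forall z, Q z} -> {ae leb2, forall z, S z}.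
Proof. by move=> PQ; apply: filterS2. Qed.

Lemma int2_ae f g : integrable2 f -> integrable2 g ->
  {ae leb2, forall z, f z = g z} -> \int[leb2]_z f z = \int[leb2]_z g z.
Proof.
move=> fi gi fg; congr fine; apply: ae_eq_integral => //.
- by case/integrableP: fi.
- by case/integrableP: gi.
- by apply: filterS fg => z /= ->.
Qed.

Lemma int2_ae_le f g : integrable2 f -> integrable2 g ->
  {ae leb2, forall z, f z <= g z} -> \int[leb2]_z f z <= \int[leb2]_z g z.
Proof.
move=> fi gi fg.
(* Replacing [g] by the maximum of [f] and [g] turns the a.e. inequality into one valid
   everywhere. *)
have mi : integrable2 (fun z => Num.max (f z) (g z)).
  apply: (@integrable2_le _ (fun z => `|f z| + `|g z|)).
  - apply: measurable_maxr; [move: fi|move: gi];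
      by case/integrableP => /measurable_EFinP.
  - by apply: integrable2D; [move: fi|move: gi] => /integrable_norm.
  - move=> z; rewrite [leRHS]ger0_norm ?addr_ge0//.
    by have [] := leP (f z) (g z) => _; rewrite ?lerDl ?lerDr.
have -> : \int[leb2]_z g z = \int[leb2]_z (Num.max (f z) (g z)).
  by apply: int2_ae => //; apply: filterS fg => z /max_idPr.
by apply: int2_le => // z; rewrite le_max lexx.
Qed.

Lemma int2_sqr_ge0 f : 0 <= \int[leb2]_z f z ^+ 2.
Proof. by apply: int2_ge0 => z; exact: sqr_ge0. Qed.

Lemma int2_EFin f : integrable2 f ->
  (\int[leb2]_z f z)%:E = (\int[leb2]_z (f z)%:E)%E.
Proof. by move=> fi; rewrite /Rintegral fineK//; exact: integrable_fin_num. Qed.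

Lemma L2norm_sqrt f : inL2 f ->
  (L2norm f = (Num.sqrt (\int[leb2]_z f z ^+ 2))%:E)%E.
Proof.
move=> f2; rewrite L2normE -int2_EFin; last exact: inL2_sqr.
by rewrite poweR_EFin powR12_sqrt// int2_sqr_ge0.
Qed.

Lemma int2_sqr_eq0 f : inL2 f -> \int[leb2]_z f z ^+ 2 = 0 ->
  {ae leb2, forall z, f z = 0}.
Proof.
move=> f2 f0; have := L2norm_sqrt f2; rewrite f0 sqrtr0.
have mf : measurable_fun [set: measurableTypeR R * measurableTypeR R] (EFin \o f).
  by apply/measurable_EFinP; exact: inL2_measurable.
move=> /(Lnorm_eq0_eq0 mf) -/(_ (lte0n 2)).
by apply: filterS => z /(_ I) [].
Qed.

Lemma inL2_ae f g :
  measurable_fun [set: measurableTypeR R * measurableTypeR R] g ->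
  inL2 f -> {ae leb2, forall z, f z = g z} -> inL2 g.
Proof.
move=> mg f2 fg; apply: inL2P => //.
have := inL2_sqr f2; rewrite /integrable2 => i2.
apply/integrableP; split; first by apply/measurable_EFinP; exact: measurable_funX.
case/integrableP : i2 => mf2; apply: le_lt_trans.
rewrite le_eqVlt; apply/orP; left; apply/eqP/ae_eq_integral => //.
- apply: measurableT_comp => //; apply/measurable_EFinP.
  exact: measurable_funX.
- exact: measurableT_comp.
- by apply: filterS fg => z /= ->.
Qed.

Lemma int2_CS f g : inL2 f -> inL2 g ->
  (\int[leb2]_z (f z * g z)) ^+ 2 <=
  \int[leb2]_z (f z ^+ 2) * \int[leb2]_z (g z ^+ 2).
Proof.
move=> f2 g2; set b := \int[leb2]_z (f z * g z).
set a := \int[leb2]_z (f z ^+ 2); set c := \int[leb2]_z (g z ^+ 2).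
have key (s t : R) : 0 <= s ^+ 2 * a - 2 * (s * t) * b + t ^+ 2 * c.
  have : 0 <= \int[leb2]_z (s * f z - t * g z) ^+ 2 by exact: int2_sqr_ge0.
  have -> : (fun z => (s * f z - t * g z) ^+ 2) =
      (fun z => s ^+ 2 * f z ^+ 2 - 2 * (s * t) * (f z * g z) + t ^+ 2 * g z ^+ 2).
    by apply/funext => z; ring.
  have fi := inL2_sqr f2; have gi := inL2_sqr g2; have fgi := integrable2M f2 g2.
  rewrite int2D ?int2B ?int2Z//; by do ?[exact: integrable2Z|apply: integrable2B].
have a0 : 0 <= a by exact: int2_sqr_ge0.
have c0 : 0 <= c by exact: int2_sqr_ge0.
have [a_gt0|] := ltP 0 a.
  (* For [s = b], [t = a] the quadratic form equals [a (a c - b^2)]. *)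
  have := key b a; rewrite -(pmulr_rge0 _ a_gt0).
  have -> : a * (b ^+ 2 * a - 2 * (b * a) * b + a ^+ 2 * c) =
    a ^+ 2 * (a * c - b ^+ 2) by ring.
  by rewrite pmulr_rge0 ?exprn_gt0// subr_ge0.
move=> a_le0; have a00 : a = 0 by apply/eqP; rewrite eq_le a_le0.
have [->|b0] := eqVneq b 0; first by rewrite expr0n mulr_ge0.
(* If [a = 0] and [b] is nonzero, this choice makes the form equal to [- 2 (c + 1) + c], which is
   negative. *)
have := key ((c + 1) / b) 1.
rewrite a00 mulr0 mul0r sub0r mulr1 expr1n mul1r -mulrA divfK//.
by move=> H; exfalso; lra.
Qed.

Definition nrm f : R := Num.sqrt (\int[leb2]_z f z ^+ 2).

Lemma nrm_ge0 f : 0 <= nrm f.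
Proof. exact: sqrtr_ge0. Qed.

Lemma sqr_nrm f : nrm f ^+ 2 = \int[leb2]_z f z ^+ 2.
Proof. by rewrite sqr_sqrtr// int2_sqr_ge0. Qed.

Lemma nrm_CS f g : inL2 f -> inL2 g -> `|\int[leb2]_z (f z * g z)| <= nrm f * nrm g.
Proof.
move=> f2 g2; rewrite -(@ler_pXn2r _ 2)// ?nnegrE ?mulr_ge0 ?nrm_ge0//.
by rewrite exprMn !sqr_nrm real_normK ?num_real// int2_CS.
Qed.

Lemma nrmD f g : inL2 f -> inL2 g -> nrm (fun z => f z + g z) <= nrm f + nrm g.
Proof.
move=> f2 g2; rewrite -(@ler_pXn2r _ 2)// ?nnegrE ?addr_ge0 ?nrm_ge0//.
rewrite sqrrD !sqr_nrm.
have -> : (fun z => (f z + g z) ^+ 2) =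
    (fun z => f z ^+ 2 + 2 * (f z * g z) + g z ^+ 2) by apply/funext => z; ring.
have i1 := inL2_sqr f2; have i2 := inL2_sqr g2; have i3 := integrable2M f2 g2.
rewrite int2D//; last by apply: integrable2D => //; exact: integrable2Z.
rewrite int2D//; last exact: integrable2Z.
rewrite int2Z// lerD2r lerD2l -[nrm f * nrm g *+ 2]mulr_natl ler_pM2l//.
by rewrite (le_trans _ (nrm_CS f2 g2))// ler_norm.
Qed.

Lemma nrmN f : nrm (fun z => - f z) = nrm f.
Proof. by rewrite /nrm; congr Num.sqrt; apply: eq_Rintegral => z _; rewrite sqrrN. Qed.

Lemma nrmB f g : inL2 f -> inL2 g -> nrm (fun z => f z - g z) <= nrm f + nrm g.
Proof. by move=> f2 g2; have := nrmD f2 (inL2N g2); rewrite nrmN. Qed.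

Lemma nrm_lt f (e : R) : 0 <= e -> \int[leb2]_z f z ^+ 2 < e ^+ 2 -> nrm f < e.
Proof. by move=> e0; rewrite -sqr_nrm ltr_pXn2r// nnegrE// nrm_ge0. Qed.

Lemma nrm_le f (e : R) : 0 <= e -> \int[leb2]_z f z ^+ 2 <= e ^+ 2 -> nrm f <= e.
Proof. by move=> e0; rewrite -sqr_nrm ler_pXn2r// nnegrE// nrm_ge0. Qed.

End L2plane.
#[global] Existing Instance ae_leb2_filter.

(** * Smooth functions and test functions *)

Section smooth_functions.
Context {R : realType}.
Implicit Types (f g phi psi : R * R -> R) (k : nat) (v : R * R).

Definition ex : R * R := (1, 0).
Definition ey : R * R := (0, 1).

Definition smooth phi : Prop := forall k, Ck k phi.

(** Reduces directional derivatives in the plane to one-variable calculus along a line. *)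
Lemma is_derive_line f z v (df : R) :
  is_derive z v f df <-> is_derive (0 : R) 1 (fun h => f (h *: v + z)) df.
Proof.
have E : (fun h : R => h^-1 *: ((f \o shift z) (h *: v) - f z)) =
  (fun h : R => h^-1 *: (((fun h => f (h *: v + z)) \o shift 0) (h *: 1) -
     (fun h => f (h *: v + z)) 0)).
  apply/funext => h /=; congr (_ *: (f _ - f _)).
    by rewrite addr0 [in RHS]/GRing.scale/= mulr1.
  by rewrite scale0r add0r.
split=> -[H1 H2]; split; move: H1 H2; rewrite /derivable /derive /=.
- by move=> H1 _; move: H1; rewrite E.
- by move=> _ <-; rewrite E.
- by move=> H1 _; rewrite E.
- by move=> _ <-; rewrite E.
Qed.

Lemma is_derive_scalar_comp (G : R -> R) f z v (dG df : R) :
  is_derive (f z) 1 G dG -> is_derive z v f df ->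
  is_derive z v (fun y => G (f y)) (dG * df).
Proof.
move=> HG /is_derive_line Hf; apply/is_derive_line.
have := @is_derive1_comp _ G (fun h => f (h *: v + z)) 0 dG df.
by rewrite scale0r add0r; exact.
Qed.

Lemma Ck_continuous k phi : Ck k phi -> continuous phi.
Proof. by case: k => [|k] []. Qed.

Lemma CkS_is_derive k phi : Ck k.+1 phi ->
  (forall z, is_derive z ex phi (Dx phi z)) /\
  (forall z, is_derive z ey phi (Dy phi z)).
Proof. by move=> [_ [h1 h2 _ _]]; split => z; apply: DeriveDef. Qed.

Lemma CkS_intro k phi a b : continuous phi ->
  (forall z, is_derive z ex phi (a z)) -> (forall z, is_derive z ey phi (b z)) ->
  Ck k a -> Ck k b -> Ck k.+1 phi.
Proof.
move=> cphi ha hb Ca Cb; split => //; split.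
- by move=> z; case: (ha z).
- by move=> z; case: (hb z).
- by have -> : Dx phi = a by apply/funext => z; case: (ha z).
- by have -> : Dy phi = b by apply/funext => z; case: (hb z).
Qed.

Lemma Ck_Dx k phi : Ck k.+1 phi -> Ck k (Dx phi).
Proof. by case=> _ []. Qed.

Lemma Ck_Dy k phi : Ck k.+1 phi -> Ck k (Dy phi).
Proof. by case=> _ []. Qed.

Lemma CkW k phi : Ck k.+1 phi -> Ck k phi.
Proof.
elim: k phi => [|k IH] phi H; first by case: H.
have [h1 h2] := CkS_is_derive H.
exact: (CkS_intro (Ck_continuous H) h1 h2 (IH _ (Ck_Dx H)) (IH _ (Ck_Dy H))).
Qed.

Lemma Ck_cst k (c : R) : Ck k (fun=> c).
Proof.
have cc (b : R) : continuous ((fun=> b) : R * R -> R) by exact: cst_continuous.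
elim: k c => [|k IH] c; first by split => //; exact: cc.
have d z v : is_derive z v ((fun=> c) : R * R -> R) 0 by exact: is_derive_cst.
exact: (CkS_intro (cc c) (d^~ ex) (d^~ ey) (IH 0) (IH 0)).
Qed.

Lemma CkD k f g : Ck k f -> Ck k g -> Ck k (fun z => f z + g z).
Proof.
elim: k f g => [|k IH] f g hf hg.
  by split => // z; apply: continuousD; [case: hf|case: hg] => c _; exact: c.
have [h1 h2] := CkS_is_derive hf; have [h3 h4] := CkS_is_derive hg.
have c : continuous (fun z => f z + g z).
  by move=> z; apply: continuousD; [exact: (Ck_continuous hf)|exact: (Ck_continuous hg)].
have d1 z : is_derive z ex (fun z => f z + g z) (Dx f z + Dx g z).
  exact: (is_deriveD (h1 z) (h3 z)).
have d2 z : is_derive z ey (fun z => f z + g z) (Dy f z + Dy g z).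
  exact: (is_deriveD (h2 z) (h4 z)).
exact: (CkS_intro c d1 d2 (IH _ _ (Ck_Dx hf) (Ck_Dx hg)) (IH _ _ (Ck_Dy hf) (Ck_Dy hg))).
Qed.

Lemma CkM k f g : Ck k f -> Ck k g -> Ck k (fun z => f z * g z).
Proof.
elim: k f g => [|k IH] f g hf hg.
  by split => // z; apply: continuousM; [case: hf|case: hg] => c _; exact: c.
have [h1 h2] := CkS_is_derive hf; have [h3 h4] := CkS_is_derive hg.
have c : continuous (fun z => f z * g z).
  by move=> z; apply: continuousM; [exact: (Ck_continuous hf)|exact: (Ck_continuous hg)].
have d1 z : is_derive z ex (fun z => f z * g z) (f z * Dx g z + g z * Dx f z).
  exact: (is_deriveM (h1 z) (h3 z)).
have d2 z : is_derive z ey (fun z => f z * g z) (f z * Dy g z + g z * Dy f z).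
  exact: (is_deriveM (h2 z) (h4 z)).
have Wf := CkW hf; have Wg := CkW hg.
apply: (CkS_intro c d1 d2).
- exact: (CkD (IH _ _ Wf (Ck_Dx hg)) (IH _ _ Wg (Ck_Dx hf))).
- exact: (CkD (IH _ _ Wf (Ck_Dy hg)) (IH _ _ Wg (Ck_Dy hf))).
Qed.

Lemma CkZ k (c : R) f : Ck k f -> Ck k (fun z => c * f z).
Proof. by move=> hf; apply: CkM => //; exact: Ck_cst. Qed.

Lemma is_derive_fst (z v : R * R) : is_derive z v fst v.1.
Proof.
apply/is_derive_line.
rewrite [X in is_derive _ _ X _](_ : _ = (fun h => h * v.1 + z.1)) //.
apply: is_derive_eq; rewrite /GRing.scale/=; ring.
Qed.

Lemma is_derive_snd (z v : R * R) : is_derive z v snd v.2.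
Proof.
apply/is_derive_line.
rewrite [X in is_derive _ _ X _](_ : _ = (fun h => h * v.2 + z.2)) //.
apply: is_derive_eq; rewrite /GRing.scale/=; ring.
Qed.

Lemma Ck_fst k : Ck k (fst : R * R -> R).
Proof.
have c : continuous (fst : R * R -> R) by move=> z; exact: cvg_fst.
case: k => [|k]; first by split.
exact: (CkS_intro c (is_derive_fst^~ ex) (is_derive_fst^~ ey)
          (Ck_cst k 1) (Ck_cst k 0)).
Qed.

Lemma Ck_snd k : Ck k (snd : R * R -> R).
Proof.
have c : continuous (snd : R * R -> R) by move=> z; exact: cvg_snd.
case: k => [|k]; first by split.
exact: (CkS_intro c (is_derive_snd^~ ex) (is_derive_snd^~ ey)
          (Ck_cst k 0) (Ck_cst k 1)).
Qed.

(* Closed under composition with a family of scalar functions stable under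
   derivation up to smooth factors. *)
Lemma Ck_scalar_comp (P : (R -> R) -> Prop) :
  (forall G, P G -> exists2 dG, P dG & forall x : R, is_derive x 1 G (dG x)) ->
  forall k G f, P G -> Ck k f -> Ck k (fun z => G (f z)).
Proof.
move=> HP; have cont G f : P G -> continuous f -> continuous (fun z => G (f z)).
  move=> PG cf z; apply: continuous_comp; first exact: cf.
  have [dG _ hG] := HP _ PG.
  by apply: differentiable_continuous; apply/derivable1_diffP; case: (hG (f z)).
elim => [|k IH] G f PG hf; first by split => //; apply: cont => //; case: hf.
have [dG PdG hG] := HP _ PG.
have [h1 h2] := CkS_is_derive hf; have Wf := CkW hf.
have d1 z : is_derive z ex (fun z => G (f z)) (dG (f z) * Dx f z).
  exact: is_derive_scalar_comp.
have d2 z : is_derive z ey (fun z => G (f z)) (dG (f z) * Dy f z).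
  exact: is_derive_scalar_comp.
apply: (CkS_intro (cont _ _ PG (Ck_continuous hf)) d1 d2).
- exact: (CkM (IH _ _ PdG Wf) (Ck_Dx hf)).
- exact: (CkM (IH _ _ PdG Wf) (Ck_Dy hf)).
Qed.

End smooth_functions.

(** * Smooth functions flat at the origin *)

Section bump.
Context {R : realType}.
Implicit Types (p : {poly R}) (s t : R).

Lemma is_derive_le_sqr (C : R) (f : R -> R) :
  (forall h, `|h| <= 1 -> `|f h| <= C * h ^+ 2) -> is_derive (0 : R) 1 f 0.
Proof.
move=> fC; have f0 : f 0 = 0.
  by apply/eqP; have := fC 0; rewrite normr0 ler01 expr0n mulr0 normr_le0; apply.
have L : (fun h : R => h^-1 *: ((f \o shift 0) (h *: 1) - f 0)) @ 0^' --> (0 : R).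
  apply/cvgr0Pnorm_le => e e0; near=> h.
  have h0 : h != 0 by near: h; exact: nbhs_dnbhs_neq.
  rewrite f0 subr0 /= addr0 [h *: 1]mulr1 normrM normfV.
  rewrite ler_pdivrMl ?normr_gt0//.
  have h1 : `|h| <= 1 by near: h; exact: dnbhs0_le.
  rewrite (le_trans (fC h h1))//.
  rewrite -real_normK ?num_real// expr2 mulrCA ler_wpM2l//.
  have C1 : 0 < `|C| + 1 by rewrite ltr_wpDl.
  apply: (@le_trans _ _ ((`|C| + 1) * `|h|)).
    by rewrite ler_wpM2r// (le_trans (ler_norm _))// lerDl.
  rewrite -ler_pdivlMl//; near: h; apply: dnbhs0_le.
  by rewrite mulr_gt0 ?invr_gt0.
apply: DeriveDef; first by apply/cvg_ex; exists 0.
exact/cvg_lim.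
Unshelve. all: by end_near. Qed.

(** The classical [exp (- 1 / t)], continued by 0; the polynomial in [1 / t] makes the family stable
    under derivation. *)
Definition flat p t : R :=
  if 0 < t then p.[t^-1] * expR (- t^-1) else 0.

Lemma poly_le_expR p n : exists C : R, 0 <= C /\
  forall s, 0 < s -> `|p.[s]| * s ^+ n <= C * expR s.
Proof.
elim/poly_ind: p n => [|p c IH] n.
  exists 0; split => // s s0; by rewrite horner0 normr0 !mul0r.
have [C [C0 HC]] := IH n.+1.
have key s : 0 < s -> s ^+ n <= n`!%:R * expR s.
  move=> s0; case: n {IH HC} => [|n].
    by rewrite expr0 mul1r; rewrite (le_trans _ (expR_ge1Dx s))// lerDl ltW.
  have := expR_ge1Dxn n (ltW s0).
  rewrite -ler_pdivrMl ?ltr0n ?fact_gt0// mulrC.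
  by apply: le_trans; rewrite lerDr.
exists (C + `|c| * n`!%:R); split; first by rewrite addr_ge0 // mulr_ge0.
move=> s s0; rewrite hornerMXaddC mulrDl.
apply: (@le_trans _ _ ((`|p.[s]| * s + `|c|) * s ^+ n)).
  apply: ler_wpM2r; first by rewrite exprn_ge0// ltW.
  by rewrite (le_trans (ler_normD _ _))// normrM (gtr0_norm s0).
rewrite mulrDl; apply: lerD; first by rewrite -mulrA -exprS HC.
by rewrite -mulrA ler_wpM2l// key.
Qed.

Lemma is_derive_flat p t :
  is_derive t 1 (flat p) (flat ('X^2 * (p - p^`())) t).
Proof.
have [t0|t0|->] := ltgtP t 0.
- rewrite /flat ltNge (ltW t0)/=.
  have d0 : is_derive t 1 (cst 0 : R -> R) 0 by exact: is_derive_cst.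
  apply: near_eq_is_derive d0.
  near=> x => /=; rewrite ltNge.
  suff -> : x <= 0 by [].
  by apply: ltW; near: x; exact: lt_nbhsl.
- rewrite /flat t0.
  have dinv : is_derive t 1 (fun x : R => x^-1) (- t ^- 2).
    have := @is_deriveV R id t 1 1 _ (is_derive_id _ _).
    by rewrite /GRing.scale /= mulr1; apply; rewrite gt_eqF.
  have d1 : is_derive t 1 (fun x : R => p.[x^-1]) (p^`().[t^-1] * - t ^- 2).
    have dp := @is_derive_poly R p (t^-1).
    exact: (@is_derive1_comp _ (horner p) (fun x : R => x^-1) t).
  have d2 : is_derive t 1 (fun x : R => expR (- x^-1)) (expR (- t^-1) * t ^- 2).
    have H := @is_deriveN _ _ _ _ _ _ _ dinv.
    have := @is_derive1_comp _ expR (fun x : R => - x^-1) t _ _ (is_derive_expR _) H.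
    by rewrite opprK.
  have d3 : is_derive t 1 (fun x : R => p.[x^-1] * expR (- x^-1))
      (('X^2 * (p - p^`())).[t^-1] * expR (- t^-1)).
    apply: (is_derive_eq (is_deriveM d1 d2)).
    rewrite hornerM hornerD hornerN hornerXn /GRing.scale /= exprVn; ring.
  apply: near_eq_is_derive d3.
  near=> x; suff -> : 0 < x by [].
  by near: x; exact: lt_nbhsr.
have -> : flat ('X^2 * (p - p^`())) 0 = 0 by rewrite /flat ltxx.
(* At the origin the product rule is replaced by a quadratic bound, which forces the derivative
   0. *)
have [C [C0 HC]] := poly_le_expR p 2.
apply: (@is_derive_le_sqr C) => h _; rewrite /flat.
case: ifPn => [h0|_]; last by rewrite normr0 mulr_ge0// sqr_ge0.
have hi : 0 < h^-1 by rewrite invr_gt0.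
rewrite normrM (ger0_norm (expR_ge0 _)) expRN ler_pdivrMr ?expR_gt0//.
have := HC _ hi; rewrite exprVn ler_pdivrMr ?exprn_gt0//.
by rewrite mulrAC.
Unshelve. all: by end_near. Qed.

Lemma Ck_flat k p (f : R * R -> R) : Ck k f -> Ck k (fun z => flat p (f z)).
Proof.
apply: (@Ck_scalar_comp _ (fun G => exists q, G = flat q)); last by exists p.
move=> _ [q ->]; exists (flat ('X^2 * (q - q^`()))); first by eexists.
by move=> x; exact: is_derive_flat.
Qed.

Lemma flat1_ge0 t : 0 <= flat 1 t.
Proof. by rewrite /flat; case: ifP => // _; rewrite hornerC mul1r expR_ge0. Qed.

Lemma flat1_le1 t : flat 1 t <= 1.
Proof.
rewrite /flat; case: ifPn => // t0; rewrite hornerC mul1r expR_le1.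
by rewrite oppr_le0 invr_ge0 ltW.
Qed.

(** Smooth functions thus converge boundedly to the indicator of an open half-line, the first step
    towards density in L^2. *)
Lemma flat1_cvg t : (fun n => flat 1 (n%:R * t)) @ \oo --> ((0 < t)%R%:R : R).
Proof.
have [t0|t0] := ltP 0 t; last first.
  rewrite (_ : (fun n => _) = fun=> 0); first exact: cvg_cst.
  by apply/funext => n; rewrite /flat ltNge pmulrn mulr_ge0_le0.
rewrite -(cvg_shiftS _) /=.
rewrite (_ : (fun n => _) = fun n => expR (- (t^-1 * n.+1%:R^-1))); last first.
  apply/funext => n; rewrite /flat mulr_gt0 ?ltr0n// hornerC mul1r.
  by rewrite invfM mulrC.
have H : (fun n => - (t^-1 * n.+1%:R^-1)) @ \oo --> (- (t^-1 * 0) : R).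
  by apply: cvgN; apply: cvgMr; exact: cvg_harmonic.
have E : expR (- (t^-1 * 0)) = true%:R :> R by rewrite mulr0 oppr0 expR0.
by rewrite -E; apply: (continuous_cvg _ (@continuous_expR R _) H).
Qed.

End bump.

(** * Operations on test functions and equality of mixed derivatives *)

Section test_functions.
Context {R : realType}.
Implicit Types (f g phi psi : R * R -> R) (k : nat) (v w z : R * R).

Definition boxed (N : R) phi : Prop :=
  forall z, (N < `|z.1|) || (N < `|z.2|) -> phi z = 0.

Lemma boxed_le N N' phi : N <= N' -> boxed N phi -> boxed N' phi.
Proof.
by move=> NN' h z /orP[]H; apply: h; rewrite (le_lt_trans NN' H) ?orbT.
Qed.

(** Supports are handled through boxes, which behave well under sums, products, derivatives and
    translations. *)
Lemma test_functionP phi :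
  test_function phi <-> smooth phi /\ exists N, boxed N phi.
Proof.
split=> -[sm H]; split => //.
  have [M [_ HM]] := compact_bounded H.
  exists (M + 1) => z zN; apply/eqP/negP => /negP phiz0.
  have : `|z| <= M + 1.
    by apply: (HM (M + 1)); [rewrite ltrDl|exact: subset_closure].
  by rewrite /Num.norm/= ge_max => /andP[h1 h2]; move: zN; rewrite !ltNge h1 h2.
case: H => N HN.
have cK : compact (`[- N, N] `*` `[- N, N] : set (R * R)).
  by apply: compact_setX; exact: segment_compact.
apply: (subclosed_compact _ cK); first exact: closed_closure.
have /closure_id -> : closed (`[- N, N] `*` `[- N, N] : set (R * R)).
  by apply: compact_closed cK; exact: norm_hausdorff.
apply: closure_subset => z /= phiz0.
rewrite !in_itv/= -!ler_norml; apply/andP; rewrite !leNgt -negb_or.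
by apply: contra phiz0 => /HN ->.
Qed.

Lemma smooth_Dx phi : smooth phi -> smooth (Dx phi).
Proof. by move=> sm k; exact: Ck_Dx (sm k.+1). Qed.

Lemma smooth_Dy phi : smooth phi -> smooth (Dy phi).
Proof. by move=> sm k; exact: Ck_Dy (sm k.+1). Qed.

Lemma smoothM phi psi : smooth phi -> smooth psi -> smooth (fun z => phi z * psi z).
Proof. by move=> h1 h2 k; exact: CkM. Qed.

Lemma is_derive_Dx phi z : smooth phi -> is_derive z ex phi (Dx phi z).
Proof. by move=> /(_ 1%N) /CkS_is_derive[h _]. Qed.

Lemma is_derive_Dy phi z : smooth phi -> is_derive z ey phi (Dy phi z).
Proof. by move=> /(_ 1%N) /CkS_is_derive[_ h]. Qed.

Lemma boxed_derive N phi v z : boxed N phi ->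
  (N < `|z.1|) || (N < `|z.2|) -> 'D_v phi z = 0.
Proof.
move=> HN zN.
have d0 : is_derive z v ((fun=> 0) : R * R -> R) 0 by exact: is_derive_cst.
have [_ <-] := d0; apply: near_eq_derive.
case/orP : zN => zN.
- have : \forall y \near z, N < `|y.1|.
    have c : continuous (fun y : R * R => `|y.1|).
      by move=> y; apply: continuous_comp; [exact: cvg_fst|exact: norm_continuous].
    exact: (c z (fun x => N < x) (lt_nbhsr zN)).
  by apply: filterS => y yN; rewrite HN// yN.
- have : \forall y \near z, N < `|y.2|.
    have c : continuous (fun y : R * R => `|y.2|).
      by move=> y; apply: continuous_comp; [exact: cvg_snd|exact: norm_continuous].
    exact: (c z (fun x => N < x) (lt_nbhsr zN)).
  by apply: filterS => y yN; rewrite HN// yN orbT.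
Qed.

Lemma is_derive_translate phi z w v (d : R) : is_derive (z + w) v phi d ->
  is_derive z v (fun y => phi (y + w)) d.
Proof.
move=> /is_derive_line H; apply/is_derive_line.
by rewrite (_ : (fun h => _) = (fun h => phi (h *: v + (z + w))))//;
  apply/funext => h; rewrite addrA.
Qed.

Lemma Ck_translate k phi w : Ck k phi -> Ck k (fun y => phi (y + w)).
Proof.
elim: k phi => [|k IH] phi h; have c := Ck_continuous h;
  have ct : continuous (fun y : R * R => phi (y + w)) by
    move=> z; apply: continuous_comp; [exact: (cvgD cvg_id (cvg_cst _))|exact: c].
  by split.
have [h1 h2] := CkS_is_derive h.
have d1 z : is_derive z ex (fun y => phi (y + w)) (Dx phi (z + w)).
  exact: is_derive_translate.
have d2 z : is_derive z ey (fun y => phi (y + w)) (Dy phi (z + w)).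
  exact: is_derive_translate.
exact: (CkS_intro ct d1 d2 (IH _ (Ck_Dx h)) (IH _ (Ck_Dy h))).
Qed.

Lemma test_Dx phi : test_function phi -> test_function (Dx phi).
Proof.
move=> /test_functionP[sm [N HN]]; apply/test_functionP; split.
  exact: smooth_Dx.
by exists N => z; exact: boxed_derive.
Qed.

Lemma test_Dy phi : test_function phi -> test_function (Dy phi).
Proof.
move=> /test_functionP[sm [N HN]]; apply/test_functionP; split.
  exact: smooth_Dy.
by exists N => z; exact: boxed_derive.
Qed.

Lemma test_smoothM m phi : smooth m -> test_function phi ->
  test_function (fun z => m z * phi z).
Proof.
move=> sm /test_functionP[sp [N HN]]; apply/test_functionP; split.
  exact: smoothM.
by exists N => z /HN ->; rewrite mulr0.
Qed.

Lemma testD phi psi : test_function phi -> test_function psi ->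
  test_function (fun z => phi z + psi z).
Proof.
move=> /test_functionP[s1 [N1 h1]] /test_functionP[s2 [N2 h2]].
apply/test_functionP; split; first by move=> k; exact: CkD.
exists (Num.max N1 N2) => z zN.
have zN1 : boxed (Num.max N1 N2) phi by apply: boxed_le h1; rewrite le_max lexx.
have zN2 : boxed (Num.max N1 N2) psi.
  by apply: boxed_le h2; rewrite le_max lexx orbT.
by rewrite zN1// zN2// addr0.
Qed.

Lemma testZ c phi : test_function phi -> test_function (fun z => c * phi z).
Proof. by move=> H; apply: (test_smoothM _ H) => k; exact: Ck_cst. Qed.

Lemma test_translate phi w : test_function phi ->
  test_function (fun y => phi (y + w)).
Proof.
move=> /test_functionP[sm [N HN]]; apply/test_functionP; split.
  by move=> k; exact: Ck_translate.
exists (N + `|w|) => z zN; apply: HN.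
have w1 : `|w.1| <= `|w| by rewrite [leRHS]/Num.norm/= le_max lexx.
have w2 : `|w.2| <= `|w| by rewrite [leRHS]/Num.norm/= le_max lexx orbT.
case/orP : zN => zN; apply/orP; [left|right].
- rewrite -(ltrD2r `|w|) (lt_le_trans zN)//= -[in leLHS](addrK w.1 z.1).
  by rewrite (le_trans (ler_normB _ _))// lerD2l.
- rewrite -(ltrD2r `|w|) (lt_le_trans zN)//= -[in leLHS](addrK w.2 z.2).
  by rewrite (le_trans (ler_normB _ _))// lerD2l.
Qed.

Lemma line_MVT phi v z (a b : R) (dphi : R * R -> R) : a < b ->
  (forall y, is_derive y v phi (dphi y)) ->
  exists2 c, a < c < b & phi (b *: v + z) - phi (a *: v + z) = dphi (c *: v + z) * (b - a).
Proof.
move=> ab H.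
have D (x : R) : is_derive x 1 (fun h : R => phi (h *: v + z)) (dphi (x *: v + z)).
  have /is_derive_line Hx := H (x *: v + z).
  have := @is_derive1_comp _ (fun h => phi (h *: v + (x *: v + z))) (fun h : R => h - x) x (dphi (x *: v + z)) 1.
  rewrite subrr => /(_ Hx); rewrite mulr1 => K.
  rewrite (_ : (fun h => _) = (fun h => phi (h *: v + (x *: v + z))) \o (fun h => h - x)).
    by apply: K; apply: is_derive_eq; rewrite subr0.
  by apply/funext => h /=; rewrite scalerBl addrA subrK.
have cont : {within `[a, b], continuous (fun h : R => phi (h *: v + z))}.
  apply: continuous_subspaceT => x.
  by apply: differentiable_continuous; apply/derivable1_diffP; case: (D x).
have [c cab E] := MVT ab (fun x _ => D x) cont.
by exists c => //; move: cab; rewrite in_itv.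
Qed.

(* Both mixed derivatives are limits of the same second difference quotient. *)
Lemma second_difference phi px py pxy pyx z (h : R) : 0 < h ->
  (forall y, is_derive y ex phi (px y)) -> (forall y, is_derive y ey phi (py y)) ->
  (forall y, is_derive y ey px (pxy y)) -> (forall y, is_derive y ex py (pyx y)) ->
  exists c d : R * R,
    [/\ 0 < c.1 < h, 0 < c.2 < h, 0 < d.1 < h, 0 < d.2 < h &
     pxy (z + c) = pyx (z + d)].
Proof.
move=> h0 hx hy hxy hyx; pose S (s t : R) := phi (s *: ex + (t *: ey + z)).
have S' s t : S s t = phi (t *: ey + (s *: ex + z)) by rewrite /S addrCA.
have [c1 c1h E1] : exists2 c, 0 < c < h &
    S h h - S h 0 - (S 0 h - S 0 0) =
    (px (h *: ey + (c *: ex + z)) - px (c *: ex + z)) * (h - 0).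
  pose F (y : R * R) := phi (y + h *: ey) - phi y.
  have dF y : is_derive y ex F (px (y + h *: ey) - px y).
    exact: (is_deriveB (is_derive_translate (hx _)) (hx y)).
  have [c ch E] := @line_MVT F ex z 0 h _ h0 dF.
  exists c => //; rewrite [h *: ey + _]addrC -E /F /S !scale0r !add0r.
  by rewrite -!addrA ![z + _]addrC; ring.
have [c2 c2h E2] := @line_MVT px ey (c1 *: ex + z) 0 h _ h0 hxy.
have [d2 d2h E3] : exists2 c, 0 < c < h &
    S h h - S h 0 - (S 0 h - S 0 0) =
    (py (h *: ex + (c *: ey + z)) - py (c *: ey + z)) * (h - 0).
  pose F (y : R * R) := phi (y + h *: ex) - phi y.
  have dF y : is_derive y ey F (py (y + h *: ex) - py y).
    exact: (is_deriveB (is_derive_translate (hy _)) (hy y)).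
  have [c ch E] := @line_MVT F ey z 0 h _ h0 dF.
  exists c => //; rewrite [h *: ex + _]addrC -E /F !S' !scale0r !add0r.
  by rewrite -!addrA ![z + _]addrC; ring.
have [d1 d1h E4] := @line_MVT py ex (d2 *: ey + z) 0 h _ h0 hyx.
exists (c1, c2), (d1, d2); split; [exact: c1h|exact: c2h|exact: d1h|exact: d2h|].
have hn0 : h != 0 by rewrite gt_eqF.
rewrite scale0r add0r subr0 in E2; rewrite scale0r add0r subr0 in E4.
rewrite subr0 in E1; rewrite subr0 in E3.
have : pxy (c2 *: ey + (c1 *: ex + z)) * h * h =
       pyx (d1 *: ex + (d2 *: ey + z)) * h * h.
  by rewrite -E2 -E4 -E1 -E3.
move=> /(mulIf hn0)/(mulIf hn0).
have pE (a b : R) : a *: ex + (b *: ey + z) = z + (a, b).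
  apply/pair_equal_spec; split; rewrite /= /GRing.scale/=; ring.
have -> : c2 *: ey + (c1 *: ex + z) = z + (c1, c2) by rewrite addrCA pE.
by rewrite pE.
Qed.

(** At each scale [h] the two mixed derivatives agree at two points within [h] of [z]; continuity at
    [z] concludes. *)
Lemma Dx_Dy phi z : Ck 2 phi -> Dx (Dy phi) z = Dy (Dx phi) z.
Proof.
move=> C2; have C1 := CkW C2.
have [hx hy] := CkS_is_derive C1.
have [hxx hxy] := CkS_is_derive (Ck_Dx C2).
have [hyx hyy] := CkS_is_derive (Ck_Dy C2).
have cxy := Ck_continuous (Ck_Dy (Ck_Dx C2)).
have cyx := Ck_continuous (Ck_Dx (Ck_Dy C2)).
apply/eqP; rewrite eq_sym -subr_eq0 -normr_le0; apply/ler_addgt0Pl => e e0.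
rewrite addr0.
have /cvgr_dist_lt /(_ (e / 2)) := cxy z; have /cvgr_dist_lt /(_ (e / 2)) := cyx z.
rewrite divr_gt0//= => /(_ isT) + /(_ isT).
move=> /nbhs_ballP[r1 /= r10 H1] /nbhs_ballP[r2 /= r20 H2].
pose h := Num.min r1 r2.
have h0 : 0 < h by rewrite lt_min r10.
have [c [d [c1 c2 d1 d2 E]]] := second_difference z h0 hx hy hxy hyx.
have ball1 (r : R) (a : R * R) : h <= r -> 0 < a.1 < h -> 0 < a.2 < h ->
    ball z r (z + a).
  move=> hr /andP[a10 a1] /andP[a20 a2].
  rewrite -ball_normE /= opprD addNKr normrN /Num.norm/= gt_max.
  by rewrite (gtr0_norm a10) (gtr0_norm a20) (lt_le_trans a1 hr) (lt_le_trans a2 hr).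
have hr1 : h <= r1 by rewrite ge_min lexx.
have hr2 : h <= r2 by rewrite ge_min lexx orbT.
have K1 := H1 (z + d) (ball1 _ _ hr1 d1 d2).
have K2 := H2 (z + c) (ball1 _ _ hr2 c1 c2).
move: K1 K2 E => /=.
move: (Dx (Dy phi) z) (Dx (Dy phi) (z + d)) (Dy (Dx phi) z) (Dy (Dx phi) (z + c)).
move=> a a' b b' K1 K2 E.
have -> : b - a = (b - b') - (a - a') by rewrite E; ring.
by rewrite (le_trans (ler_normB _ _))// [e]splitr lerD// ltW.
Qed.

End test_functions.

(** * Borel sets of the plane and essential supports *)

Section plane_measurability.
Context {R : realType}.
Local Notation T2 := (measurableTypeR R * measurableTypeR R)%type.

Definition rect (a b c d : R) : set (R * R) :=
  [set z | a < z.1 < b /\ c < z.2 < d].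

Definition rat_rect (q : (rat * rat) * (rat * rat)) : set (R * R) :=
  rect (ratr q.1.1) (ratr q.1.2) (ratr q.2.1) (ratr q.2.2).

Lemma measurable_rect a b c d : measurable (rect a b c d : set T2).
Proof.
rewrite (_ : rect a b c d = `]a, b[%classic `*` `]c, d[%classic).
  by apply: measurableX; exact: measurable_itv.
by apply/seteqP; split => z /=; rewrite !in_itv.
Qed.

Lemma open_rat_rect (U : set (R * R)) z : open U -> U z ->
  exists q, rat_rect q z /\ rat_rect q `<=` U.
Proof.
move=> oU Uz; have := open_nbhs_nbhs (conj oU Uz).
move=> /nbhs_ballP[e /= e0 eU].
have ra (x : R) : exists q1 q2 : rat, [/\ x - e < ratr q1, ratr q1 < x,
    x < ratr q2 & ratr q2 < x + e].
  have [q1 ] : exists q : rat, ratr q \in `]x - e, x[%R.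
    by apply: rat_in_itvoo; rewrite ltrBlDr ltrDl.
  have [q2 ] : exists q : rat, ratr q \in `]x, x + e[%R.
    by apply: rat_in_itvoo; rewrite ltrDl.
  by rewrite !in_itv/= => /andP[? ?] /andP[? ?]; exists q1, q2.
have [a [b [h1 h2 h3 h4]]] := ra z.1.
have [c [d [k1 k2 k3 k4]]] := ra z.2.
exists ((a, b), (c, d)); split.
  by split => /=; apply/andP.
move=> y [/= /andP[y1 y2] /andP[y3 y4]]; apply: eU.
split; rewrite /ball /= ltr_distlC; apply/andP; split.
- exact: lt_trans y1.
- exact: lt_trans h4.
- exact: lt_trans y3.
- exact: lt_trans k4.
Qed.

Lemma open_measurable2 (U : set (R * R)) : open U -> measurable (U : set T2).
Proof.
move=> oU; have -> : U = \bigcup_(q in [set: (rat * rat) * (rat * rat)])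
    (if `[< rat_rect q `<=` U >] then rat_rect q else set0).
  apply/seteqP; split.
    move=> z Uz; have [q [qz qU]] := open_rat_rect oU Uz.
    by exists q => //; case: asboolP.
  by move=> z [q _]; case: asboolP => // H; exact: H.
apply: countable_bigcupT_measurable; first exact: countableP.
by move=> q; case: ifP => _; [exact: measurable_rect|exact: measurable0].
Qed.

Lemma continuous_measurable2 (f : R * R -> R) : continuous f ->
  measurable_fun [set: T2] f.
Proof.
move=> cf; apply: (measurability _ (RGenOInfty.measurableE R)).
move=> /= _ [_ [a ->]] <-; rewrite setTI; apply: open_measurable2.
by apply: open_comp => //; exact: interval_open.
Qed.

(** The complement of the essential support is a union of possibly uncountably many open sets where
    [f] is a.e. zero. Rational rectangles inside them form a countable cover, so the exceptional
    null sets can be united. *)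
Lemma ess_supp_ae0 (f : R * R -> R) (A : set (R * R)) : ess_supp f `<=` A ->
  {ae leb2, forall z, ~ A z -> f z = 0}.
Proof.
move=> fA; pose P (U : set (R * R)) := {ae leb2, forall z, U z -> f z = 0}.
have H n : {ae leb2, forall z, forall q, unpickle n = Some q ->
    P (rat_rect q) -> rat_rect q z -> f z = 0}.
  case: (unpickle n) => [q|]; last by apply: aeW.
  have [Pq|nPq] := pselect (P (rat_rect q)).
    by apply: ae2_imp Pq => z h _ [<-] _; exact: h.
  by apply: aeW => z _ [<-].
have K := ae_foralln H; apply: ae2_imp K => z Kz nAz.
have : ~ ess_supp f z by move=> /fA.
rewrite /ess_supp /= => /contrapT[U [oU PU] Uz].
have [q [qz qU]] := open_rat_rect oU Uz.
apply: (Kz (pickle q) q) => //; first by rewrite pickleK.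
by apply: ae2_imp PU => y h /qU.
Qed.

End plane_measurability.

(** * Density of test functions in L^2 *)

Section test_density.
Context {R : realType}.
Local Notation T2 := (measurableTypeR R * measurableTypeR R)%type.
Implicit Types (f g phi : R * R -> R).

Lemma L2_dominated_cvg (F : nat -> R * R -> R) f g :
  (forall n, measurable_fun [set: T2] (F n)) -> inL2 g ->
  (forall n z, `|F n z| <= g z) -> (forall z, F n z @[n --> \oo] --> f z) ->
  inL2 f /\ \int[leb2]_z (f z - F n z) ^+ 2 @[n --> \oo] --> (0 : R).
Proof.
move=> mF g2 Fg Ff.
have fg z : `|f z| <= g z.
  have c : `|F n z| @[n --> \oo] --> `|f z| by apply: cvg_norm; exact: Ff.
  rewrite -(cvg_lim _ c)//; apply: limr_le; first by apply/cvg_ex; exists `|f z|.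
  by apply: nearW => n; exact: Fg.
have g0 z : 0 <= g z by rewrite (le_trans _ (fg z)).
have mf : measurable_fun [set: T2] f.
  by apply: (measurable_fun_cvg mF) => z _; exact: Ff.
have f2 : inL2 f by apply: (inL2_le mf g2) => z; rewrite (ger0_norm (g0 z)).
split => //.
have gi : integrable2 (fun z => 4 * g z ^+ 2) by apply: integrable2Z; exact: inL2_sqr.
have mh n : measurable_fun [set: T2] (fun z => (f z - F n z) ^+ 2).
  by apply: measurable_funX; apply: measurable_funB.
have hg n z : `|(f z - F n z) ^+ 2| <= 4 * g z ^+ 2.
  rewrite normrX (_ : 4 * g z ^+ 2 = (2 * g z) ^+ 2); last by ring.
  rewrite lerXn2r ?nnegrE ?mulr_ge0// (le_trans (ler_normB _ _))//.
  by rewrite mulr2n mulrDl mul1r lerD.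
have h0 z : (f z - F n z) ^+ 2 @[n --> \oo] --> (0 : R).
  rewrite -[X in _ --> X](_ : (f z - f z) * (f z - f z) = 0); last first.
    by rewrite subrr mul0r.
  under eq_fun do rewrite expr2.
  by apply: cvgM; apply: cvgB => //; exact: cvg_cst.
have := @dominated_convergence _ _ _ (@leb2 R) setT measurableT
  (fun n z => ((f z - F n z) ^+ 2)%:E) (cst 0%E) (fun z => (4 * g z ^+ 2)%:E).
case.
- by move=> n; exact/measurable_EFinP.
- exact: measurable_cst.
- by apply: aeW => z _ /=; apply/fine_cvgP; split; [exact: nearW|exact: h0].
- exact: gi.
- by apply: aeW => z n _ /=; rewrite lee_fin.
move=> _ _; rewrite integral0 => /fine_cvgP[_].
by apply: cvg_trans.
Qed.

(** Membership in the L^2 closure of the test functions, shown below to hold for every [f] in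
    L^2. *)
Definition test_approx f : Prop := inL2 f /\ forall e : R, 0 < e ->
  exists2 phi, test_function phi & \int[leb2]_z (f z - phi z) ^+ 2 < e.

Lemma int2_sqrB_le f g (h : R * R -> R) : inL2 f -> inL2 g -> inL2 h ->
  \int[leb2]_z (f z - h z) ^+ 2 <=
  2 * \int[leb2]_z (f z - g z) ^+ 2 + 2 * \int[leb2]_z (g z - h z) ^+ 2.
Proof.
move=> f2 g2 h2.
have i1 := inL2_sqr (inL2B f2 g2); have i2 := inL2_sqr (inL2B g2 h2).
rewrite -!int2Z// -int2D; [|exact: integrable2Z..].
apply: int2_le => [||z]; first exact: (inL2_sqr (inL2B f2 h2)).
  by apply: integrable2D; exact: integrable2Z.
by rewrite -subr_ge0; have := sqr_ge0 (f z - g z - (g z - h z)); lra.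
Qed.

Lemma leb2X (A B : set R) : measurable (A : set (measurableTypeR R)) ->
  measurable (B : set (measurableTypeR R)) ->
  leb2 (A `*` B) = (lebesgue_measure A * lebesgue_measure B)%E.
Proof. by move=> mA mB; exact: product_measure1E. Qed.

Lemma leb2_rect_lty (a b c d : R) : (leb2 (rect a b c d) < +oo)%E.
Proof.
rewrite (_ : rect a b c d = `]a, b[%classic `*` `]c, d[%classic).
  rewrite leb2X//; try exact: measurable_itv.
  by rewrite !lebesgue_measure_itv/=; do 2 case: ifP => _;
    rewrite -?EFinD -?EFinM ?mule0 ?mul0e ltry.
by apply/seteqP; split => z /=; rewrite !in_itv.
Qed.

Lemma integrable2_indic (A : set (R * R)) : measurable (A : set T2) ->
  (leb2 A < +oo)%E -> integrable2 (\1_A).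
Proof.
move=> mA Afin; apply/integrableP; split.
  by apply/measurable_EFinP; exact: measurable_indic.
have -> : (\int[leb2]_z `|(EFin \o \1_A) z| = \int[leb2]_z (\1_A z)%:E)%E.
  by apply: eq_integral => z _; rewrite gee0_abs// lee_fin.
by rewrite integral_indic// setIT.
Qed.

Lemma indic1 (A : set (R * R)) z : A z -> \1_A z = 1 :> R.
Proof. by move=> Az; rewrite indicE mem_set. Qed.

Lemma indic0z (A : set (R * R)) z : ~ A z -> \1_A z = 0 :> R.
Proof. by move=> Az; rewrite indicE memNset. Qed.

Lemma indic_sqr (A : set (R * R)) z : (\1_A z) ^+ 2 = \1_A z :> R.
Proof. by rewrite indicE; case: (_ \in _); rewrite ?expr1n ?expr0n. Qed.

Lemma inL2_indic (A : set (R * R)) : measurable (A : set T2) ->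
  (leb2 A < +oo)%E -> inL2 (\1_A).
Proof.
move=> mA Afin; apply: inL2P; first exact: measurable_indic.
by under eq_fun do rewrite indic_sqr; exact: integrable2_indic.
Qed.

Lemma rect_boxed (N N' : R) f : boxed N f -> N < N' -> forall z, f z != 0 ->
  rect (- N') N' (- N') N' z.
Proof.
move=> fN NN' z fz; rewrite /rect /= -!ltr_norml; apply/andP; rewrite !ltNge -negb_or.
apply: contra fz => /orP zN'; apply/eqP/fN/orP.
by case: zN' => h; [left|right]; exact: lt_le_trans h.
Qed.

Lemma boxed_inL2 (N C : R) f : measurable_fun [set: T2] f -> boxed N f ->
  (forall z, `|f z| <= C) -> inL2 f.
Proof.
move=> mf fN fC; pose N' := Num.max N 0 + 1.
have NN' : N < N' by rewrite ltr_pwDr// le_max lexx.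
have mr := measurable_rect (- N') N' (- N') N'.
have muf := leb2_rect_lty (- N') N' (- N') N'.
apply: (@inL2_le _ _ (fun z => C * \1_(rect (- N') N' (- N') N') z)) => //.
  by apply: inL2Z; exact: inL2_indic.
move=> z; have [->|fz] := eqVneq (f z) 0; first by rewrite normr0.
rewrite indicE mem_set ?mulr1; last exact: rect_boxed NN' z fz.
by rewrite (le_trans (fC z))// ler_norm.
Qed.

Lemma test_bounded phi : test_function phi -> exists C, forall z, `|phi z| <= C.
Proof.
move=> /test_functionP[sm [N HN]].
have cK : compact (`[- N, N] `*` `[- N, N] : set (R * R)).
  by apply: compact_setX; exact: segment_compact.
have cphi : continuous phi := Ck_continuous (sm 0%N).
have [M [_ HM]] := compact_bounded (continuous_compact (continuous_subspaceT cphi) cK).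
exists (`|M| + 1) => z.
have [->|fz] := eqVneq (phi z) 0; first by rewrite normr0 addr_ge0.
apply: (HM (`|M| + 1)); first by rewrite (le_lt_trans (ler_norm _))// ltrDl.
exists z => //=; rewrite !in_itv/= -!ler_norml; apply/andP; rewrite !leNgt -negb_or.
by apply: contra fz => /HN ->.
Qed.

Lemma test_inL2 phi : test_function phi -> inL2 phi.
Proof.
move=> tphi; have [C HC] := test_bounded tphi.
case/test_functionP : tphi => sm [N HN]; apply: (boxed_inL2 _ HN HC).
by apply: continuous_measurable2; exact: (Ck_continuous (sm 0%N)).
Qed.

Lemma test_approx_lim f : inL2 f ->
  (forall e : R, 0 < e -> exists2 g, test_approx g &
     \int[leb2]_z (f z - g z) ^+ 2 < e) -> test_approx f.
Proof.
move=> f2 H; split => // e e0.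
have e4 : 0 < e / 4 by rewrite divr_gt0.
have [g [g2 /(_ _ e4)[phi tphi g_phi]] fg] := H _ e4.
exists phi => //; apply: (le_lt_trans (int2_sqrB_le f2 g2 (test_inL2 tphi))).
by lra.
Qed.

Lemma test_approxB f g : test_approx f -> test_approx g ->
  test_approx (fun z => f z - g z).
Proof.
move=> [f2 hf] [g2 hg]; split; first exact: inL2B.
move=> e e0; have e4 : 0 < e / 4 by rewrite divr_gt0.
have [p tp hp] := hf _ e4; have [q tq hq] := hg _ e4.
have p2 := test_inL2 tp; have q2 := test_inL2 tq.
exists (fun z => p z + (-1) * q z); first by apply: testD => //; exact: testZ.
have i1 := inL2_sqr (inL2B f2 p2); have i2 := inL2_sqr (inL2B g2 q2).
apply: (@le_lt_trans _ _ (2 * \int[leb2]_z (f z - p z) ^+ 2 +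
    2 * \int[leb2]_z (g z - q z) ^+ 2)); last by lra.
rewrite -!int2Z// -int2D; [|exact: integrable2Z..].
apply: int2_le => [||z].
- by apply: inL2_sqr; apply: inL2B; [exact: inL2B|apply: inL2D => //; exact: inL2Z].
- by apply: integrable2D; exact: integrable2Z.
- by rewrite -subr_ge0; have := sqr_ge0 (f z - p z + (g z - q z)); lra.
Qed.

Lemma test_approxZ (c : R) f : test_approx f -> test_approx (fun z => c * f z).
Proof.
move=> [f2 hf]; split; first exact: inL2Z.
move=> e e0; have c1 : 0 < c ^+ 2 + 1 by rewrite ltr_wpDl// sqr_ge0.
have [p tp hp] := hf _ (divr_gt0 e0 c1).
exists (fun z => c * p z); first exact: testZ.
have i1 := inL2_sqr (inL2B f2 (test_inL2 tp)).
have -> : (fun z => (c * f z - c * p z) ^+ 2) = (fun z => c ^+ 2 * (f z - p z) ^+ 2).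
  by apply/funext => z; ring.
rewrite int2Z//; move: hp; rewrite ltr_pdivlMr// mulrC.
by apply: le_lt_trans; rewrite ler_wpM2r ?int2_sqr_ge0// lerDl.
Qed.

Lemma test_approx0 : test_approx (fun=> 0 : R).
Proof.
split; first exact: inL2_0.
move=> e e0; exists (fun=> 0).
  apply/test_functionP; split; first by move=> k; exact: Ck_cst.
  by exists 0 => z.
rewrite (_ : (fun=> _) = cst 0); last by apply/funext => z; rewrite subrr expr0n.
by rewrite /Rintegral integral0.
Qed.

Lemma test_approxD f g : test_approx f -> test_approx g ->
  test_approx (fun z => f z + g z).
Proof.
move=> hf hg; have := test_approxB hf (test_approxB test_approx0 hg).
by under eq_fun do rewrite sub0r opprK.
Qed.

Lemma test_approx_dominated (F : nat -> R * R -> R) f g :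
  (forall n, test_approx (F n)) -> inL2 g ->
  (forall n z, `|F n z| <= g z) -> (forall z, F n z @[n --> \oo] --> f z) ->
  test_approx f.
Proof.
move=> aF g2 Fg Ff.
have mF n : measurable_fun [set: T2] (F n) by case: (aF n) => /inL2_measurable.
have [f2 H] := L2_dominated_cvg mF g2 Fg Ff.
apply: test_approx_lim => // e e0.
have [n _ /(_ n (leqnn n)) Hn] := cvgr0_norm_lt _ H _ e0.
exists (F n) => //.
by rewrite (le_lt_trans (ler_norm _)).
Qed.

Lemma test_approx_test phi : test_function phi -> test_approx phi.
Proof.
move=> tphi; split; first exact: test_inL2.
move=> e e0; exists phi => //.
rewrite (_ : (fun z => _) = cst 0).
  by rewrite /Rintegral integral0.
by apply/funext => z; rewrite subrr expr0n.
Qed.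

(** Each side of the rectangle gets a factor [flat 1 (n t)], with [t] the signed distance to that
    side. The product is supported in the rectangle and at most 1, so the limit indicator itself
    dominates. *)
Lemma test_approx_rect (a b c d : R) : test_approx (\1_(rect a b c d)).
Proof.
pose F n (z : R * R) : R := flat 1 (n%:R * (z.1 - a)) * flat 1 (n%:R * (b - z.1)) *
  (flat 1 (n%:R * (z.2 - c)) * flat 1 (n%:R * (d - z.2))).
have F0 n z : ~ rect a b c d z -> F n z = 0.
  have fl0 (x : R) : x <= 0 -> flat 1 (n%:R * x) = 0.
    by move=> x0; rewrite /flat ltNge mulr_ge0_le0.
  move=> H; have [h1|h1] := leP z.1 a; first by rewrite /F fl0 ?mul0r ?subr_le0.
  have [h2|h2] := leP b z.1; first by rewrite /F (fl0 (b - _)) ?mulr0 ?mul0r ?subr_le0.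
  have [h3|h3] := leP z.2 c; first by rewrite /F (fl0 (_ - c)) ?mul0r ?mulr0 ?subr_le0.
  have [h4|h4] := leP d z.2; first by rewrite /F (fl0 (d - _)) ?mulr0 ?subr_le0.
  by exfalso; apply: H; split; apply/andP.
apply: (@test_approx_dominated F _ (\1_(rect a b c d))).
- move=> n; apply/test_approx_test/test_functionP; split.
    move=> k; rewrite /F.
    have C1 : Ck k (fst : R * R -> R) := @Ck_fst R k.
    have C2 : Ck k (snd : R * R -> R) := @Ck_snd R k.
    have A (f : R * R -> R) (p q : R) : Ck k f -> Ck k (fun z => flat 1 (n%:R * (p * f z + q))).
      by move=> Cf; apply: Ck_flat; apply: CkZ; apply: CkD; [exact: CkZ|exact: Ck_cst].
    have := CkM (CkM (A _ 1 (- a) C1) (A _ (-1) b C1)) (CkM (A _ 1 (- c) C2) (A _ (-1) d C2)).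
    rewrite [X in Ck k X -> _](_ : _ = F n)//; apply/funext => z.
    by rewrite !mul1r !mulN1r ![- _ + _]addrC.
  exists (`|a| + `|b| + `|c| + `|d|) => z zN; apply: F0 => -[/andP[h1 h2] /andP[h3 h4]].
  move: zN; apply/negP; rewrite negb_or -!leNgt !ler_norml.
  have := ler_norm a; have := ler_norm b; have := ler_norm c; have := ler_norm d.
  have := lerNnormlW (lexx `|a|); have := lerNnormlW (lexx `|b|).
  have := lerNnormlW (lexx `|c|); have := lerNnormlW (lexx `|d|).
  move: (normr_ge0 a) (normr_ge0 b) (normr_ge0 c) (normr_ge0 d) => *.
  by do 2 (apply/andP; split); lra.
- by apply: inL2_indic; [exact: measurable_rect|exact: leb2_rect_lty].
- move=> n z; have [H|H] := pselect (rect a b c d z).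
    rewrite indicE mem_set// ger0_norm; last by rewrite /F !mulr_ge0// flat1_ge0.
    by rewrite /F; do ?[apply: mulr_ile1; rewrite ?mulr_ge0 ?flat1_ge0 ?flat1_le1//].
  by rewrite F0// normr0 indicE memNset.
- move=> z.
  have cv (x : R) : flat 1 (n%:R * x) @[n --> \oo] --> ((0 < x)%R%:R : R) by exact: flat1_cvg.
  have -> : \1_(rect a b c d) z = ((0 < z.1 - a)%R%:R * (0 < b - z.1)%R%:R) *
      ((0 < z.2 - c)%R%:R * (0 < d - z.2)%R%:R) :> R.
    rewrite indicE !subr_gt0.
    case: (boolP (a < z.1)) => h1; case: (boolP (z.1 < b)) => h2;
    case: (boolP (c < z.2)) => h3; case: (boolP (z.2 < d)) => h4;
      rewrite ?mulr1 ?mulr0 ?mul0r //=.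
    by rewrite mem_set//; split; apply/andP.
  1-15: by rewrite memNset//= => -[/andP[e1 e2] /andP[e3 e4]]; move: h1 h2 h3 h4;
    rewrite ?e1 ?e2 ?e3 ?e4.
  by apply: cvgM; apply: cvgM; exact: cv.
Qed.

(** The whole line is included so that half-planes are products of rays; these products form a
    pi-system generating the Borel sets. *)
Definition rays : set (set R) := [set A | A = setT \/ exists a : R, A = `]a, +oo[%classic].

Lemma measurable_rays : @measurable _ T2 = <<s [set A `*` B | A in rays & B in rays] >>.
Proof.
have mray (A : set (measurableTypeR R)) : rays A -> measurable A.
  by case=> [->|[a ->]]; [exact: measurableT|exact: measurable_itv].
set G := [set A `*` B | A in rays & B in rays].
apply/seteqP; split; last first.
  apply: smallest_sub; first exact: sigma_algebra_measurable.
  by move=> _ [A rA [B rB <-]]; apply: measurableX; exact: mray.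
have sA : sigma_algebra setT <<s G >> by exact: smallest_sigma_algebra.
have half1 (A : set (measurableTypeR R)) : measurable A -> <<s G >> (A `*` setT).
  rewrite RGenOInfty.measurableE.
  pose S := [set A : set R | <<s G >> (A `*` setT)].
  suff : <<s (RGenOInfty.G (R:=R)) >> `<=` S by apply.
  apply: smallest_sub.
    split.
    - by rewrite /S /= set0X; case: sA.
    - move=> X; rewrite /S /= => SX; rewrite setTD.
      have -> : ~` X `*` setT = setT `\` (X `*` setT) :> set (R * R).
        by apply/seteqP; split => z /=; tauto.
      by case: sA => _ + _; apply.
    - move=> F SF; rewrite /S /= setX_bigcupl.
      by case: sA => _ _; apply.
  move=> _ [a ->]; apply: sub_gen_smallest; exists `]a, +oo[%classic; first by right; exists a.
  by exists setT => //; left.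
have half2 (A : set (measurableTypeR R)) : measurable A -> <<s G >> (setT `*` A).
  rewrite RGenOInfty.measurableE.
  pose S := [set A : set R | <<s G >> (setT `*` A)].
  suff : <<s (RGenOInfty.G (R:=R)) >> `<=` S by apply.
  apply: smallest_sub.
    split.
    - by rewrite /S /= setX0; case: sA.
    - move=> X; rewrite /S /= => SX; rewrite setTD.
      have -> : setT `*` ~` X = setT `\` (setT `*` X) :> set (R * R).
        by apply/seteqP; split => z /=; tauto.
      by case: sA => _ + _; apply.
    - move=> F SF; rewrite /S /= setX_bigcupr.
      by case: sA => _ _; apply.
  move=> _ [a ->]; apply: sub_gen_smallest; exists setT; first by left.
  by exists `]a, +oo[%classic => //; right; exists a.
rewrite measurable_prod_measurableType; apply: smallest_sub => //.
move=> _ [A mA [B mB <-]].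
have -> : A `*` B = (A `*` setT) `&` (setT `*` B).
  by apply/seteqP; split => z /=; tauto.
have /sigma_algebraP[|_ _ _ sI] := sA => //.
by apply: sI; [exact: half1|exact: half2].
Qed.

(** The Dynkin argument is run inside a fixed box, which keeps complements and countable unions in
    L^2. *)
Lemma test_approx_indic (N : R) (S : set (R * R)) : measurable (S : set T2) ->
  test_approx (\1_(S `&` rect (- N) N (- N) N)).
Proof.
set D := rect (- N) N (- N) N.
have mD : measurable (D : set T2) by exact: measurable_rect.
have Dfin : (leb2 D < +oo)%E by exact: leb2_rect_lty.
have D2 : inL2 (\1_D) by exact: inL2_indic.
rewrite measurable_rays; move: S; apply: dynkin_induction.
- exact: measurable_rays.
- move=> _ _ [A rA [B rB <-]] [A' rA' [B' rB' <-]].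
  have rI (X Y : set R) : rays X -> rays Y -> rays (X `&` Y).
    case=> [->|[x ->]]; first by rewrite setTI.
    case=> [->|[y ->]]; first by rewrite setIT; right; exists x.
    right; exists (Num.max x y); apply/seteqP; split => z /=;
      by rewrite !in_itv/= !andbT gt_max => /andP.
  exists (A `&` A'); first exact: rI.
  exists (B `&` B'); first exact: rI.
  by apply/seteqP; split => z /=; tauto.
- by rewrite setTI; exact: test_approx_rect.
- move=> _ [A rA [B rB <-]].
  have ray (X : set R) : rays X -> exists a, X `&` `]- N, N[%classic = `]a, N[%classic.
    case=> [->|[x ->]]; first by exists (- N); rewrite setTI.
    exists (Num.max x (- N)); apply/seteqP; split => z /=; rewrite !in_itv/= ?andbT gt_max.
      by move=> [-> /andP[-> ->]].
    by move=> /andP[/andP[-> ->] ->].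
  have [a aE] := ray _ rA; have [b bE] := ray _ rB.
  rewrite (_ : _ `&` D = rect a N b N); first exact: test_approx_rect.
  have E (z : R * R) : (A `*` B `&` D) z <->
      (A `&` `]- N, N[%classic) z.1 /\ (B `&` `]- N, N[%classic) z.2.
    by rewrite /D /rect /= !in_itv/=; tauto.
  by apply/seteqP; split => z; rewrite E aE bE /rect /= !in_itv.
- move=> S mS aS; have := test_approxB (test_approx_rect (- N) N (- N) N) aS.
  rewrite [X in test_approx X -> _](_ : _ = \1_(~` S `&` D))//.
  apply/funext => z; have [zD|zD] := pselect (D z); have [zS|zS] := pselect (S z).
  + by rewrite (indic1 zD) (indic1 (conj zS zD)) indic0z ?subrr// => -[].
  + by rewrite (indic1 zD) indic0z ?(@indic1 (~` S `&` D)) ?subr0// => -[].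
  + by rewrite (indic0z zD) !indic0z ?subr0// => -[].
  + by rewrite (indic0z zD) !indic0z ?subr0// => -[].
- move=> F mF tF aF.
  (* By disjointness the partial sums only take the values 0 and 1, so the indicator of the box
     dominates them. *)
  pose G n (z : R * R) : R := \sum_(k < n) \1_(F k `&` D) z.
  have Gin k z : (F k `&` D) z -> forall n, G n z = (k < n)%N%:R.
    move=> kz n; rewrite /G; case: ltnP => kn.
      rewrite (bigD1 (Ordinal kn))//= indicE mem_set// big1 ?addr0// => i ik.
      rewrite indicE memNset// => -[Fi _]; move: ik; apply/negP; rewrite negbK.
      apply/eqP/val_inj => /=; apply: (tF i k) => //.
      by exists z; split => //; case: kz.
    apply: big1 => i _; rewrite indicE memNset// => -[Fi _].
    have ik : val i = k by apply: (tF i k) => //; exists z; split => //; case: kz.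
    by move: (ltn_ord i); rewrite ltnNge -[nat_of_ord i]/(val i) ik kn.
  have Gout z : ~ (\bigcup_k F k `&` D) z -> forall n, G n z = 0.
    move=> H n; apply: big1 => i _; rewrite indicE memNset// => -[Fi Dz].
    by apply: H; split => //; exists (val i).
  apply: (@test_approx_dominated G _ (\1_D)) => //.
  + elim=> [|n IH].
      rewrite (_ : G 0%N = fun=> 0); first exact: test_approx0.
      by apply/funext => z; rewrite /G big_ord0.
    rewrite (_ : G n.+1 = fun z => G n z + \1_(F n `&` D) z).
      by apply: test_approxD => //; exact: aF.
    by apply/funext => z; rewrite /G big_ord_recr.
  + move=> n z; have [[[k _ Fk] Dz]|H] := pselect ((\bigcup_k F k `&` D) z).
      rewrite (Gin k)// indicE mem_set//.
      by case: (k < n)%N; rewrite ?normr1 ?normr0.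
    by rewrite Gout// normr0 indicE.
  + move=> z; have [[[k _ Fk] Dz]|H] := pselect ((\bigcup_k F k `&` D) z).
      rewrite indicE mem_set; last by split => //; exists k.
      apply/cvgrPdist_lt => e e0; near=> n.
      rewrite (Gin k)// (_ : (k < n)%N); first by rewrite subrr normr0.
      by near: n; exists k.+1.
    rewrite indicE memNset//; under eq_fun do rewrite Gout//.
    exact: cvg_cst.
Unshelve. all: by end_near. Qed.
End test_density.

Section test_density_L2.
Context {R : realType}.
Local Notation T2 := (measurableTypeR R * measurableTypeR R)%type.
Implicit Types (f g phi : R * R -> R).
Import HBNNSimple HBSimple.

Lemma test_approx_sum (I : Type) (s : seq I) (F : I -> R * R -> R) :
  (forall i, test_approx (F i)) -> test_approx (fun z => \sum_(i <- s) F i z).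
Proof.
move=> aF; elim: s => [|i s IH].
  by under eq_fun do rewrite big_nil; exact: test_approx0.
under eq_fun do rewrite big_cons.
exact: test_approxD.
Qed.

Lemma test_approx_nnsfun (N : R) (h : {nnsfun T2 >-> R}) :
  test_approx (fun z => h z * \1_(rect (- N) N (- N) N) z).
Proof.
set D := rect (- N) N (- N) N.
have fin : finite_set (range h) by exact: fimfunP.
rewrite (_ : (fun z => _) = fun z => \sum_(y <- finmap.enum_fset (fset_set (range h)))
    (y * \1_(h @^-1` [set y] `&` D) z)).
  apply: test_approx_sum => y; apply: test_approxZ.
  by apply: test_approx_indic; exact: measurable_sfunP.
apply/funext => z; rewrite [in LHS]fimfunE fsbig_finite//= mulr_suml.
by apply: eq_bigr => y _; rewrite -mulrA indicI.
Qed.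

Lemma test_approx_ge0 f : inL2 f -> (forall z, 0 <= f z) -> test_approx f.
Proof.
move=> f2 f0.
have mf : measurable_fun [set: T2] (EFin \o f).
  by apply/measurable_EFinP; exact: inL2_measurable.
have ef0 (z : T2) : setT z -> (0 <= (EFin \o f) z)%E by rewrite /= lee_fin.
pose h := nnsfun_approx measurableT mf.
apply: (@test_approx_dominated _
  (fun n z => h n z * \1_(rect (- n%:R) n%:R (- n%:R) n%:R) z) _ f) => //.
- by move=> n; exact: test_approx_nnsfun.
- move=> n z; rewrite ger0_norm ?mulr_ge0//.
  rewrite -[leRHS]mulr1 ler_pM//.
    by rewrite /h nnsfun_approxE -lee_fin; exact: (le_approx n ef0).
- move=> z; rewrite -[X in _ --> X]mulr1; apply: cvgM.
    have := @cvg_nnsfun_approx _ _ _ _ measurableT _ mf ef0 z I.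
    by move/fine_cvgP => [_]; apply: cvg_trans.
  apply/cvgrPdist_lt => e e0; near=> n; rewrite indic1 ?subrr ?normr0//.
  rewrite /rect /= -!ltr_norml; split; near: n.
  + by apply: nbhs_infty_gtr; exact: num_real.
  + by apply: nbhs_infty_gtr; exact: num_real.
Unshelve. all: by end_near. Qed.

Lemma inL2_test_approx f : inL2 f -> test_approx f.
Proof.
move=> f2; have mf := inL2_measurable f2.
have f02 : inL2 (fun=> 0 : R) := inL2_0.
have p2 : inL2 (fun z => Num.max (f z) 0).
  apply: (inL2_le _ f2) => [|z]; first by apply: measurable_maxr.
  by case: (leP (f z) 0); rewrite ?normr0.
have n2 : inL2 (fun z => Num.max (- f z) 0).
  apply: (inL2_le _ f2) => [|z].
    by apply: measurable_maxr => //; exact: measurableT_comp.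
  by case: (leP (- f z) 0); rewrite ?normr0// normrN.
have -> : f = (fun z => Num.max (f z) 0 - Num.max (- f z) 0).
  apply/funext => z; case: (leP (f z) 0) => h.
    by rewrite (max_idPl _) ?oppr_ge0// sub0r opprK.
  by rewrite (max_idPr _) ?subr0// oppr_le0 ltW.
by apply: test_approxB; apply: test_approx_ge0 => // z; rewrite le_max lexx orbT.
Qed.

(** Orthogonality gives [|f - phi|^2 = |f|^2 + |phi|^2]; with [phi] close to [f], the norm of [f] is
    arbitrarily small. *)
Lemma inL2_test_eq0 f : inL2 f ->
  (forall phi, test_function phi -> \int[leb2]_z (f z * phi z) = 0) ->
  {ae leb2, forall z, f z = 0}.
Proof.
move=> f2 H; apply: int2_sqr_eq0 => //.
apply/eqP; rewrite eq_le int2_sqr_ge0 andbT; apply/ler_addgt0Pl => e e0.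
rewrite addr0.
have [_ /(_ _ e0)[phi tphi hphi]] := inL2_test_approx f2.
have phi2 := test_inL2 tphi.
apply: le_trans (ltW hphi).
have -> : (fun z => (f z - phi z) ^+ 2) =
    (fun z => f z ^+ 2 - 2 * (f z * phi z) + phi z ^+ 2).
  by apply/funext => z; ring.
have i1 := inL2_sqr f2; have i2 := inL2_sqr phi2; have i3 := integrable2M f2 phi2.
rewrite int2D//; last by apply: integrable2B => //; exact: integrable2Z.
rewrite int2B//; last exact: integrable2Z.
by rewrite int2Z// H// mulr0 subr0 lerDl int2_sqr_ge0.
Qed.

End test_density_L2.

(** * Weak derivatives *)

Section translation.
Context {R : realType}.
Local Notation T2 := (measurableTypeR R * measurableTypeR R)%type.
Implicit Types (f g : R * R -> R) (w : R * R).

Definition translate w f : R * R -> R := fun z => f (z + w).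

(** By uniqueness of Lebesgue measure it suffices to compare half-open intervals. *)
Lemma lebesgue_measure_translate (x : R) (A : set R) :
  measurable (A : set (measurableTypeR R)) ->
  lebesgue_measure ((fun y => y + x) @^-1` A) = lebesgue_measure A.
Proof.
pose phi (y : measurableTypeR R) : measurableTypeR R := y + x.
have mphi : measurable_fun setT phi by apply: measurable_funD.
pose H := mfun_Sub (mem_set mphi : phi \in mfun).
move=> mA; apply/esym.
have := @lebesgue_measure_unique R (pushforward lebesgue_measure H).
apply => //= _ [[a b]] _ <-.
rewrite /pushforward (_ : H @^-1` _ = `]a - x, b - x]%classic).
  rewrite !lebesgue_measure_itv/= !lte_fin ltrD2r; case: ifP => // _.
  by congr EFin; ring.
by apply/seteqP; split => y; rewrite /H /= !in_itv/= ltrBlDr lerBrDr.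
Qed.

Lemma measurable_translate w : measurable_fun [set: T2] (fun z : T2 => z + w : T2).
Proof.
apply/measurable_fun_pairP; split.
  by apply: measurable_funD => //; exact: measurable_fst.
by apply: measurable_funD => //; exact: measurable_snd.
Qed.

Lemma leb2_translate w (A : set (R * R)) : measurable (A : set T2) ->
  leb2 ((fun z => z + w) @^-1` A) = leb2 A.
Proof.
pose H := mfun_Sub (mem_set (measurable_translate w) : _ \in mfun).
move=> mA; apply/esym.
apply: (@product_measure_unique _ _ _ _ R lebesgue_measure lebesgue_measure
  (pushforward leb2 H)) => // X Y mX mY.
rewrite /= /pushforward.
have mpre (x : R) (Z : set R) : measurable (Z : set (measurableTypeR R)) ->
    measurable ((fun y => y + x) @^-1` Z : set (measurableTypeR R)).
  move=> mZ; have mx : measurable_fun [set: measurableTypeR R]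
    (fun y => y + x : measurableTypeR R) by apply: measurable_funD.
  by rewrite -[X in measurable X]setTI; exact: mx.
transitivity (leb2 (((fun y => y + w.1) @^-1` X) `*` ((fun y => y + w.2) @^-1` Y))).
  by [].
by rewrite leb2X ?lebesgue_measure_translate//; exact: mpre.
Qed.

Lemma integral_translate w (h : R * R -> \bar R) :
  measurable_fun [set: T2] h -> (forall z, 0 <= h z)%E ->
  (\int[@leb2 R]_z h (z + w)%R = \int[leb2]_z h z)%E.
Proof.
move=> mh h0; have := @ge0_integral_pushforward _ _ T2 T2 R _
  (measurable_translate w) leb2 setT h measurableT mh (fun z _ => h0 z).
rewrite preimage_setT => <-.
apply: eq_measure_integral; first exact: measurable_translate.
by move=> mt A mA _; exact: leb2_translate.
Qed.

Lemma integrable2_translate w f : integrable2 f -> integrable2 (translate w f).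
Proof.
case/integrableP => mf fi; apply/integrableP; split.
  apply: (measurableT_comp mf); exact: measurable_translate.
rewrite (integral_translate w (h := fun z => `|(EFin \o f) z|%E)) //.
exact: measurableT_comp.
Qed.

Lemma int2_translate w f : integrable2 f ->
  \int[leb2]_z translate w f z = \int[leb2]_z f z.
Proof.
move=> fi; have := integrable2_translate w fi; have /integrableP[mf _] := fi.
rewrite /Rintegral => ti; congr fine.
have := @integral_pushforward _ _ T2 T2 R _ (measurable_translate w) leb2
  setT (EFin \o f) mf.
rewrite preimage_setT => /(_ ti measurableT) /= <-.
apply: eq_measure_integral; first exact: measurable_translate.
by move=> mt A mA _; exact: leb2_translate.
Qed.

Lemma inL2_translate w f : inL2 f -> inL2 (translate w f).
Proof.
move=> f2; apply: inL2P.
  apply: (measurableT_comp (inL2_measurable f2)); exact: measurable_translate.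
exact: (integrable2_translate w (inL2_sqr f2)).
Qed.

Lemma translateD w w' f : translate w (translate w' f) = translate (w + w') f.
Proof. by apply/funext => z; rewrite /translate addrA. Qed.

Lemma translate0 f : translate 0 f = f.
Proof. by apply/funext => z; rewrite /translate addr0. Qed.

Lemma int2_translateM w f g : inL2 f -> inL2 g ->
  \int[leb2]_z (f z * translate w g z) = \int[leb2]_z (translate (- w) f z * g z).
Proof.
move=> f2 g2.
rewrite -(int2_translate (- w) (integrable2M f2 (inL2_translate w g2))).
by apply: eq_Rintegral => z _; rewrite /translate subrK.
Qed.

Lemma int2_sqr_translate w f : inL2 f ->
  \int[leb2]_z translate w f z ^+ 2 = \int[leb2]_z f z ^+ 2.
Proof. by move=> f2; exact: (int2_translate w (inL2_sqr f2)). Qed.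

End translation.

(** * Weak derivatives along an axis and integration by parts *)

Section weak_derivatives.
Context {R : realType}.
Local Notation T2 := (measurableTypeR R * measurableTypeR R)%type.
Implicit Types (f g phi b : R * R -> R) (v z : R * R) (r s : R).

Definition axis v : Prop := v = ex \/ v = ey.

(** A single differentiation step between two L^2 functions, the form in which integrations by parts
    are carried out; [is_wderiv] refers every derivative back to the original function. *)
Definition wder v f g : Prop := [/\ inL2 f, inL2 g & forall phi, test_function phi ->
  \int[leb2]_z (f z * 'D_v phi z) = - \int[leb2]_z (g z * phi z)].

Lemma test_D v phi : axis v -> test_function phi -> test_function ('D_v phi).
Proof. by case=> ->; [exact: test_Dx|exact: test_Dy]. Qed.

Lemma test_is_derive v phi z : axis v -> test_function phi ->
  is_derive z v phi ('D_v phi z).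
Proof.
by move=> [->|->] /test_functionP[sm _]; [exact: is_derive_Dx|exact: is_derive_Dy].
Qed.

Lemma boxed_translate v N phi r : axis v -> boxed N phi -> `|r| <= 1 ->
  boxed (N + 1) (translate (r *: v) phi).
Proof.
move=> av bN r1 z zN; apply: bN.
have tri (x y : R) : N + 1 < `|x| -> `|y| <= 1 -> N < `|x + y|.
  move=> h1 h2; rewrite -(ltrD2r 1) (lt_le_trans h1)//.
  by rewrite -[in leLHS](addrK y x) (le_trans (ler_normB _ _))// lerD2l.
have r01 (c : R) : (c == 0) || (c == 1) -> `|r * c| <= 1.
  by case/orP => /eqP ->; rewrite ?mulr0 ?normr0 ?mulr1.
case/orP : zN => zN; apply/orP; [left|right]; apply: tri => //=.
- by case: av => -> /=; apply: r01; rewrite eqxx ?orbT.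
- by case: av => -> /=; apply: r01; rewrite eqxx ?orbT.
Qed.

(** Converts uniform bounds into L^2 bounds for functions living in a common box; [K] does not
    depend on the function. *)
Lemma boxed_nrm_le (N : R) : exists2 K : R, 0 <= K & forall f (C : R),
  measurable_fun [set: T2] f -> boxed N f -> 0 <= C -> (forall z, `|f z| <= C) ->
  nrm f <= C * K.
Proof.
set D := rect (- (N + 1)) (N + 1) (- (N + 1)) (N + 1).
have D2 : inL2 (\1_D) by apply: inL2_indic; [exact: measurable_rect|exact: leb2_rect_lty].
exists (nrm (\1_D)); first exact: nrm_ge0.
move=> f C mf fN C0 fC.
have f2 := boxed_inL2 mf fN fC.
apply: nrm_le; first by rewrite mulr_ge0// nrm_ge0.
rewrite exprMn sqr_nrm -int2Z; last exact: inL2_sqr.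
apply: int2_le => [||z]; [exact: inL2_sqr|by apply: integrable2Z; exact: inL2_sqr|].
have [->|fz] := eqVneq (f z) 0; first by rewrite expr0n mulr_ge0// sqr_ge0.
rewrite indic1; last by apply: (rect_boxed fN) fz; rewrite ltrDl.
by rewrite expr1n mulr1 -real_normK ?num_real// lerXn2r// nnegrE.
Qed.

Lemma line_MVT0 phi v z r (dphi : R * R -> R) :
  (forall y, is_derive y v phi (dphi y)) -> exists2 c : R, `|c| <= `|r| &
    phi (z + r *: v) - phi z = dphi (z + c *: v) * r.
Proof.
move=> D; have [r0|r0|->] := ltgtP r 0.
- have [c /andP[c1 c2] E] := line_MVT z r0 D.
  exists c; first by rewrite !ltr0_norm// lerN2 ltW.
  move: E; rewrite scale0r add0r sub0r ![_ *: v + z]addrC => E.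
  by apply: oppr_inj; rewrite opprB E mulrN.
- have [c /andP[c1 c2] E] := line_MVT z r0 D.
  exists c; first by rewrite !gtr0_norm// ltW.
  by move: E; rewrite scale0r add0r subr0 ![_ *: v + z]addrC.
- by exists 0 => //; rewrite scale0r addr0 subrr mulr0.
Qed.

Lemma test_translate_bound v phi z r (C : R) : axis v -> test_function phi ->
  (forall y, `|'D_v phi y| <= C) -> `|phi (z + r *: v) - phi z| <= `|r| * C.
Proof.
move=> av tphi HC.
have [c _ ->] := line_MVT0 z r (fun y => test_is_derive y av tphi).
by rewrite normrM mulrC ler_wpM2l.
Qed.

Lemma measurable_test phi : test_function phi -> measurable_fun [set: T2] phi.
Proof. by move=> /test_inL2/inL2_measurable. Qed.

(** Density reduces the claim to a test function, where the mean value theorem gives a Lipschitz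
    bound on a fixed box. *)
Lemma L2_translate_cvg v b (e : R) : axis v -> inL2 b -> 0 < e ->
  exists2 d : R, 0 < d & forall r, `|r| <= d ->
    nrm (fun z => translate (r *: v) b z - b z) <= e.
Proof.
move=> av b2 e0; have e3 : 0 < e / 3 by rewrite divr_gt0.
have [_ /(_ _ (exprn_gt0 2 e3))[phi tphi hphi]] := inL2_test_approx b2.
have phi2 := test_inL2 tphi.
have tD := test_D av tphi.
have [C HC] := test_bounded tD.
have C0 : 0 <= C by rewrite (le_trans _ (HC 0)).
have /test_functionP[_ [N bN]] := tphi.
have bN1 : boxed (N + 1) phi by apply: boxed_le bN; rewrite lerDl.
have [K K0 HK] := boxed_nrm_le (N + 1).
have bphi : nrm (fun z => b z - phi z) < e / 3 by apply: nrm_lt => //; exact: ltW.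
(* Steps of size at most 1 keep the translates of [phi] in the box [N + 1]. *)
have d0 : 0 < Num.min 1 (e / 3 / (C * K + 1)).
  by rewrite lt_min ltr01/= divr_gt0// ltr_wpDl// mulr_ge0.
exists (Num.min 1 (e / 3 / (C * K + 1))) => // r; rewrite le_min => /andP[r1 r2].
set w := r *: v.
have -> : (fun z => translate w b z - b z) = (fun z =>
    (translate w (fun z => b z - phi z) z - (b z - phi z)) +
    (translate w phi z - phi z)).
  by apply/funext => z; rewrite /translate; ring.
have tw : nrm (translate w (fun z => b z - phi z)) = nrm (fun z => b z - phi z).
  by rewrite /nrm int2_sqr_translate//; exact: inL2B.
have bp2 : inL2 (fun z => b z - phi z) by exact: inL2B.
apply: (le_trans (nrmD _ _)).
- by apply: inL2B => //; exact: inL2_translate.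
- by apply: inL2B => //; exact: inL2_translate.
have -> : e = e / 3 + e / 3 + e / 3 by field.
apply: lerD.
  apply: (le_trans (nrmB _ bp2)); first exact: inL2_translate.
  by rewrite tw lerD// ltW.
apply: (@le_trans _ _ (`|r| * C * K)).
  apply: HK.
  - apply: measurable_funB; last exact: measurable_test.
    by apply: measurable_test; exact: test_translate.
  - by move=> z zN; rewrite (boxed_translate av bN r1 zN) (bN1 z zN) subrr.
  - by rewrite mulr_ge0.
  - by move=> z; exact: test_translate_bound.
move: r2; rewrite ler_pdivlMr; last by rewrite ltr_wpDl// mulr_ge0.
by apply: le_trans; rewrite -mulrA ler_wpM2l// lerDl.
Qed.

(** The Taylor remainder of [phi] is at most [C s^2], with [C] a bound of the second derivative, and
    vanishes off a fixed box; its pairing with [f] is therefore quadratic in [s]. *)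
Lemma test_pairing_is_derive0 v f phi : axis v -> inL2 f -> test_function phi ->
  is_derive (0 : R) 1 (fun s => \int[leb2]_z (f z * translate (s *: v) phi z))
    (\int[leb2]_z (f z * 'D_v phi z)).
Proof.
move=> av f2 tphi; have phi2 := test_inL2 tphi.
have tD := test_D av tphi; have tDD := test_D av tD.
have D2 := test_inL2 tD.
have [C HC] := test_bounded tDD.
have C0 : 0 <= C by rewrite (le_trans _ (HC 0)).
have /test_functionP[_ [N bN]] := tphi.
have bN1 : boxed (N + 1) phi by apply: boxed_le bN; rewrite lerDl.
have [K K0 HK] := boxed_nrm_le (N + 1).
set a := \int[leb2]_z (f z * 'D_v phi z); set k := (fun s => _).
pose rem s z := translate (s *: v) phi z - phi z - s * 'D_v phi z.
have rem2 s : inL2 (rem s).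
  by apply: inL2B; [apply: inL2B => //; exact: inL2_translate|exact: inL2Z].
have kE s : k s - k 0 - s * a = \int[leb2]_z (f z * rem s z).
  rewrite /k /a scale0r translate0 -int2B; last 2 first.
  - by apply: integrable2M => //; exact: inL2_translate.
  - exact: integrable2M.
  rewrite -int2Z; last exact: integrable2M.
  rewrite -int2B; last 2 first.
  - by apply: integrable2B; apply: integrable2M => //; exact: inL2_translate.
  - by apply: integrable2Z; exact: integrable2M.
  by apply: eq_Rintegral => z _; rewrite /rem; ring.
have D0 : is_derive (0 : R) 1 (fun s => k s - k 0 - s * a) 0.
  apply: (@is_derive_le_sqr _ (nrm f * (C * K))) => s s1.
  rewrite kE (le_trans (nrm_CS f2 (rem2 s)))// -mulrA ler_wpM2l ?nrm_ge0//.
  rewrite mulrAC; apply: HK.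
  - exact: inL2_measurable.
  - by move=> z zN; rewrite /rem (boxed_translate av bN s1 zN) (bN1 z zN)
    (boxed_derive _ bN1 zN) mulr0 !subr0.
  - by rewrite mulr_ge0// sqr_ge0.
  move=> z; rewrite /rem /translate.
  have HD y := test_is_derive y av tphi.
  have [c cs E] := line_MVT0 z s HD.
  have -> : phi (z + s *: v) - phi z - s * 'D_v phi z =
      ('D_v phi (z + c *: v) - 'D_v phi z) * s by rewrite E; ring.
  rewrite normrM (@le_trans _ _ (`|c| * C * `|s|))//.
    by rewrite ler_wpM2r//; exact: (test_translate_bound z c av tD HC).
  rewrite -[s ^+ 2]real_normK ?num_real// expr2 [C * _]mulrC -mulrA [C * _]mulrC mulrA.
  by rewrite ler_wpM2r// ler_wpM2r.
have DL : is_derive (0 : R) 1 (fun s => s * a + k 0) a.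
  by apply: is_derive_eq; rewrite /GRing.scale/=; ring.
have := is_deriveD D0 DL; rewrite add0r; congr (is_derive _ _ _ _).
apply/funext => s; transitivity ((k s - k 0 - s * a) + (s * a + k 0)); first by [].
by rewrite addrA !subrK.
Qed.

Lemma test_pairing_is_derive v f phi s : axis v -> inL2 f -> test_function phi ->
  is_derive s 1 (fun s => \int[leb2]_z (f z * translate (s *: v) phi z))
    (\int[leb2]_z (f z * 'D_v (translate (s *: v) phi) z)).
Proof.
move=> av f2 tphi.
have D := test_pairing_is_derive0 av f2 (test_translate (s *: v) tphi).
set a := (X in is_derive _ _ _ X) in D *.
set F := (X in is_derive _ _ X _) in D.
have E : (fun s => \int[leb2]_z (f z * translate (s *: v) phi z)) =
    F \o (fun r : R => r - s).
  by apply/funext => r /=; rewrite /F translateD -scalerDl subrK.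
have D1 : is_derive s (1 : R) (fun r : R => r - s) 1.
  by apply: is_derive_eq; rewrite subr0.
have D' : is_derive (s - s) 1 F a by rewrite subrr.
by have := @is_derive1_comp R F _ s a 1 D' D1; rewrite mulr1 E.
Qed.

Lemma real_MVT0 (h dh : R -> R) s : (forall x : R, is_derive x 1 h (dh x)) ->
  exists2 c, `|c| <= `|s| & h s - h 0 = dh c * s.
Proof.
move=> D.
have D2 (y : R * R) : is_derive y ex (fun z => h z.1) (dh y.1).
  by rewrite -[dh _]mulr1; apply: is_derive_scalar_comp; exact: is_derive_fst.
have [c cs] := line_MVT0 0 s D2.
rewrite !add0r /= /GRing.scale /= !mulr1 => E.
by exists c.
Qed.

(** A quantitative difference quotient: the function [h] below has derivative
    [- <g, translate (r *: v) phi - phi>], so the mean value theorem bounds the error by the modulus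
    of translation of [phi]. *)
Lemma wder_test_increment v f g phi s (D : R) : axis v -> wder v f g ->
  test_function phi ->
  (forall r, `|r| <= `|s| -> nrm (fun z => translate (r *: v) phi z - phi z) <= D) ->
  `|\int[leb2]_z (f z * (translate (s *: v) phi z - phi z)) +
    s * \int[leb2]_z (g z * phi z)| <= `|s| * (nrm g * D).
Proof.
move=> av [f2 g2 fg] tphi HD; have phi2 := test_inL2 tphi.
pose h r := \int[leb2]_z (f z * translate (r *: v) phi z) +
  r * \int[leb2]_z (g z * phi z).
have dh r : is_derive r 1 h
    (- \int[leb2]_z (g z * (translate (r *: v) phi z - phi z))).
  have D1 := test_pairing_is_derive r av f2 tphi.
  have D2 : is_derive r 1 (fun r => r * \int[leb2]_z (g z * phi z))
      (\int[leb2]_z (g z * phi z)).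
    by apply: is_derive_eq; rewrite /GRing.scale/=; ring.
  apply: (is_derive_eq (is_deriveD D1 D2)).
  have tt := test_translate (r *: v) tphi.
  have t2 := inL2_translate (r *: v) phi2.
  have i1 := integrable2M g2 t2; have i2 := integrable2M g2 phi2.
  have E : \int[leb2]_z (g z * (translate (r *: v) phi z - phi z)) =
      \int[leb2]_z (g z * translate (r *: v) phi z) - \int[leb2]_z (g z * phi z).
    by rewrite -int2B//; apply: eq_Rintegral => z _; rewrite mulrBr.
  by rewrite E (fg _ tt) opprB addrC.
have [c cs] := real_MVT0 s dh.
rewrite {1 2}/h mul0r addr0 scale0r translate0.
have -> : \int[leb2]_z (f z * translate (s *: v) phi z) +
    s * (\int[leb2]_z (g z * phi z)) - \int[leb2]_z (f z * phi z) =
  \int[leb2]_z (f z * (translate (s *: v) phi z - phi z)) +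
    s * \int[leb2]_z (g z * phi z).
  rewrite addrAC; congr (_ + _).
  rewrite -int2B//; last exact: integrable2M.
    by apply: eq_Rintegral => z _; rewrite mulrBr.
  by apply: integrable2M => //; exact: inL2_translate.
move=> ->; rewrite normrM normrN mulrC ler_wpM2l//.
apply: (le_trans (nrm_CS g2 _)); first by apply: inL2B => //; exact: inL2_translate.
by rewrite ler_wpM2l ?nrm_ge0//; exact: HD.
Qed.

Lemma inL2_approx_test b (e : R) : inL2 b -> 0 < e ->
  exists2 phi, test_function phi & nrm (fun z => b z - phi z) < e.
Proof.
move=> b2 e0; have [_ /(_ _ (exprn_gt0 2 e0))[phi tphi hphi]] := inL2_test_approx b2.
by exists phi => //; apply: nrm_lt => //; exact: ltW.
Qed.

Lemma nrm_translate w f : inL2 f -> nrm (translate w f) = nrm f.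
Proof. by move=> f2; rewrite /nrm int2_sqr_translate. Qed.

(** Only the L^2 modulus of translation enters the bound for test functions, so it passes by density
    to any [b] in L^2, even one without weak derivatives. *)
Lemma wder_increment v f g b s (D : R) : axis v -> wder v f g -> inL2 b ->
  (forall r, `|r| <= `|s| -> nrm (fun z => translate (r *: v) b z - b z) <= D) ->
  `|\int[leb2]_z (f z * (translate (s *: v) b z - b z)) +
    s * \int[leb2]_z (g z * b z)| <= `|s| * (nrm g * D).
Proof.
move=> av fg b2 HD; have [f2 g2 _] := fg.
(* [Q e] majorizes all errors made by replacing [b] with a test function at distance at most [e]. *)
pose Q := nrm f * 2 + `|s| * nrm g + `|s| * (nrm g * 2) + 1.
have Q0 : 0 < Q.
  by rewrite ltr_wpDl// !addr_ge0// !mulr_ge0// nrm_ge0.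
apply/ler_addgt0Pl => e0' e'0; pose e := e0' / Q.
have e0 : 0 < e by rewrite divr_gt0.
have eE : e0' = Q * e by rewrite /e mulrC divfK// gt_eqF.
have [phi tphi he] := inL2_approx_test b2 e0.
have phi2 := test_inL2 tphi.
pose d z := b z - phi z; have d2 : inL2 d by exact: inL2B.
have dn : nrm d <= e by exact: ltW.
have T2' w (h : R * R -> R) (h2 : inL2 h) := inL2_translate w h2.
have Hphi r : `|r| <= `|s| -> nrm (fun z => translate (r *: v) phi z - phi z) <= D + 2 * e.
  move=> rs.
  have -> : (fun z => translate (r *: v) phi z - phi z) =
    (fun z => (translate (r *: v) b z - b z) - (translate (r *: v) d z - d z)).
    by apply/funext => z; rewrite /translate /d; ring.
  apply: (le_trans (nrmB _ _)); [by apply: inL2B => //; exact: T2'..|].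
  apply: lerD; first exact: HD.
  apply: (le_trans (nrmB _ d2)); first exact: T2'.
  by rewrite nrm_translate// mulr2n mulrDl mul1r lerD.
have K := wder_test_increment av fg tphi Hphi.
set w := s *: v in K *.
have I1 := integrable2M f2 (inL2B (T2' w _ phi2) phi2).
have I2 := integrable2M f2 (inL2B (T2' w _ d2) d2).
have I3 := integrable2M g2 phi2; have I4 := integrable2M g2 d2.
have -> : \int[leb2]_z (f z * (translate w b z - b z)) + s * \int[leb2]_z (g z * b z) =
  (\int[leb2]_z (f z * (translate w phi z - phi z)) + s * \int[leb2]_z (g z * phi z)) +
  (\int[leb2]_z (f z * (translate w d z - d z)) + s * \int[leb2]_z (g z * d z)).
  rewrite addrACA -mulrDr -!int2D//; congr (_ + s * _).
    by apply: eq_Rintegral => z _; rewrite /translate /d; ring.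
  by apply: eq_Rintegral => z _; rewrite /d; ring.
apply: (le_trans (ler_normD _ _)).
have B1 : `|\int[leb2]_z (f z * (translate w d z - d z))| <= nrm f * (2 * e).
  apply: (le_trans (nrm_CS f2 (inL2B (T2' w _ d2) d2))).
  rewrite ler_wpM2l ?nrm_ge0//; apply: (le_trans (nrmB (T2' w _ d2) d2)).
  by rewrite nrm_translate// mulr2n mulrDl mul1r lerD.
have B2 : `|s * \int[leb2]_z (g z * d z)| <= `|s| * (nrm g * e).
  rewrite normrM ler_wpM2l//; apply: (le_trans (nrm_CS g2 d2)).
  by rewrite ler_wpM2l ?nrm_ge0.
apply: (le_trans (lerD K (le_trans (ler_normD _ _) (lerD B1 B2)))).
rewrite eE /Q; have := nrm_ge0 f; have := normr_ge0 s; have := nrm_ge0 g; nra.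
Qed.

(** Neither factor is a test function. The increment of [g] along [s v] tested on [f] and the
    increment of [f] along [- s v] tested on [g] have the same integral by translation invariance;
    [wder_increment] expands both to first order in [s]. *)
Lemma int2_by_parts v f f' g g' : axis v -> wder v f f' -> wder v g g' ->
  \int[leb2]_z (f' z * g z) + \int[leb2]_z (f z * g' z) = 0.
Proof.
move=> av ff' gg'; have [f2 f'2 _] := ff'; have [g2 g'2 _] := gg'.
apply/eqP; rewrite -normr_le0; apply/ler_addgt0Pl => e' e'0; rewrite addr0.
pose Q := nrm f' + nrm g' + 1.
have Q0 : 0 < Q by rewrite ltr_wpDl// addr_ge0// nrm_ge0.
pose e := e' / Q; have e0 : 0 < e by rewrite divr_gt0.
have eE : e' = Q * e by rewrite /e mulrC divfK// gt_eqF.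
have [d1 d10 H1] := L2_translate_cvg av g2 e0.
have [d2 d20 H2] := L2_translate_cvg av f2 e0.
pose s := Num.min d1 d2; have s0 : 0 < s by rewrite lt_min d10.
have A1 : `|\int[leb2]_z (f z * (translate (s *: v) g z - g z)) +
    s * \int[leb2]_z (f' z * g z)| <= `|s| * (nrm f' * e).
  apply: wder_increment => // r; rewrite (gtr0_norm s0) le_min => /andP[h _].
  exact: H1.
have A2 : `|\int[leb2]_z (g z * (translate ((- s) *: v) f z - f z)) +
    (- s) * \int[leb2]_z (g' z * f z)| <= `|- s| * (nrm g' * e).
  apply: wder_increment => // r; rewrite normrN (gtr0_norm s0) le_min => /andP[_ h].
  exact: H2.
have E : \int[leb2]_z (f z * (translate (s *: v) g z - g z)) =
    \int[leb2]_z (g z * (translate ((- s) *: v) f z - f z)).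
  have T2' w (h : R * R -> R) (h2 : inL2 h) := inL2_translate w h2.
  under eq_Rintegral do rewrite mulrBr.
  rewrite int2B; [|exact: integrable2M (T2' _ _ g2)|exact: integrable2M].
  rewrite int2_translateM// scaleNr -int2B; last 2 first.
  - exact: integrable2M (T2' _ _ f2) g2.
  - exact: integrable2M.
  by apply: eq_Rintegral => z _; ring.
have E2 : \int[leb2]_z (g' z * f z) = \int[leb2]_z (f z * g' z).
  by apply: eq_Rintegral => z _; rewrite mulrC.
move: A1 A2; rewrite -E E2 normrN (gtr0_norm s0) => A1 A2.
rewrite -(ler_pM2l s0) -[s in leLHS](gtr0_norm s0) -normrM.
have -> : s * (\int[leb2]_z (f' z * g z) + \int[leb2]_z (f z * g' z)) =
  (\int[leb2]_z (f z * (translate (s *: v) g z - g z)) +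
    s * \int[leb2]_z (f' z * g z)) -
  (\int[leb2]_z (f z * (translate (s *: v) g z - g z)) +
    - s * \int[leb2]_z (f z * g' z)) by ring.
apply: (le_trans (ler_normB _ _)); apply: (le_trans (lerD A1 A2)).
rewrite -mulrDr ler_wpM2l ?(ltW s0)// eE /Q -mulrDl ler_wpM2r ?(ltW e0)//.
by rewrite lerDl.
Qed.

End weak_derivatives.

(** * Rules of calculus for weak derivatives *)

Section weak_derivative_calculus.
Context {R : realType}.
Local Notation T2 := (measurableTypeR R * measurableTypeR R)%type.
Implicit Types (f g phi m : R * R -> R) (v z : R * R).

Lemma integrable2_test f phi : inL2 f -> test_function phi ->
  integrable2 (fun z => f z * phi z).
Proof. by move=> f2 /test_inL2; exact: integrable2M. Qed.

Lemma inL2_test_eq f g : inL2 f -> inL2 g ->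
  (forall phi, test_function phi ->
     \int[leb2]_z (f z * phi z) = \int[leb2]_z (g z * phi z)) ->
  {ae leb2, forall z, f z = g z}.
Proof.
move=> f2 g2 H; have := inL2_test_eq0 (inL2B f2 g2) _.
move=> K; apply: ae2_imp (K _) => [z /eqP|phi tphi].
  by rewrite subr_eq0 => /eqP.
under eq_Rintegral do rewrite mulrBl.
by rewrite int2B ?H ?subrr//; exact: integrable2_test.
Qed.

Lemma iter_test i j phi : test_function phi -> test_function (iter i Dx (iter j Dy phi)).
Proof.
move=> tphi; elim: i => [|i IH] /=; last exact: test_Dx.
by elim: j => [|j IH] //=; exact: test_Dy.
Qed.

Lemma is_wderiv_uniq i j f g g' : is_wderiv i j f g -> is_wderiv i j f g' ->
  {ae leb2, forall z, g z = g' z}.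
Proof.
move=> [g2 H] [g'2 H']; apply: inL2_test_eq => // phi tphi.
have := H' _ tphi; rewrite (H _ tphi) => /(congr1 (fun x => (-1) ^+ (i + j) * x)).
by rewrite !mulrA -!exprMn mulrNN mulr1 !expr1n !mul1r.
Qed.

Lemma is_wderivB i j f g f' g' : inL2 f -> inL2 f' ->
  is_wderiv i j f g -> is_wderiv i j f' g' ->
  is_wderiv i j (f \- f') (fun z => g z - g' z).
Proof.
move=> f2 f'2 [g2 H] [g'2 H']; split; first exact: inL2B.
move=> phi tphi; have ti := iter_test i j tphi.
under eq_Rintegral do rewrite mulrBl.
rewrite int2B; [|exact: integrable2_test..].
rewrite H// H'// -mulrBr -int2B; [|exact: integrable2_test..].
by congr (_ * _); apply: eq_Rintegral => z _; rewrite mulrBl.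
Qed.

Lemma is_wderiv00 f : inL2 f -> is_wderiv 0 0 f f.
Proof. by move=> f2; split => // phi _; rewrite expr0 mul1r. Qed.

(** In [is_wderiv] the [x]-derivatives are applied last, so an extra [Dx] on [phi] fits directly
    only when there is no [y]-derivative. Mixed cases go through [wder_comm]. *)
Lemma is_wderiv_wder_x i f g g' : is_wderiv i 0 f g -> is_wderiv i.+1 0 f g' ->
  wder ex g g'.
Proof.
move=> [g2 H] [g'2 H']; split => // phi tphi.
have E1 := H _ (test_Dx tphi); have E2 := H' _ tphi.
move: E1 E2; rewrite iterSr /= addn0 addSn => -> /(congr1 (fun x => (-1) ^+ i * x)).
rewrite mulrA exprS mulN1r addn0 mulNr mulrN !mulrA -!exprMn mulrNN mulr1 expr1n.
by rewrite !mul1r.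
Qed.

Lemma is_wderiv_wder_y i j f g g' : is_wderiv i j f g -> is_wderiv i j.+1 f g' ->
  wder ey g g'.
Proof.
move=> [g2 H] [g'2 H']; split => // phi tphi.
have E1 := H _ (test_Dy tphi); have E2 := H' _ tphi.
move: E1 E2; rewrite iterSr addnS => -> /(congr1 (fun x => (-1) ^+ (i + j) * x)).
rewrite mulrA exprS mulN1r mulNr mulrN !mulrA -!exprMn mulrNN mulr1 expr1n.
by rewrite !mul1r.
Qed.

Lemma wderD v f f' g g' : axis v -> wder v f f' -> wder v g g' ->
  wder v (fun z => f z + g z) (fun z => f' z + g' z).
Proof.
move=> av [f2 f'2 H] [g2 g'2 H']; split; [exact: inL2D..|] => phi tphi.
have tD := test_D av tphi.
under eq_Rintegral do rewrite mulrDl.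
rewrite int2D; [|exact: integrable2_test..].
rewrite H// H'// -opprD -int2D; [|exact: integrable2_test..].
by congr (- _); apply: eq_Rintegral => z _; rewrite mulrDl.
Qed.

Lemma wderZ v (c : R) f f' : axis v -> wder v f f' ->
  wder v (fun z => c * f z) (fun z => c * f' z).
Proof.
move=> av [f2 f'2 H]; split; [exact: inL2Z..|] => phi tphi.
have tD := test_D av tphi.
under eq_Rintegral do rewrite -mulrA.
rewrite int2Z; last exact: integrable2_test.
rewrite H// mulrN -int2Z; last exact: integrable2_test.
by congr (- _); apply: eq_Rintegral => z _; rewrite mulrA.
Qed.

Lemma wder_eq v f f' g g' : wder v f f' -> f =1 g -> f' =1 g' -> wder v g g'.
Proof. by move=> H /funext <- /funext <-. Qed.

(** The factor may be unbounded, as Gaussian weights are; square integrability of the products is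
    therefore assumed instead of bounds on [m]. *)
Lemma wderM v m m' f f' : axis v -> smooth m -> smooth m' ->
  (forall z, is_derive z v m (m' z)) -> wder v f f' ->
  inL2 (fun z => m z * f z) -> inL2 (fun z => m' z * f z + m z * f' z) ->
  wder v (fun z => m z * f z) (fun z => m' z * f z + m z * f' z).
Proof.
move=> av sm sm' dm [f2 f'2 H] mf2 mf'2; split => // phi tphi.
have tD := test_D av tphi.
have tm := test_smoothM sm tphi; have tm' := test_smoothM sm' tphi.
have dE z : 'D_v (fun z => m z * phi z) z = m z * 'D_v phi z + phi z * m' z.
  have := is_deriveM (dm z) (test_is_derive z av tphi).
  by case.
have := H _ tm; under eq_Rintegral => z _ do rewrite dE mulrDr.
have tmD := test_smoothM sm tD.
rewrite int2D; last 2 first.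
- exact: integrable2_test f2 tmD.
- by have := integrable2_test f2 tm'; under eq_fun do rewrite [m' _ * _]mulrC.
move=> /(canRL (addrK _)) E.
have -> : \int[leb2]_z (m z * f z * 'D_v phi z) =
    \int[leb2]_z (f z * (m z * 'D_v phi z)).
  by apply: eq_Rintegral => z _; ring.
rewrite E -opprD -int2D; last 2 first.
- exact: integrable2_test f'2 tm.
- by have := integrable2_test f2 tm'; under eq_fun do rewrite [m' _ * _]mulrC.
by congr (- _); apply: eq_Rintegral => z _; ring.
Qed.

Lemma wder_comm f fx fy fxy : wder ex f fx -> wder ey f fy -> wder ey fx fxy ->
  wder ex fy fxy.
Proof.
move=> [f2 fx2 H1] [_ fy2 H2] [_ fxy2 H3]; split; [exact: fy2|exact: fxy2|].
move=> phi tphi.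
have E z : 'D_ex ('D_ey phi) z = 'D_ey ('D_ex phi) z.
  by case/test_functionP : tphi => sm _; exact: (Dx_Dy z (sm 2%N)).
have t1 := test_D (or_introl erefl) tphi : test_function ('D_ex phi).
have t2 := test_D (or_intror erefl) tphi : test_function ('D_ey phi).
apply: oppr_inj; rewrite -(H2 _ t1) opprK -(opprK (\int[leb2]_z (fxy z * _))) -(H3 _ tphi).
rewrite -(H1 _ t2).
by apply: eq_Rintegral => z _; rewrite E.
Qed.

End weak_derivative_calculus.

(** * A Sobolev embedding *)

Section sobolev_embedding.
Context {R : realType}.
Local Notation T2 := (measurableTypeR R * measurableTypeR R)%type.
Local Notation leb := (@lebesgue_measure R).
Implicit Types (f g b : R * R -> R) (v z w : R * R) (s r : R).

Local Notation I01 := (`[0, 1]%classic : set R).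

Lemma nrmBC f g : nrm (fun z => f z - g z) = nrm (fun z => g z - f z).
Proof. by rewrite -nrmN /nrm; congr Num.sqrt; apply: eq_Rintegral => z _; rewrite opprB. Qed.

Lemma integral_indic_mul (D : set R) (f : R -> \bar R) :
  (\int[leb]_(s in D) f s = \int[leb]_s ((\1_D s)%:E * f s))%E.
Proof.
rewrite integral_mkcond; apply: eq_integral => s _.
by rewrite patchE indicE; case: ifP => _; rewrite ?mul1e ?mul0e.
Qed.

(** Integrate the derivative of [(1 - s) k(s)], which equals [k 0] at 0 and vanishes at 1. *)
Lemma C1_unit_bound (k dk : R -> R) : (forall s : R, is_derive s 1 k (dk s)) ->
  continuous dk ->
  (`|k 0|%:E <= \int[leb]_(s in I01) (`|k s| + `|dk s|)%:E)%E.
Proof.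
move=> D cdk.
have ck : continuous k.
  by move=> s; apply: differentiable_continuous; apply/derivable1_diffP; case: (D s).
pose F s := (1 - s) * k s; pose dF s := - k s + (1 - s) * dk s.
have DF s : is_derive s 1 F (dF s).
  have D1 : is_derive s 1 (fun s : R => 1 - s) (-1).
    by apply: is_derive_eq; ring.
  apply: (is_derive_eq (is_deriveM D1 (D s))).
  by rewrite /dF /GRing.scale /=; ring.
have cF : continuous F.
  by move=> s; apply: differentiable_continuous; apply/derivable1_diffP; case: (DF s).
have cdF : continuous dF.
  move=> s; apply: cvgD; first by apply: cvgN; exact: ck.
  by apply: cvgM; [apply: cvgB; [exact: cvg_cst|exact: cvg_id]|exact: cdk].
have c1 : {within `[0, 1], continuous dF} by exact: continuous_subspaceT.
have c2 : derivable_oo_LRcontinuous F 0 1.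
  split; [by move=> s _; case: (DF s)|exact: cvg_at_right_filter (cF 0)|].
  exact: cvg_at_left_filter (cF 1).
have c3 : {in `]0, 1[, F^`()%classic =1 dF}.
  by move=> s _; rewrite derive1E; case: (DF s).
have := continuous_FTC2 ltr01 c1 c2 c3.
rewrite /F subrr mul0r subr0 mul1r sub0e => E.
have -> : (`|k 0|%:E = `| \int[leb]_(x in I01) (dF x)%:E |)%E.
  by rewrite E /= normrN.
have mc (h : R -> R) : continuous h -> measurable_fun (I01 : set (measurableTypeR R)) h.
  by move=> ch; apply: measurable_funTS; exact: continuous_measurable_fun.
apply: (le_trans (le_abse_integral _ _ _)) => //.
  by apply/measurable_EFinP; exact: mc.
apply: ge0_le_integral => //.
- by apply: measurableT_comp => //; apply/measurable_EFinP; exact: mc.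
- by apply/measurable_EFinP; apply: measurable_funD; apply: measurableT_comp => //; exact: mc.
move=> s /=; rewrite in_itv/= => /andP[s0 s1]; rewrite lee_fin /dF.
rewrite (le_trans (ler_normD _ _))// normrN lerD2l normrM.
by rewrite -[leRHS]mul1r ler_wpM2r// ger0_norm ?subr_ge0// gerBl.
Qed.

Lemma is_derive_increment (k : R -> R) s (a : R) :
  (forall e : R, 0 < e -> exists2 d : R, 0 < d & forall h, `|h| <= d ->
     `|k (s + h) - k s - h * a| <= `|h| * e) -> is_derive s 1 k a.
Proof.
move=> H.
have L : (fun h : R => h^-1 *: ((k \o shift s) (h *: 1) - k s)) @ 0^' --> a.
  apply/cvgrPdist_le => e e0; have [d d0 Hd] := H e e0; near=> h.
  have h0 : h != 0 by near: h; exact: nbhs_dnbhs_neq.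
  have hd : `|h| <= d by near: h; exact: dnbhs0_le.
  have := Hd h hd; rewrite /= [h *: 1]mulr1 [h + s]addrC => K.
  rewrite -[a](mulKf h0) -[_ *: _]/(h^-1 * _) -mulrBr normrM normfV distrC.
  by rewrite ler_pdivrMl ?normr_gt0.
apply: DeriveDef; first by apply/cvg_ex; exists a.
exact/cvg_lim.
Unshelve. all: by end_near. Qed.

(** Translating [b] by [- s v] amounts to translating [f] by [s v], whence the sign. The pairing is
    differentiable although [b] is merely in L^2. *)
Lemma pairing_is_derive v f g b s : axis v -> wder v f g -> inL2 b ->
  is_derive s 1 (fun s => \int[leb2]_z (f z * translate ((- s) *: v) b z))
    (\int[leb2]_z (g z * translate ((- s) *: v) b z)).
Proof.
move=> av fg b2; have [f2 g2 _] := fg.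
set c := translate ((- s) *: v) b; have c2 : inL2 c by exact: inL2_translate.
apply: is_derive_increment => e e0.
have e1 : 0 < e / (nrm g + 1) by rewrite divr_gt0// ltr_wpDl// nrm_ge0.
have [d d0 Hd] := L2_translate_cvg av c2 e1.
exists d => // h hd.
have K := @wder_increment _ v f g c (- h) _ av fg c2 (fun r hr => Hd r (le_trans hr _)).
rewrite normrN in K; have {}K := K hd.
have E : \int[leb2]_z (f z * translate (- (s + h) *: v) b z) - \int[leb2]_z (f z * c z) =
  \int[leb2]_z (f z * (translate ((- h) *: v) c z - c z)).
  rewrite -int2B; [|exact: integrable2M f2 (inL2_translate _ b2)|exact: integrable2M].
  apply: eq_Rintegral => z _; rewrite mulrBr; congr (f z * _ - _).
  by rewrite /c translateD -scalerDl opprD addrC.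
rewrite E; move: K; rewrite mulNr => K; apply: (le_trans K); rewrite ler_wpM2l//.
rewrite mulrCA -[leRHS]mulr1 ler_wpM2l ?(ltW e0)// ler_pdivrMr ?mul1r.
  by rewrite lerDl.
by rewrite ltr_wpDl// nrm_ge0.
Qed.

Lemma continuous_pairing v f b : axis v -> inL2 f -> inL2 b ->
  continuous (fun s => \int[leb2]_z (f z * translate ((- s) *: v) b z)).
Proof.
move=> av f2 b2 s.
set c := translate ((- s) *: v) b; have c2 : inL2 c by exact: inL2_translate.
apply/cvgrPdist_le => e e0.
have e1 : 0 < e / (nrm f + 1) by rewrite divr_gt0// ltr_wpDl// nrm_ge0.
have [d d0 Hd] := L2_translate_cvg av c2 e1.
near=> t.
rewrite -int2B; [|exact: integrable2M|exact: integrable2M f2 (inL2_translate _ b2)].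
have -> : (fun z => f z * c z - f z * translate (- t *: v) b z) =
    (fun z => f z * (c z - translate ((s - t) *: v) c z)).
  apply/funext => z; rewrite mulrBr; congr (_ - f z * _).
  by rewrite /c translateD -scalerDl addrAC subrr add0r.
apply: (le_trans (nrm_CS f2 (inL2B c2 (inL2_translate _ c2)))).
rewrite nrmBC.
have K : nrm (fun z => translate ((s - t) *: v) c z - c z) <= e / (nrm f + 1).
  by apply: Hd; near: t; apply: cvgr_dist_le d0; exact: cvg_id.
apply: (le_trans (ler_wpM2l (nrm_ge0 f) K)).
rewrite mulrCA -[leRHS]mulr1 ler_wpM2l ?(ltW e0)// ler_pdivrMr ?mul1r.
  by rewrite lerDl.
by rewrite ltr_wpDl// nrm_ge0.
Unshelve. all: by end_near. Qed.

Lemma pairing_unit_bound v f g b : axis v -> wder v f g -> inL2 b ->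
  (`|\int[leb2]_z (f z * b z)|%:E <= \int[leb]_(s in I01)
    (`|\int[leb2]_z (f z * translate ((- s) *: v) b z)| +
     `|\int[leb2]_z (g z * translate ((- s) *: v) b z)|)%:E)%E.
Proof.
move=> av fg b2; have [f2 g2 _] := fg.
have := C1_unit_bound (fun s => pairing_is_derive s av fg b2) (continuous_pairing av g2 b2).
by rewrite oppr0 scale0r translate0.
Qed.

End sobolev_embedding.

Section sigma_finite_plane.
Context {R : realType}.
Local Notation T2 := (measurableTypeR R * measurableTypeR R)%type.

Lemma leb2_sigma_finite : sigma_finite setT (@leb2 R).
Proof.
exists (fun n => rect (- n%:R) n%:R (- n%:R) n%:R).
  apply/esym/seteqP; split => // z _.
  have [n [n1 n2]] : exists n, `|z.1| < n%:R /\ `|z.2| < n%:R.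
    exists (Num.truncn (Num.max `|z.1| `|z.2|)).+1.
    by split; apply: le_lt_trans (truncnS_gt _); rewrite le_max lexx ?orbT.
  by exists n => //; rewrite /rect /= -!ltr_norml.
by move=> n; split; [exact: measurable_rect|exact: leb2_rect_lty].
Qed.

(** [leb2] equipped with its sigma-finiteness, as Tonelli's theorem for two copies of the plane
    requires. *)
Definition sleb2 : {sigma_finite_measure set T2 -> \bar R} :=
  HB.pack (Measure.sort (@leb2 R))
    (Measure_isSigmaFinite.Build _ T2 R (@leb2 R) leb2_sigma_finite).

End sigma_finite_plane.

(** * The sup bound by duality *)

Section sobolev_sup.
Context {R : realType}.
Local Notation T1 := (measurableTypeR R).
Local Notation T2 := (T1 * T1)%type.
Local Notation leb := (@lebesgue_measure R).
Implicit Types (f g b : R * R -> R) (v z w : R * R) (s r : R).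

Local Notation I01 := (`[0, 1]%classic : set R).
Local Notation chi := (\1_I01 : R -> R).
Local Notation Q := (I01 `*` I01).

(** A majorant of the pairing of [g] with the translate of [b] by [- w]; its integrand is
    nonnegative and jointly measurable in [(w, z)], as Tonelli's theorem requires. *)
Definition shifted_mass g b w : \bar R := (\int[leb2]_z (b z * `|g (z + w)|)%:E)%E.

Lemma measurable_shift : measurable_fun [set: (T2 * T2)%type]
  (fun p : (T2 * T2)%type => (p.2 + p.1 : T2)).
Proof.
apply/measurable_fun_pairP; split; apply: measurable_funD.
- by apply: measurableT_comp => //; exact: measurable_snd.
- by apply: measurableT_comp => //; exact: measurable_fst.
- by apply: measurableT_comp => //; exact: measurable_snd.
- by apply: measurableT_comp => //; exact: measurable_fst.
Qed.

Lemma measurable_shifted g b : inL2 g -> inL2 b ->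
  measurable_fun [set: (T2 * T2)%type] (fun p => (b p.2 * `|g (p.2 + p.1)|)%:E).
Proof.
move=> g2 b2; apply/measurable_EFinP; apply: measurable_funM.
  exact: (measurableT_comp (inL2_measurable b2) measurable_snd).
apply: measurableT_comp => //.
exact: (measurableT_comp (inL2_measurable g2) measurable_shift).
Qed.

Lemma shifted_mass_ge0 g b w : (forall z, 0 <= b z) -> (0 <= shifted_mass g b w)%E.
Proof. by move=> b0; apply: integral_ge0 => z _; rewrite lee_fin mulr_ge0. Qed.

Lemma measurable_shifted_mass g b : inL2 g -> inL2 b -> (forall z, 0 <= b z) ->
  measurable_fun [set: T2] (shifted_mass g b).
Proof.
move=> g2 b2 b0.
have := @measurable_fun_fubini_tonelli_F _ _ T2 T2 R (@sleb2 R)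
  (fun p => (b p.2 * `|g (p.2 + p.1)|)%:E) (measurable_shifted g2 b2).
by apply => p; rewrite lee_fin mulr_ge0.
Qed.

Lemma pairing_le_shifted_mass g b w : inL2 g -> inL2 b -> (forall z, 0 <= b z) ->
  (`|\int[leb2]_z (g z * translate (- w) b z)|%:E <= shifted_mass g b w)%E.
Proof.
move=> g2 b2 b0; rewrite int2_translateM// opprK.
have gb := integrable2M (inL2_translate w g2) b2.
rewrite (EFin_normr_Rintegral measurableT gb).
apply: (le_trans (le_abse_integral _ _ _)) => //; first by case/integrableP: gb.
rewrite le_eqVlt; apply/orP; left; apply/eqP; apply: eq_integral => z _.
by rewrite /= normrM mulrC ger0_norm.
Qed.

(** The unit-interval bound is applied in [x], then in [y] to both resulting pairings; this is why
    exactly [f], [f_x], [f_y] and [f_xy] occur. *)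
Lemma pairing_le_square f fx fy fxy b :
  wder ex f fx -> wder ey f fy -> wder ey fx fxy -> inL2 b -> (forall z, 0 <= b z) ->
  (`|\int[leb2]_z (f z * b z)|%:E <= \int[leb2]_(w in Q)
    (shifted_mass f b w + shifted_mass fy b w +
     (shifted_mass fx b w + shifted_mass fxy b w)))%E.
Proof.
move=> Hx Hy Hxy b2 b0.
have [f2 fx2 _] := Hx; have [_ fy2 _] := Hy; have [_ fxy2 _] := Hxy.
pose S w := (shifted_mass f b w + shifted_mass fy b w +
     (shifted_mass fx b w + shifted_mass fxy b w))%E.
have S0 w : (0 <= S w)%E.
  by apply: adde_ge0; apply: adde_ge0; exact: shifted_mass_ge0.
have mS : measurable_fun [set: T2] S.
  by apply: emeasurable_funD; apply: emeasurable_funD; exact: measurable_shifted_mass.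
have mQ : measurable (Q : set T2) by apply: measurableX; exact: measurable_itv.
have mSQ : measurable_fun [set: T2] (S \_ Q).
  by apply/(measurable_restrictT _ _).1 => //; exact: measurable_funTS.
have SQ0 w : (0 <= (S \_ Q) w)%E by rewrite patchE; case: ifP.
have SQE s r : (S \_ Q) (s, r) = ((\1_I01 s)%:E * ((\1_I01 r)%:E * S (s, r)))%E.
  rewrite patchE !indicE in_setX /=.
  by case: (s \in _); case: (r \in _); rewrite ?mul1e ?mul0e.
rewrite integral_mkcond -/S /leb2 fubini_tonelli1//.
apply: (le_trans (pairing_unit_bound (or_introl erefl) Hx b2)).
rewrite integral_indic_mul; apply: ge0_le_integral => //.
- apply/measurable_EFinP; apply: measurable_funM.
    by apply: measurable_indic; exact: measurable_itv.
  apply: continuous_measurable_fun => s.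
  by apply: cvgD; apply: cvg_norm;
    apply: (continuous_pairing (or_introl erefl) _ b2).
- exact: measurable_fun_fubini_tonelli_F.
move=> s _; rewrite /fubini_F.
under eq_integral do rewrite SQE.
rewrite ge0_integralZl//; last 2 first.
- apply: emeasurable_funM; first by apply/measurable_EFinP; apply: measurable_indic; exact: measurable_itv.
  exact: (measurableT_comp mS (measurable_pair1 s)).
- by move=> r _; rewrite mule_ge0// lee_fin.
rewrite lee_wpmul2l ?lee_fin//.
have bs2 := inL2_translate ((- s) *: ex) b2.
rewrite EFinD.
have K1 := pairing_unit_bound (or_intror erefl) Hy bs2.
have K2 := pairing_unit_bound (or_intror erefl) Hxy bs2.
apply: (le_trans (leeD K1 K2)).
have cont g (g2 : inL2 g) : measurable_fun [set: T1]
    (fun r => `|\int[leb2]_z (g z * translate ((- r) *: ey) (translate ((- s) *: ex) b) z)|).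
  apply: continuous_measurable_fun => r; apply: cvg_norm.
  exact: (continuous_pairing (or_intror erefl) g2 bs2).
have mI : measurable (I01 : set T1) by exact: measurable_itv.
rewrite -ge0_integralD//; last 2 first.
- by apply/measurable_EFinP; apply: measurable_funD; apply: measurable_funTS; exact: cont.
- by apply/measurable_EFinP; apply: measurable_funD; apply: measurable_funTS; exact: cont.
rewrite -integral_indic_mul; apply: ge0_le_integral => //.
- by move=> r _; rewrite -EFinD lee_fin !addr_ge0.
- by apply: emeasurable_funD; apply/measurable_EFinP; apply: measurable_funD;
    apply: measurable_funTS; exact: cont.
- apply: measurable_funTS; exact: (measurableT_comp mS (measurable_pair1 s)).
move=> r _.
have tE : translate ((- r) *: ey) (translate ((- s) *: ex) b) = translate (- (s, r)) b.
  rewrite translateD; congr (translate _ b).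
  by apply/pair_equal_spec; split; rewrite /= /GRing.scale/=; ring.
rewrite tE !EFinD /S; apply: leeD; apply: leeD; exact: pairing_le_shifted_mass.
Qed.

Lemma int2_indic (A : set (R * R)) : measurable (A : set T2) -> (leb2 A < +oo)%E ->
  (\int[leb2]_z (\1_A z : R))%:E = leb2 A.
Proof.
move=> mA Afin; rewrite int2_EFin; last exact: integrable2_indic.
by rewrite integral_indic// setIT.
Qed.

Lemma nrm_Q : nrm (\1_Q) = 1.
Proof.
have mQ : measurable (Q : set T2) by apply: measurableX; exact: measurable_itv.
have Q1 : leb2 Q = 1%E.
  rewrite leb2X; [|exact: measurable_itv..].
  by rewrite !lebesgue_measure_itv/= lte_fin ltr01 oppr0 adde0 mule1.
rewrite /nrm; under eq_Rintegral do rewrite indic_sqr.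
have : (\int[leb2]_z (\1_Q z : R))%:E = 1%E.
  by rewrite -Q1; apply: int2_indic => //; rewrite Q1 ltry.
by move=> [->]; rewrite sqrtr1.
Qed.

Lemma inL2_normr g : inL2 g -> inL2 (fun z => `|g z|).
Proof.
move=> g2; apply: (inL2_le _ g2) => [|z]; last by rewrite normr_id.
by apply: measurableT_comp => //; exact: inL2_measurable.
Qed.

(** After exchanging the integrals, the inner one is [b z] times the integral of [|g|] over the unit
    square shifted by [z], which Cauchy-Schwarz bounds by [nrm g]. *)
Lemma shifted_mass_square g b : inL2 g -> inL2 b -> integrable2 b ->
  (forall z, 0 <= b z) ->
  (\int[leb2]_(w in Q) shifted_mass g b w <= (nrm g * \int[leb2]_z b z)%:E)%E.
Proof.
move=> g2 b2 bi b0.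
have mQ : measurable (Q : set T2) by apply: measurableX; exact: measurable_itv.
have Qfin : (leb2 Q < +oo)%E.
  rewrite leb2X; [|exact: measurable_itv..].
  by rewrite !lebesgue_measure_itv/= lte_fin ltr01 oppr0 adde0 mule1 ltry.
have Q2 : inL2 (\1_Q) by exact: inL2_indic.
pose G (p : (T2 * T2)%type) : \bar R := ((\1_Q p.1)%:E * (b p.2 * `|g (p.2 + p.1)|)%:E)%E.
have mG : measurable_fun setT G.
  apply: emeasurable_funM; last exact: measurable_shifted.
  apply/measurable_EFinP.
  exact: (measurableT_comp (inL2_measurable Q2) measurable_fst).
have G0 p : (0 <= G p)%E by rewrite /G -EFinM lee_fin !mulr_ge0.
have -> : (\int[leb2]_(w in Q) shifted_mass g b w = \int[leb2]_w \int[leb2]_z G (w, z))%E.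
  rewrite integral_mkcond; apply: eq_integral => w _.
  rewrite patchE /G /= indicE; case: ifP => _.
    by apply: eq_integral => z _; rewrite mul1e.
  by under eq_integral do rewrite mul0e; rewrite integral0.
have := @fubini_tonelli _ _ T2 T2 R (@sleb2 R) (@sleb2 R) G mG G0.
rewrite /= => ->.
rewrite -int2Z// int2_EFin; last exact: integrable2Z.
apply: ge0_le_integral => //.
- by move=> z _; apply: integral_ge0.
- have := @measurable_fun_fubini_tonelli_G _ _ T2 T2 R (@sleb2 R) G mG G0.
  by [].
- by apply/measurable_EFinP; apply: measurable_funM => //; exact: inL2_measurable.
move=> z _.
have -> : (\int[leb2]_w G (w, z) = (\int[leb2]_w (b z * (\1_Q w * `|translate z g w|)))%:E)%E.
  rewrite int2_EFin.
    by apply: eq_integral => w _; rewrite /G /= -EFinM /translate; congr EFin; rewrite [w + z]addrC; ring.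
  apply: integrable2Z; apply: integrable2M => //.
  exact: inL2_normr (inL2_translate z g2).
rewrite lee_fin int2Z; last first.
  by apply: integrable2M => //; exact: inL2_normr (inL2_translate z g2).
rewrite mulrC ler_wpM2r//.
have n2 := inL2_normr (inL2_translate z g2).
apply: (le_trans (le_trans (ler_norm _) (nrm_CS Q2 n2))).
rewrite nrm_Q mul1r -(nrm_translate z g2) /nrm.
by under eq_Rintegral do rewrite real_normK ?num_real//.
Qed.

Lemma int2_eq0_ae f : integrable2 f -> (forall z, 0 <= f z) ->
  \int[leb2]_z f z = 0 -> {ae leb2, forall z, f z = 0}.
Proof.
move=> fi f0 If; have E := int2_EFin fi; rewrite If in E.
have mf : measurable_fun [set: T2] (EFin \o f) by case/integrableP : fi.
have : (\int[leb2]_z `|(EFin \o f) z| = 0)%E.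
  by rewrite [RHS]E; apply: eq_integral => z _ /=; rewrite ger0_norm.
move=> /(ae_eq_integral_abs leb2 measurableT mf).
by apply: ae2_imp => z /(_ I) [].
Qed.

(** Tested on the part of the set where [f > M] in a box, the hypothesis says that a positive
    function has a nonpositive integral. *)
Lemma sup_of_indic f (M : R) : inL2 f ->
  (forall A : set (R * R), measurable (A : set T2) -> (leb2 A < +oo)%E ->
    \int[leb2]_z (f z * \1_A z) <= M * \int[leb2]_z (\1_A z : R)) ->
  {ae leb2, forall z, f z <= M}.
Proof.
move=> f2 H.
suff K (n : nat) : {ae leb2, forall z, rect (- n%:R) n%:R (- n%:R) n%:R z -> f z <= M}.
  have := ae_foralln K; apply: ae2_imp => z Hz.
  have [n [n1 n2]] : exists n, `|z.1| < n%:R /\ `|z.2| < n%:R.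
    exists (Num.truncn (Num.max `|z.1| `|z.2|)).+1.
    by split; apply: le_lt_trans (truncnS_gt _); rewrite le_max lexx ?orbT.
  by apply: (Hz n); rewrite /rect /= -!ltr_norml.
set D := rect _ _ _ _.
pose A : set (R * R) := [set z | M < f z] `&` D.
have mf := inL2_measurable f2.
have mD : measurable (D : set T2) by exact: measurable_rect.
have mA : measurable (A : set T2).
  apply: measurableI => //.
  rewrite (_ : [set z | M < f z] = setT `&` f @^-1` `]M, +oo[%classic).
    by apply: mf => //; exact: measurable_itv.
  by apply/seteqP; split => z /=; rewrite in_itv/= andbT; [move=> ->|case].
have Afin : (leb2 A < +oo)%E.
  apply: le_lt_trans (leb2_rect_lty (- n%:R) n%:R (- n%:R) n%:R).
  by apply: le_measure; rewrite ?inE//; exact: subIsetr.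
have A2 := inL2_indic mA Afin; have Ai := integrable2_indic mA Afin.
have fAi := integrable2M f2 A2.
have gi : integrable2 (fun z => f z * \1_A z - M * \1_A z).
  by apply: integrable2B => //; exact: integrable2Z.
have g0 z : 0 <= f z * \1_A z - M * \1_A z.
  rewrite -mulrBl; have [Az|Az] := pselect (A z); last by rewrite indic0z// mulr0.
  by rewrite indic1// mulr1 subr_ge0 ltW//; case: Az.
have g00 : \int[leb2]_z (f z * \1_A z - M * \1_A z) = 0.
  apply/eqP; rewrite eq_le int2_ge0// andbT int2B//; last exact: integrable2Z.
  by rewrite int2Z// subr_le0 H.
have := int2_eq0_ae gi g0 g00; apply: ae2_imp => z gz Dz.
rewrite leNgt; apply/negP => Mf.
have Az : A z by [].
by move: gz; rewrite indic1// !mulr1 => /eqP; rewrite subr_eq0 gt_eqF.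
Qed.

Lemma integral_square_D2 (F G : T2 -> \bar R) :
  measurable_fun setT F -> measurable_fun setT G ->
  (forall w, 0 <= F w)%E -> (forall w, 0 <= G w)%E ->
  (\int[leb2]_(w in Q) (F w + G w) =
   \int[leb2]_(w in Q) F w + \int[leb2]_(w in Q) G w)%E.
Proof.
move=> mF mG F0 G0.
have mQ : measurable (Q : set T2) by apply: measurableX; exact: measurable_itv.
by apply: ge0_integralD => //; exact: measurable_funTS.
Qed.

(** Duality between L^1 and L^infinity: only indicators of sets of finite measure have to be paired
    with [f]. *)
Theorem sobolev_sup f fx fy fxy :
  wder ex f fx -> wder ey f fy -> wder ey fx fxy ->
  {ae leb2, forall z, `|f z| <= nrm f + nrm fy + (nrm fx + nrm fxy)}.
Proof.
move=> Hx Hy Hxy; pose M := nrm f + nrm fy + (nrm fx + nrm fxy).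
have [f2 fx2 _] := Hx; have [_ fy2 _] := Hy; have [_ fxy2 _] := Hxy.
have key (A : set (R * R)) : measurable (A : set T2) -> (leb2 A < +oo)%E ->
    `|\int[leb2]_z (f z * \1_A z)| <= M * \int[leb2]_z (\1_A z : R).
  move=> mA Afin; have A2 := inL2_indic mA Afin; have Ai := integrable2_indic mA Afin.
  have A0 z : 0 <= \1_A z :> R by [].
  rewrite -lee_fin; apply: (le_trans (pairing_le_square Hx Hy Hxy A2 A0)).
  have ms g (g2 : inL2 g) : measurable_fun setT (shifted_mass g (\1_A)).
    exact: measurable_shifted_mass.
  have s0 g w : (0 <= shifted_mass g (\1_A) w)%E by exact: shifted_mass_ge0.
  have sQ g (g2 : inL2 g) := shifted_mass_square g2 A2 Ai A0.
  have -> := integral_square_D2 (emeasurable_funD (ms _ f2) (ms _ fy2))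
    (emeasurable_funD (ms _ fx2) (ms _ fxy2))
    (fun w => adde_ge0 (s0 _ w) (s0 _ w)) (fun w => adde_ge0 (s0 _ w) (s0 _ w)).
  rewrite (integral_square_D2 (ms _ f2) (ms _ fy2) (s0 _) (s0 _)).
  rewrite (integral_square_D2 (ms _ fx2) (ms _ fxy2) (s0 _) (s0 _)).
  rewrite /M !mulrDl !EFinD; apply: leeD; apply: leeD; exact: sQ.
have fM : {ae leb2, forall z, f z <= M}.
  apply: (sup_of_indic f2) => A mA Afin.
  exact: le_trans (ler_norm _) (key A mA Afin).
have fN : {ae leb2, forall z, - f z <= M}.
  apply: (sup_of_indic (inL2N f2)) => A mA Afin.
  apply: le_trans (key A mA Afin); rewrite -normrN; apply: le_trans (ler_norm _).
  rewrite -int2N; last exact: integrable2M f2 (inL2_indic mA Afin).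
  by rewrite le_eqVlt; apply/orP; left; apply/eqP; apply: eq_Rintegral => z _; ring.
by apply: ae2_imp2 fM fN => z h1 h2; rewrite ler_norml h1 lerNl h2.
Qed.

End sobolev_sup.

(** * Slices of the solution in time *)

Section solution_data.
Context {R : realType}.
Local Notation T2 := (measurableTypeR R * measurableTypeR R)%type.
Implicit Types (f g : R * R -> R) (u : R -> R * R -> R) (s t h : R).

Lemma ereal_cvg0_lt (F : set_system R) {FF : Filter F} (N : R -> \bar R) (e : R) :
  N x @[x --> F] --> 0%E -> 0 < e -> \forall x \near F, (N x < e%:E)%E.
Proof.
move=> /fine_cvgP[fin /cvgr0_norm_lt H] e0.
near=> x; have fx : N x \is a fin_num by near: x.
rewrite -(fineK fx) lte_fin (le_lt_trans (ler_norm _))//.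
by near: x; exact: H.
Unshelve. all: by end_near. Qed.

Lemma norm_continuous01_lt N u s (e : R) : norm_continuous01 N u -> s \in `[0, 1] ->
  0 < e -> exists2 d : R, 0 < d & forall t, t \in `[0, 1] -> `|t - s| <= d ->
    (N (u t \- u s)%R < e%:E)%E.
Proof.
move=> H sI e0; have FF : Filter (within [set` `[0, 1]] (nbhs s)) by exact: within_filter.
have := @ereal_cvg0_lt _ FF _ _ (H s sI) e0.
rewrite near_withinE => /nbhs_ballP[d /= d0 Hd].
exists (d / 2); first by rewrite divr_gt0.
move=> t tI td; apply: Hd => //; rewrite /ball /= distrC (le_lt_trans td)//.
by rewrite gtr_pMr// invf_lt1// ltr1n.
Qed.

Lemma L2norm_wD_le_Hnorm k i j f : (i + j <= k)%N ->
  (L2norm (wD i j f) <= Hnorm k f)%E.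
Proof.
move=> ijk; have ik : (i < k.+1)%N by rewrite ltnS (leq_trans _ ijk)// leq_addr.
have jk : (j < k.+1)%N by rewrite ltnS (leq_trans _ ijk)// leq_addl.
have L0 g : (0 <= L2norm g)%E by exact: Lnorm_ge0.
have -> : L2norm (wD i j f) = ((L2norm (wD i j f) `^ 2) `^ 2^-1)%E.
  by rewrite -poweRrM divff// poweRe1.
rewrite /Hnorm gt0_ler_poweR//.
- by rewrite in_itv/= poweR_ge0 leey.
- by rewrite in_itv/= leey andbT; apply: sume_ge0 => a _; apply: sume_ge0 => b _; exact: poweR_ge0.
rewrite (bigD1 (Ordinal ik))//= (bigD1 (Ordinal jk))//= -addeA leeDl//.
apply: adde_ge0; apply: sume_ge0 => a _; first exact: poweR_ge0.
by apply: sume_ge0 => b _; exact: poweR_ge0.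
Qed.

Lemma nrmZ (c : R) f : inL2 f -> nrm (fun z => c * f z) = `|c| * nrm f.
Proof.
move=> f2; rewrite /nrm; under eq_Rintegral do rewrite exprMn.
rewrite int2Z; last exact: inL2_sqr.
by rewrite sqrtrM ?sqr_ge0// sqrtr_sqr.
Qed.

(* [wD 0 0 (u t)] is only a.e. equal to [u t]. *)
Definition Du u i j t : R * R -> R :=
  if (i + j == 0)%N then u t else wD i j (u t).

Lemma Du_is_wderiv k u i j t : C0H k u -> t \in `[0, 1] -> (i + j <= k)%N ->
  is_wderiv i j (u t) (Du u i j t).
Proof.
move=> [H _] tI ijk; have [u2 Hu] := H t tI.
rewrite /Du; case: eqVneq => [|_].
  move=> /eqP; rewrite addn_eq0 => /andP[/eqP -> /eqP ->].
  exact: is_wderiv00.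
have [g Hg] := Hu _ _ ijk.
by rewrite /wD; case: xgetP => [h -> //|/(_ g)].
Qed.

Lemma Du_inL2 k u i j t : C0H k u -> t \in `[0, 1] -> (i + j <= k)%N ->
  inL2 (Du u i j t).
Proof. by move=> H tI ijk; have [] := Du_is_wderiv H tI ijk. Qed.

Lemma nrm_ae f g : inL2 f -> inL2 g -> {ae leb2, forall z, f z = g z} -> nrm f = nrm g.
Proof.
move=> f2 g2 fg; congr Num.sqrt; apply: int2_ae; [exact: inL2_sqr..|].
by apply: ae2_imp fg => z ->.
Qed.

(** The representatives chosen by [wD] need not depend linearly on the function; uniqueness of weak
    derivatives identifies, up to a null set, the derivative of the difference with the difference
    of the derivatives. *)
Lemma Du_continuous k u i j s (e : R) : C0H k u -> C0L2 u -> s \in `[0, 1] ->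
  (i + j <= k)%N -> 0 < e ->
  exists2 d : R, 0 < d & forall t, t \in `[0, 1] -> `|t - s| <= d ->
    nrm (fun z => Du u i j t z - Du u i j s z) <= e.
Proof.
move=> H [uL2 HL] sI ijk e0.
have [ij0|ij0] := eqVneq (i + j)%N 0%N.
  have [d d0 Hd] := norm_continuous01_lt HL sI e0.
  exists d => // t tI td; rewrite /Du ij0 eqxx.
  have := Hd t tI td; rewrite L2norm_sqrt; last exact: inL2B (uL2 t tI) (uL2 s sI).
  by rewrite lte_fin => /ltW.
have [d d0 Hd] := norm_continuous01_lt H.2 sI e0.
exists d => // t tI td.
have Ht := Du_is_wderiv H tI ijk; have Hs := Du_is_wderiv H sI ijk.
have W := is_wderivB (uL2 t tI) (uL2 s sI) Ht Hs.
have W' : is_wderiv i j (u t \- u s) (wD i j (u t \- u s)).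
  by rewrite /wD; case: xgetP => [h -> //|/(_ _ W)].
have [w2 _] := W'; have [g2 _] := W.
rewrite (nrm_ae g2 w2 (is_wderiv_uniq W W')).
have := le_lt_trans (L2norm_wD_le_Hnorm (u t \- u s) ijk) (Hd t tI td).
by rewrite L2norm_sqrt// lte_fin => /ltW.
Qed.

Lemma continuous01_bounded (n : R -> R) :
  (forall s (e : R), s \in `[0, 1] -> 0 < e -> exists2 d : R, 0 < d &
     forall t, t \in `[0, 1] -> `|t - s| <= d -> `|n t - n s| <= e) ->
  exists C : R, forall t, t \in `[0, 1] -> n t <= C.
Proof.
move=> H.
have c : {within `[0, 1], continuous n}.
  apply/subspace_continuousP => s /= sI; apply/cvgrPdist_le => e e0.
  have [d d0 Hd] := H s e sI e0.
  rewrite near_withinE; apply/nbhs_ballP; exists d => //= t.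
  rewrite /ball /= => std tI; rewrite distrC; apply: Hd => //.
  by rewrite distrC ltW.
have [c0 _ Hc] := EVT_max ler01 c.
by exists (n c0) => t tI; exact: Hc.
Qed.

Lemma nrm_dist f g : inL2 f -> inL2 g -> `|nrm f - nrm g| <= nrm (fun z => f z - g z).
Proof.
move=> f2 g2.
have tri (a b : R * R -> R) : inL2 a -> inL2 b -> nrm a - nrm b <= nrm (fun z => a z - b z).
  move=> a2 b2; rewrite lerBlDr.
  have := nrmD (inL2B a2 b2) b2; rewrite [X in nrm X](_ : _ = a)//.
  by apply/funext => z; rewrite subrK.
by rewrite ler_norml tri// andbT lerNl opprB nrmBC tri.
Qed.

Lemma Du_bounded k u i j : C0H k u -> C0L2 u -> (i + j <= k)%N ->
  exists C : R, forall t, t \in `[0, 1] -> nrm (Du u i j t) <= C.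
Proof.
move=> H HL ijk; apply: (@continuous01_bounded (fun t => nrm (Du u i j t))).
move=> s e sI e0; have [d d0 Hd] := Du_continuous H HL sI ijk e0.
exists d => // t tI td; apply: le_trans (Hd t tI td).
by apply: nrm_dist; exact: (Du_inL2 H).
Qed.

Lemma dt_is_L2deriv u t : C1L2 u -> t \in `[0, 1] -> is_L2deriv u t (dt u t).
Proof.
move=> [_ H _] tI; have [v Hv] := H t tI.
by rewrite /dt; case: xgetP => [w -> //|/(_ v)].
Qed.

Lemma dt_increment u t (e : R) : C1L2 u -> t \in `[0, 1] -> 0 < e ->
  exists2 d : R, 0 < d & forall h, `|h| <= d -> t + h \in `[0, 1] ->
    nrm (fun z => u (t + h) z - u t z - h * dt u t z) <= `|h| * e.
Proof.
move=> H tI e0; have [[uL2 _] _ _] := H.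
have [v2 Hv] := dt_is_L2deriv H tI.
have FF : Filter (within [set h | t + h \in `[0, 1]] (0 : R)^') by exact: within_filter.
have := @ereal_cvg0_lt _ FF _ _ Hv e0.
rewrite near_withinE => /nbhs_ballP[d /= d0 Hd].
exists (d / 2); first by rewrite divr_gt0.
move=> h hd thI; have [->|h0] := eqVneq h 0.
  rewrite normr0 mul0r (_ : (fun z => _) = fun=> 0).
    rewrite /nrm (_ : (fun z => _) = cst 0); last by apply/funext => z; rewrite expr0n.
    by rewrite /Rintegral integral0 sqrtr0.
  by apply/funext => z; rewrite addr0 subrr mul0r subrr.
have q2 : inL2 (fun z => h^-1 * (u (t + h) z - u t z) - dt u t z).
  by apply: inL2B => //; apply: inL2Z; apply: inL2B; exact: uL2.
have : nrm (fun z => h^-1 * (u (t + h) z - u t z) - dt u t z) < e.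
  rewrite -lte_fin -L2norm_sqrt//; apply: Hd => //.
  rewrite /ball /= sub0r normrN (le_lt_trans hd)//.
  by rewrite gtr_pMr// invf_lt1// ltr1n.
move=> K; have -> : (fun z => u (t + h) z - u t z - h * dt u t z) =
    (fun z => h * (h^-1 * (u (t + h) z - u t z) - dt u t z)).
  by apply/funext => z; rewrite mulrBr mulVKf.
by rewrite nrmZ// ler_wpM2l// ltW.
Qed.

(** The sup bound for [u_x] involves [u_x], [u_xy], [u_xx] and [u_xxy], hence derivatives of order
    at most three. *)
Lemma Dx_bounded k u : (3 <= k)%N -> C0H k u -> C0L2 u -> exists2 M : R, 0 <= M &
  forall t, t \in `[0, 1] -> {ae leb2, forall z, `|Du u 1 0 t z| <= M}.
Proof.
move=> k3 H HL.
have le i j : (i + j <= 3)%N -> (i + j <= k)%N by move=> h; exact: leq_trans k3.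
have B i j (ij : (i + j <= 3)%N) := Du_bounded H HL (le i j ij).
have [C1 H1] := B 1%N 0%N isT; have [C2 H2] := B 1%N 1%N isT.
have [C3 H3] := B 2%N 0%N isT; have [C4 H4] := B 2%N 1%N isT.
exists `|C1 + C2 + (C3 + C4)| => // t tI.
have W i j (ij : (i + j <= 3)%N) := Du_is_wderiv H tI (le i j ij).
have S := sobolev_sup (is_wderiv_wder_x (W 1 0 isT) (W 2 0 isT))
  (is_wderiv_wder_y (W 1 0 isT) (W 1 1 isT)) (is_wderiv_wder_y (W 2 0 isT) (W 2 1 isT)).
apply: ae2_imp S => z /le_trans; apply; apply: le_trans (ler_norm _).
by apply: lerD; apply: lerD; [exact: H1|exact: H2|exact: H3|exact: H4].
Qed.

Lemma ZK_ae u t : C0H 4 u -> ZK_solution u -> t \in `[0, 1] ->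
  {ae leb2, forall z, dt u t z =
    - (Du u 3 0 t z + Du u 1 2 t z + Du u 1 0 t z * u t z)}.
Proof.
move=> H HZ tI; apply: ae2_imp (HZ t tI) => z.
have -> : Du u 3 0 t = wD 3 0 (u t) by [].
have -> : Du u 1 2 t = wD 1 2 (u t) by [].
have -> : Du u 1 0 t = wD 1 0 (u t) by [].
move: (dt u t z) (wD 3 0 (u t) z) (wD 1 2 (u t) z) (u t z) (wD 1 0 (u t) z).
by move=> a b c d e E; lra.
Qed.

End solution_data.

(** * Exponential weights and decay *)

Section weights.
Context {R : realType}.
Local Notation T2 := (measurableTypeR R * measurableTypeR R)%type.
Implicit Types (f g h : R * R -> R) (z v : R * R) (c e : R).

(** Total derivatives, kept together with their integrability. They can be combined linearly, and an
    integral identity becomes a pointwise one, left to [ring]. *)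
Definition null2 h : Prop := integrable2 h /\ \int[leb2]_z h z = 0.

Lemma null2D f g : null2 f -> null2 g -> null2 (fun z => f z + g z).
Proof. by move=> [fi f0] [gi g0]; split; [exact: integrable2D|rewrite int2D// f0 g0 addr0]. Qed.

Lemma null2Z c f : null2 f -> null2 (fun z => c * f z).
Proof. by move=> [fi f0]; split; [exact: integrable2Z|rewrite int2Z// f0 mulr0]. Qed.

Lemma null2_eq f g : null2 f -> f =1 g -> null2 g.
Proof. by move=> H /funext <-. Qed.

Lemma null2_parts v f f' g g' : axis v -> wder v f f' -> wder v g g' ->
  null2 (fun z => f' z * g z + f z * g' z).
Proof.
move=> av ff' gg'; have [f2 f'2 _] := ff'; have [g2 g'2 _] := gg'.
split; first by apply: integrable2D; exact: integrable2M.
by rewrite int2D ?(int2_by_parts av ff' gg')//; exact: integrable2M.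
Qed.

Lemma fatou_int2 (F : nat -> R * R -> R) f (C : R) :
  (forall n, integrable2 (F n)) -> (forall n z, 0 <= F n z) ->
  (forall n, \int[leb2]_z F n z <= C) -> (forall z, F n z @[n --> \oo] --> f z) ->
  integrable2 f /\ \int[leb2]_z f z <= C.
Proof.
move=> Fi F0 FC Ff.
have mF n : measurable_fun [set: T2] (F n) by case/integrableP : (Fi n) => /measurable_EFinP.
have mf : measurable_fun [set: T2] f.
  by apply: (measurable_fun_cvg mF) => z _; exact: Ff.
have f0 z : 0 <= f z.
  rewrite -(cvg_lim _ (Ff z))//; apply: limr_ge; first by apply/cvg_ex; exists (f z).
  by apply: nearW => n; exact: F0.
have K : (\int[leb2]_z (f z)%:E <= C%:E)%E.
  have E z : (f z)%:E = limn_einf (fun n => (F n z)%:E).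
    rewrite is_cvg_limn_einfE.
      by apply/esym/cvg_lim => //; apply/fine_cvgP; split; [exact: nearW|exact: Ff].
    by apply/cvg_ex; exists (f z)%:E; apply/fine_cvgP; split; [exact: nearW|exact: Ff].
  under eq_integral do rewrite E.
  apply: (le_trans (fatou _ _ _ _)) => //.
  - by move=> n; exact/measurable_EFinP.
  - by move=> n z _; rewrite lee_fin.
  rewrite limn_einf_lim; apply: lime_le; first exact: is_cvg_einfs.
  apply: nearW => n; apply: (@le_trans _ _ (\int[leb2]_z (F n z)%:E)%E).
    by apply: ereal_inf_lbound; exists n => //=.
  by rewrite -int2_EFin// lee_fin.
have fi : integrable2 f.
  apply/integrableP; split; first exact/measurable_EFinP.
  under eq_integral do rewrite /= ger0_norm//.
  exact: (le_lt_trans K (ltry _)).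
by split => //; rewrite -lee_fin int2_EFin.
Qed.

Definition ew c z : R := expR (c * z.1).

Lemma is_derive_ew c z v : is_derive z v (ew c) (c * v.1 * ew c z).
Proof.
have D : is_derive (z.1) 1 (fun x : R => expR (c * x)) (c * expR (c * z.1)).
  have D1 : is_derive z.1 (1 : R) (fun x : R => c * x) c.
    by apply: is_derive_eq; rewrite /GRing.scale/=; ring.
  by have := is_derive1_comp (is_derive_expR (c * z.1)) D1; rewrite mulrC.
have := is_derive_scalar_comp D (is_derive_fst z v).
by rewrite mulrAC.
Qed.

Lemma ew_gt0 c z : 0 < ew c z.
Proof. exact: expR_gt0. Qed.

Lemma ewD c d z : ew (c + d) z = ew c z * ew d z.
Proof. by rewrite /ew mulrDl expRD. Qed.

Lemma continuous_ew c : continuous (ew c).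
Proof.
move=> z; apply: (continuous_comp (f := fun z => c * z.1) (g := expR)).
  by apply: cvgM; [exact: cvg_cst|exact: cvg_fst].
exact: continuous_expR.
Qed.

Lemma smooth_ew c : smooth (ew c).
Proof.
elim=> [|k IH]; first by split => //; exact: continuous_ew.
have d1 z : is_derive z ex (ew c) (c * ew c z).
  by have := is_derive_ew c z ex; rewrite mulr1.
have d2 z : is_derive z ey (ew c) 0.
  by have := is_derive_ew c z ey; rewrite mulr0 mul0r.
exact: (CkS_intro (continuous_ew (c := c)) d1 d2 (CkZ c IH) (Ck_cst k 0)).
Qed.

(* A bounded smooth truncation of [ew c], increasing to it as [e] tends to 0. *)
Definition lg c e z : R := (e + ew (- c) z)^-1.

Section logistic.
Context (c e : R) (e0 : 0 < e).

Let d_gt0 z : 0 < e + ew (- c) z.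
Proof. by rewrite addr_gt0// ew_gt0. Qed.

Lemma lg_gt0 z : 0 < lg c e z.
Proof. by rewrite invr_gt0. Qed.

Lemma lg_le z : lg c e z <= e^-1.
Proof. by rewrite /lg lef_pV2 ?posrE// lerDl ltW// ew_gt0. Qed.

Lemma lg_le_ew z : lg c e z <= ew c z.
Proof.
rewrite /lg -[ew c z]invrK lef_pV2 ?posrE ?invr_gt0 ?ew_gt0//.
by rewrite /ew -expRN mulNr lerDr ltW.
Qed.

(** The logistic equation: every derivative of [lg] is a polynomial in [lg], hence bounded. *)
Lemma is_derive_lg z v : is_derive z v (lg c e)
  (c * v.1 * (lg c e z - e * lg c e z ^+ 2)).
Proof.
have D : is_derive (e + ew (- c) z) 1 (fun x : R => x^-1) (- (e + ew (- c) z) ^- 2).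
  have := @is_deriveV R id (e + ew (- c) z) 1 1 _ (is_derive_id _ _).
  by rewrite /GRing.scale /= mulr1; apply; rewrite gt_eqF.
have D1 : is_derive z v (fun z => e + ew (- c) z) (- c * v.1 * ew (- c) z).
  have D0 : is_derive z v ((fun=> e) : R * R -> R) 0 by exact: is_derive_cst.
  by have := is_deriveD D0 (is_derive_ew (- c) z v); rewrite add0r.
have := is_derive_scalar_comp D D1; congr is_derive.
rewrite /lg; have := d_gt0 z; move: (ew (- c) z) => E E0.
by field; rewrite gt_eqF.
Qed.

Lemma smooth_lg : smooth (lg c e).
Proof.
have cont : continuous (lg c e).
  move=> z; apply: cvgV; first by rewrite gt_eqF.
  by apply: cvgD; [exact: cvg_cst|exact: continuous_ew].
elim=> [|k IH]; first by split.
have d1 z : is_derive z ex (lg c e) (c * (lg c e z + (- e) * (lg c e z * lg c e z))).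
  by have := is_derive_lg z ex; rewrite mulr1 mulNr expr2.
have d2 z : is_derive z ey (lg c e) 0.
  by have := is_derive_lg z ey; rewrite mulr0 mul0r.
exact: (CkS_intro cont d1 d2 (CkZ c (CkD IH (CkZ (- e) (CkM IH IH)))) (Ck_cst k 0)).
Qed.

Lemma lg_frac z : 0 < e * lg c e z < 1.
Proof.
rewrite mulr_gt0 ?lg_gt0//= /lg ltr_pdivrMr// mul1r ltrDl.
exact: ew_gt0.
Qed.

End logistic.

Lemma lg_cvg c z : lg c (n.+1%:R^-1) z @[n --> \oo] --> ew c z.
Proof.
have -> : ew c z = (0 + ew (- c) z)^-1 by rewrite add0r /ew -expRN mulNr opprK.
apply: cvgV; first by rewrite add0r gt_eqF// ew_gt0.
by apply: cvgD; [exact: cvg_harmonic|exact: cvg_cst].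
Qed.

End weights.

(** * Continuity and differentiation in time *)

Section time_derivative.
Context {R : realType}.
Local Notation T2 := (measurableTypeR R * measurableTypeR R)%type.
Implicit Types (f g h m : R * R -> R) (z : R * R) (s t : R) (u G H : R -> R * R -> R) (k : R -> R).

(** Spelled out with both times in [[0, 1]], so that values of [k] outside this interval never
    enter. *)
Definition cont01 k : Prop := forall s (e : R), s \in `[0, 1] -> 0 < e ->
  exists2 d : R, 0 < d & forall t, t \in `[0, 1] -> `|t - s| <= d -> `|k t - k s| <= e.

Definition L2cont G : Prop := (forall t, t \in `[0, 1] -> inL2 (G t)) /\
  forall s (e : R), s \in `[0, 1] -> 0 < e ->
  exists2 d : R, 0 < d & forall t, t \in `[0, 1] -> `|t - s| <= d ->
    nrm (fun z => G t z - G s z) <= e.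

Lemma L2cont_C0L2 u : C0L2 u -> L2cont u.
Proof.
move=> [u2 Hu]; split => // s e sI e0.
have [d d0 Hd] := norm_continuous01_lt Hu sI e0; exists d => // t tI td.
have := Hd t tI td; rewrite L2norm_sqrt; last exact: inL2B (u2 t tI) (u2 s sI).
by rewrite lte_fin => /ltW.
Qed.

Lemma L2cont_nrm_le G H (C : R) : 0 <= C -> L2cont G -> (forall t, t \in `[0, 1] -> inL2 (H t)) ->
  (forall s t, s \in `[0, 1] -> t \in `[0, 1] ->
    nrm (fun z => H t z - H s z) <= C * nrm (fun z => G t z - G s z)) -> L2cont H.
Proof.
move=> C0 [G2 HG] H2 GH; split => // s e sI e0.
have C1 : 0 < C + 1 by rewrite ltr_wpDl.
have [|d d0 Hd] := HG s (e / (C + 1)) sI; first by rewrite divr_gt0.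
exists d => // t tI td; apply: (le_trans (GH s t sI tI)).
apply: (@le_trans _ _ ((C + 1) * (e / (C + 1)))); last by rewrite mulrC divfK// gt_eqF.
by apply: ler_pM; rewrite ?nrm_ge0 ?lerDl//; exact: Hd.
Qed.

Lemma L2contD G H : L2cont G -> L2cont H -> L2cont (fun t z => G t z + H t z).
Proof.
move=> [G2 HG] [H2 HH]; split; first by move=> t tI; exact: inL2D (G2 t tI) (H2 t tI).
move=> s e sI e0; have e2 : 0 < e / 2 by rewrite divr_gt0.
have [d d0 Hd] := HG s _ sI e2; have [c c0 Hc] := HH s _ sI e2.
exists (Num.min d c); first by rewrite lt_min d0.
move=> t tI; rewrite le_min => /andP[td tc].
have := nrmD (inL2B (G2 t tI) (G2 s sI)) (inL2B (H2 t tI) (H2 s sI)).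
rewrite [X in nrm X <= _ -> _](_ : _ = fun z => G t z + H t z - (G s z + H s z)).
  by move/le_trans; apply; rewrite [e]splitr; apply: lerD; [exact: Hd|exact: Hc].
by apply/funext => z; rewrite opprD addrACA.
Qed.

Lemma L2contZ (c : R) G : L2cont G -> L2cont (fun t z => c * G t z).
Proof.
move=> HG; have [G2 _] := HG; apply: (L2cont_nrm_le (normr_ge0 c) HG).
  by move=> t tI; exact: inL2Z (G2 t tI).
move=> s t sI tI; rewrite -nrmZ; last exact: inL2B (G2 t tI) (G2 s sI).
by under eq_fun do rewrite -mulrBr.
Qed.

Lemma inL2_bdM f m (C : R) : measurable_fun [set: T2] m -> (forall z, `|m z| <= C) ->
  inL2 f -> inL2 (fun z => m z * f z).
Proof.
move=> mm mC f2; apply: (@inL2_le _ _ (fun z => C * f z)); last 2 first.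
- exact: inL2Z.
- move=> z; rewrite !normrM ler_wpM2r// (le_trans (mC z))// ler_norm//.
by apply: measurable_funM => //; exact: inL2_measurable.
Qed.

Lemma nrm_bdM f m (C : R) : measurable_fun [set: T2] m -> (forall z, `|m z| <= C) ->
  inL2 f -> nrm (fun z => m z * f z) <= C * nrm f.
Proof.
move=> mm mC f2; have C0 : 0 <= C := le_trans (normr_ge0 _) (mC 0).
have mf2 := inL2_bdM mm mC f2.
apply: nrm_le; first by rewrite mulr_ge0 ?nrm_ge0.
rewrite exprMn sqr_nrm -int2Z; last exact: inL2_sqr.
apply: int2_le; [exact: inL2_sqr|by apply: integrable2Z; exact: inL2_sqr|].
move=> z; rewrite exprMn ler_wpM2r ?sqr_ge0// -(real_normK (num_real (m z))).
by rewrite lerXn2r ?nnegrE.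
Qed.

Lemma L2cont_bdM G m (C : R) : measurable_fun [set: T2] m -> (forall z, `|m z| <= C) ->
  L2cont G -> L2cont (fun t z => m z * G t z).
Proof.
move=> mm mC HG; have [G2 _] := HG; have C0 : 0 <= C := le_trans (normr_ge0 _) (mC 0).
apply: (L2cont_nrm_le C0 HG); first by move=> t tI; exact: (inL2_bdM mm mC (G2 t tI)).
move=> s t sI tI; apply: le_trans (nrm_bdM mm mC (inL2B (G2 t tI) (G2 s sI))).
by under eq_fun do rewrite -mulrBr.
Qed.

Lemma L2cont_bounded G : L2cont G -> exists2 C : R, 0 <= C &
  forall t, t \in `[0, 1] -> nrm (G t) <= C.
Proof.
move=> [G2 HG]; have [C HC] : exists C : R, forall t, t \in `[0, 1] -> nrm (G t) <= C.
  apply: (@continuous01_bounded _ (fun t => nrm (G t))) => s e sI e0.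
  have [d d0 Hd] := HG s e sI e0; exists d => // t tI td.
  by apply: le_trans (Hd t tI td); apply: nrm_dist; [exact: (G2 t)|exact: (G2 s)].
by exists `|C| => // t tI; rewrite (le_trans (HC t tI))// ler_norm.
Qed.

Lemma cont01_pairing G H : L2cont G -> L2cont H ->
  cont01 (fun t => \int[leb2]_z (G t z * H t z)).
Proof.
move=> cG cH; have [C C0 HC] := L2cont_bounded cG; have [K K0 HK] := L2cont_bounded cH.
have [G2 HG] := cG; have [H2 HH] := cH.
move=> s e sI e0; have S0 : 0 < C + K + 1 by rewrite ltr_wpDl// addr_ge0.
have e2 : 0 < e / (C + K + 1) by rewrite divr_gt0.
have [d d0 Hd] := HG s _ sI e2; have [c c0 Hc] := HH s _ sI e2.
exists (Num.min d c); first by rewrite lt_min d0.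
move=> t tI; rewrite le_min => /andP[td tc].
have Gt := G2 t tI; have Gs := G2 s sI; have Ht := H2 t tI; have Hs := H2 s sI.
rewrite -(int2B (integrable2M Gt Ht) (integrable2M Gs Hs)).
have -> : (fun z => G t z * H t z - G s z * H s z) = (fun z =>
    (G t z - G s z) * H t z + G s z * (H t z - H s z)).
  by apply/funext => z; ring.
rewrite int2D; [|exact: integrable2M (inL2B Gt Gs) Ht|exact: integrable2M Gs (inL2B Ht Hs)].
apply: (le_trans (ler_normD _ _)).
apply: (@le_trans _ _ (e / (C + K + 1) * K + C * (e / (C + K + 1)))).
  apply: lerD.
    apply: (le_trans (nrm_CS (inL2B Gt Gs) Ht)).
    by apply: ler_pM; rewrite ?nrm_ge0//; [exact: Hd|exact: HK].
  apply: (le_trans (nrm_CS Gs (inL2B Ht Hs))).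
  by apply: ler_pM; rewrite ?nrm_ge0//; [exact: HC|exact: Hc].
rewrite mulrC -mulrDl [K + C]addrC mulrA ler_pdivrMr// mulrC ler_pM2l//.
by rewrite lerDl.
Qed.

(* The derivative falls twice on [u]: by symmetry of [G], the increment of the
   pairing is [<G t + G s, u t - u s>]. *)
Lemma symmetric_pairing_is_derive u G t : C1L2 u -> L2cont G ->
  (forall s r, s \in `[0, 1] -> r \in `[0, 1] ->
    \int[leb2]_z (G s z * u r z) = \int[leb2]_z (G r z * u s z)) ->
  0 < t < 1 ->
  is_derive t 1 (fun s => \int[leb2]_z (G s z * u s z))
    (2 * \int[leb2]_z (G t z * dt u t z)).
Proof.
move=> Hu cG sym /andP[t0 t1].
have tI : t \in `[0, 1] by rewrite in_itv/= !ltW.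
have [[u2 _] _ [v2 _]] := Hu; have [G2 HG] := cG.
have [C C0 HC] := L2cont_bounded cG.
have ut := u2 t tI; have vt := v2 t tI; have Gt := G2 t tI.
apply: is_derive_increment => e e0.
(* The errors are the increment of [G] against [dt u t] and the remainder [r] against [G (t + h)]
   and against [G t]. *)
pose N := nrm (dt u t) + 2 * C + 1.
have N0 : 0 < N by rewrite ltr_wpDl// addr_ge0 ?nrm_ge0// mulr_ge0.
pose e1 := Num.min 1 (e / N); have e10 : 0 < e1 by rewrite lt_min ltr01 divr_gt0.
have [d d0 Hd] := HG t e1 tI e10.
have [c c0 Hc] := dt_increment Hu tI e10.
exists (Num.min (Num.min d c) (Num.min t (1 - t))).
  by rewrite !lt_min d0 c0 t0 subr_gt0.
move=> h; rewrite !le_min => /andP[/andP[hd hc] /andP[ht h1]].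
have thI : t + h \in `[0, 1].
  rewrite in_itv/=; move: ht h1; rewrite !ler_norml => /andP[A _] /andP[_ B].
  by apply/andP; split; lra.
have {}Hd : nrm (fun z => G (t + h) z - G t z) <= e1.
  by apply: Hd => //; rewrite addrC addrA addNr add0r.
have {}Hc := Hc h hc thI.
have uth := u2 _ thI; have Gth := G2 _ thI.
pose r z := u (t + h) z - u t z - h * dt u t z.
have r2 : inL2 r by apply: inL2B; [exact: inL2B|exact: inL2Z].
have D2 : inL2 (fun z => G (t + h) z - G t z) by exact: inL2B.
have E1 : \int[leb2]_z (G (t + h) z * u (t + h) z) = \int[leb2]_z (G (t + h) z * u t z)
    + h * \int[leb2]_z (G (t + h) z * dt u t z) + \int[leb2]_z (G (t + h) z * r z).
  have i1 := integrable2M Gth ut; have i2 := integrable2M Gth vt.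
  have i3 := integrable2M Gth r2.
  rewrite -int2Z// -int2D//; last exact: integrable2Z.
  rewrite -int2D//; last by apply: integrable2D => //; exact: integrable2Z.
  by congr (Rintegral _ _ _); apply/funext => z; rewrite /r; ring.
have E2 : \int[leb2]_z (G t z * u (t + h) z) = \int[leb2]_z (G t z * u t z)
    + h * \int[leb2]_z (G t z * dt u t z) + \int[leb2]_z (G t z * r z).
  have i1 := integrable2M Gt ut; have i2 := integrable2M Gt vt.
  have i3 := integrable2M Gt r2.
  rewrite -int2Z// -int2D//; last exact: integrable2Z.
  rewrite -int2D//; last by apply: integrable2D => //; exact: integrable2Z.
  by congr (Rintegral _ _ _); apply/funext => z; rewrite /r; ring.
have E3 : \int[leb2]_z (G (t + h) z * dt u t z) = \int[leb2]_z (G t z * dt u t z) +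
    \int[leb2]_z ((G (t + h) z - G t z) * dt u t z).
  have i1 := integrable2M Gt vt; have i2 := integrable2M D2 vt.
  rewrite -int2D//.
  by congr (Rintegral _ _ _); apply/funext => z; ring.
have N1 := nrm_CS D2 vt; have N2 := nrm_CS Gth r2; have N3 := nrm_CS Gt r2.
rewrite E1 (sym _ _ thI tI) E2 E3; move: N1 N2 N3.
move: (Rintegral _ _ _) (Rintegral _ _ _) (Rintegral _ _ _) (Rintegral _ _ _) (Rintegral _ _ _).
move=> Y X Y3 Y4 Y5 N1 N2 N3.
have {}N1 : `|Y5| <= e1 * nrm (dt u t).
  by apply: (le_trans N1); rewrite ler_wpM2r ?nrm_ge0.
have {}N2 : `|Y4| <= C * (`|h| * e1).
  by apply: (le_trans N2); apply: ler_pM; rewrite ?nrm_ge0//; exact: HC.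
have {}N3 : `|Y3| <= C * (`|h| * e1).
  by apply: (le_trans N3); apply: ler_pM; rewrite ?nrm_ge0//; exact: HC.
rewrite (_ : _ - _ = h * Y5 + Y3 + Y4); last by ring.
apply: (le_trans (ler_normD _ _)); apply: (@le_trans _ _
   (`|h| * (e1 * nrm (dt u t)) + C * (`|h| * e1) + C * (`|h| * e1))).
  apply: lerD => //; apply: (le_trans (ler_normD _ _)); apply: lerD => //.
  by rewrite normrM ler_wpM2l.
have -> : `|h| * (e1 * nrm (dt u t)) + C * (`|h| * e1) + C * (`|h| * e1) =
  `|h| * (e1 * (nrm (dt u t) + 2 * C)) by ring.
rewrite ler_wpM2l//; apply: (@le_trans _ _ (e1 * N)).
  by rewrite ler_wpM2l ?(ltW e10)// /N lerDl.
by rewrite -ler_pdivlMr// ge_min lexx orbT.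
Qed.

(** With an integrating factor, the mean value theorem takes the place of Gronwall's inequality and
    of integration in time; the derivative of [k] is required only at interior times. *)
Lemma cont01_exp_MVT k dk (th dth : R -> R) (x y : R) :
  cont01 k -> 0 <= x -> x < y -> y <= 1 ->
  (forall t, 0 < t < 1 -> is_derive t 1 k (dk t)) ->
  (forall t : R, is_derive t 1 th (dth t)) ->
  exists2 c, x < c < y & expR (th y) * k y - expR (th x) * k x =
    expR (th c) * (dth c * k c + dk c) * (y - x).
Proof.
move=> ck x0 xy y1 dk' dth'.
have sub t : x <= t <= y -> t \in `[0, 1].
  by move=> /andP[a b]; rewrite in_itv/= (le_trans x0 a) (le_trans b y1).
have D t : 0 < t < 1 -> is_derive t 1 (fun s => expR (th s) * k s)
    (expR (th t) * (dth t * k t + dk t)).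
  move=> tI; have D1 : is_derive t 1 (fun s => expR (th s)) (dth t * expR (th t)).
    by have := is_derive1_comp (is_derive_expR (th t)) (dth' t); rewrite mulrC.
  apply: (is_derive_eq (is_deriveM D1 (dk' t tI))).
  by rewrite /GRing.scale/=; ring.
have ce t : {for t, continuous (fun s => expR (th s))}.
  apply: (continuous_comp (f := th)); last exact: continuous_expR.
  by apply/differentiable_continuous/derivable1_diffP; case: (dth' t).
have cw : {within `[x, y], continuous (fun s => expR (th s) * k s)}.
  apply/subspace_continuousP => s /= sI; apply: cvgM.
    by apply: cvg_trans (ce s); apply: cvg_app; exact: cvg_within.
  apply/cvgrPdist_le => e e0.
  have [d d0 Hd] := ck s e (sub s sI) e0.
  rewrite near_withinE; apply/nbhs_ballP; exists d => //= t.
  rewrite /ball /= => std tI; rewrite distrC; apply: Hd; first exact: sub.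
  by rewrite distrC ltW.
have D' t : t \in `]x, y[ -> is_derive t 1 (fun s => expR (th s) * k s)
    (expR (th t) * (dth t * k t + dk t)).
  rewrite in_itv/= => /andP[a b]; apply: D.
  by rewrite (le_lt_trans x0 a) (lt_le_trans b y1).
by have [c cI ->] := MVT xy D' cw; exists c.
Qed.

End time_derivative.

(** * Logistic weights and weighted interpolation *)

Section weighted_slices.
Context {R : realType}.
Local Notation T2 := (measurableTypeR R * measurableTypeR R)%type.
Implicit Types (f g m : R * R -> R) (z v : R * R) (c e : R).

Lemma measurable_smooth m : smooth m -> measurable_fun [set: T2] m.
Proof. by move=> /(_ 0%N) [cm _]; exact: continuous_measurable2. Qed.

Lemma wderMb v m m' f f' (C C' : R) : axis v -> smooth m -> smooth m' ->
  (forall z, is_derive z v m (m' z)) ->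
  (forall z, `|m z| <= C) -> (forall z, `|m' z| <= C') -> wder v f f' ->
  wder v (fun z => m z * f z) (fun z => m' z * f z + m z * f' z).
Proof.
move=> av sm sm' D mC mC' W; have [f2 f'2 _] := W.
apply: wderM => //; first exact: inL2_bdM (measurable_smooth sm) mC f2.
apply: inL2D; first exact: inL2_bdM (measurable_smooth sm') mC' f2.
exact: inL2_bdM (measurable_smooth sm) mC f'2.
Qed.

Lemma integrable2_bdM f m (C : R) : measurable_fun [set: T2] m ->
  (forall z, `|m z| <= C) -> integrable2 f -> integrable2 (fun z => m z * f z).
Proof.
move=> mm mC fi; apply: (@integrable2_le _ _ (fun z => C * f z)).
- by apply: measurable_funM => //; case/integrableP : fi => /measurable_EFinP.
- exact: integrable2Z.
- by move=> z; rewrite !normrM ler_wpM2r// (le_trans (mC z))// ler_norm.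
Qed.

Section logistic_weight.
Context (c e : R) (e0 : 0 < e).
Let m : R * R -> R := lg c e.
(** The first three [x]-derivatives of [m], obtained by differentiating the logistic equation
    [m' = c (m - e m^2)]. *)
Definition lg1 z := c * (m z - e * m z ^+ 2).
Definition lg2 z := c * (lg1 z - 2 * e * (m z * lg1 z)).
Definition lg3 z := c * (lg2 z - 2 * e * (lg1 z ^+ 2 + m z * lg2 z)).

Let m0 z : 0 < m z. Proof. exact: lg_gt0. Qed.
Let me z : 0 < e * m z < 1. Proof. exact: lg_frac. Qed.

Lemma lg1_le z : `|lg1 z| <= `|c| * m z.
Proof.
rewrite /lg1 normrM ler_wpM2l//; have := me z; have := m0 z; move: (m z) => a a0 /andP[ea0 ea1].
rewrite ler_norml expr2 mulrA; apply/andP; split; nra.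
Qed.

Lemma lg1_ge0 z : 0 <= c -> 0 <= lg1 z.
Proof.
move=> c0; rewrite /lg1 mulr_ge0//; have := me z; have := m0 z.
by move: (m z) => a a0 /andP[ea0 ea1]; nra.
Qed.

Lemma lg1_le0 z : c <= 0 -> lg1 z <= 0.
Proof.
move=> c0; rewrite /lg1 mulr_le0_ge0//; have := me z; have := m0 z.
by move: (m z) => a a0 /andP[ea0 ea1]; nra.
Qed.

Lemma lg3_le z : `|lg3 z| <= `|c| ^+ 3 * m z.
Proof.
(* For [y = e m] in (0, 1), the factor [(1 - y) (1 - 6 y + 6 y^2)] has absolute value at most 1; the
   bound is thus uniform in [e]. *)
have -> : lg3 z = c ^+ 3 * (m z * ((1 - e * m z) * (1 - 6 * (e * m z) + 6 * (e * m z) ^+ 2))).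
  by rewrite /lg3 /lg2 /lg1; move: (m z) => a; ring.
rewrite normrM normrX ler_wpM2l ?exprn_ge0// normrM gtr0_norm// ger_pMr//.
move: (e * m z) (me z) => y /andP[y0 y1].
by rewrite normrM mulr_ile1//; rewrite ler_norml; apply/andP; split; nra.
Qed.

Lemma lg2_le z : `|lg2 z| <= `|c| ^+ 2 * m z.
Proof.
have -> : lg2 z = c ^+ 2 * (m z * ((1 - e * m z) * (1 - 2 * (e * m z)))).
  by rewrite /lg2 /lg1; move: (m z) => a; ring.
rewrite normrM normrX ler_wpM2l ?exprn_ge0// normrM gtr0_norm// ger_pMr//.
move: (e * m z) (me z) => y /andP[y0 y1].
by rewrite normrM mulr_ile1//; rewrite ler_norml; apply/andP; split; nra.
Qed.

Let sm : smooth m. Proof. exact: smooth_lg. Qed.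

Lemma smooth_comb (a b : R) f g : smooth f -> smooth g -> smooth (fun z => a * (f z + b * g z)).
Proof. by move=> sf sg k; exact: (CkZ a (CkD (sf k) (CkZ b (sg k)))). Qed.

Lemma smooth_lg1 : smooth lg1.
Proof.
have -> : lg1 = fun z => c * (m z + - e * (m z * m z)).
  by apply/funext => z; rewrite /lg1; ring.
by apply: smooth_comb => //; exact: smoothM.
Qed.

Lemma smooth_lg2 : smooth lg2.
Proof.
have -> : lg2 = fun z => c * (lg1 z + - (2 * e) * (m z * lg1 z)).
  by apply/funext => z; rewrite /lg2; ring.
apply: smooth_comb; first exact: smooth_lg1.
by apply: smoothM => //; exact: smooth_lg1.
Qed.

Lemma smooth_lg3 : smooth lg3.
Proof.
have -> : lg3 = fun z => c * (lg2 z + - (2 * e) * (1 * (lg1 z * lg1 z + 1 * (m z * lg2 z)))).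
  by apply/funext => z; rewrite /lg3; ring.
apply: smooth_comb; first exact: smooth_lg2.
apply: smooth_comb; first by apply: smoothM; exact: smooth_lg1.
by apply: smoothM => //; exact: smooth_lg2.
Qed.

Let dm z : is_derive z ex m (lg1 z).
Proof. by have := is_derive_lg c e0 z ex; rewrite mulr1. Qed.

Let dlg1 z : is_derive z ex lg1 (lg2 z).
Proof.
have -> : lg1 = (fun z => c * (m z + - e * (m z * m z))).
  by apply/funext => y; rewrite /lg1; ring.
have D := is_deriveM (dm z) (dm z).
have D1 := is_deriveD (dm z) (is_deriveZ (- e) D).
apply: (is_derive_eq (is_deriveZ c D1)).
by rewrite /GRing.scale/= /lg2; ring.
Qed.

Let dlg2 z : is_derive z ex lg2 (lg3 z).
Proof.
have -> : lg2 = (fun z => c * (lg1 z + - (2 * e) * (m z * lg1 z))).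
  by apply/funext => y; rewrite /lg2; ring.
have D := is_deriveM (dm z) (dlg1 z).
have D1 := is_deriveD (dlg1 z) (is_deriveZ (- (2 * e)) D).
apply: (is_derive_eq (is_deriveZ c D1)).
by rewrite /GRing.scale/= /lg3; ring.
Qed.

Let dmy z : is_derive z ey m 0.
Proof. by have := is_derive_lg c e0 z ey; rewrite mulr0 mul0r. Qed.

Lemma lg_abs_le z : `|m z| <= e^-1.
Proof. by rewrite gtr0_norm//; exact: lg_le. Qed.


Lemma lgk_bound (a : R) z (q : R) : 0 <= a -> q <= a * m z -> q <= a * e^-1.
Proof. by move=> a0 /le_trans; apply; rewrite ler_wpM2l//; exact: lg_le. Qed.

Let lg1_b z : `|lg1 z| <= `|c| * e^-1.
Proof. by apply: (lgk_bound (z := z)) => //; exact: lg1_le. Qed.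
Let lg2_b z : `|lg2 z| <= `|c| ^+ 2 * e^-1.
Proof. by apply: (lgk_bound (z := z)); [rewrite exprn_ge0|exact: lg2_le]. Qed.
Let lg3_b z : `|lg3 z| <= `|c| ^+ 3 * e^-1.
Proof. by apply: (lgk_bound (z := z)); [rewrite exprn_ge0|exact: lg3_le]. Qed.

Let wx0 f f' (W : wder ex f f') :
  wder ex (fun z => m z * f z) (fun z => lg1 z * f z + m z * f' z).
Proof. exact: (wderMb (or_introl erefl) sm smooth_lg1 dm lg_abs_le lg1_b W). Qed.

Let wx1 f f' (W : wder ex f f') :
  wder ex (fun z => lg1 z * f z) (fun z => lg2 z * f z + lg1 z * f' z).
Proof. exact: (wderMb (or_introl erefl) smooth_lg1 smooth_lg2 dlg1 lg1_b lg2_b W). Qed.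

Let wx2 f f' (W : wder ex f f') :
  wder ex (fun z => lg2 z * f z) (fun z => lg3 z * f z + lg2 z * f' z).
Proof. exact: (wderMb (or_introl erefl) smooth_lg2 smooth_lg3 dlg2 lg2_b lg3_b W). Qed.

Let wy0 f f' (W : wder ey f f') :
  wder ey (fun z => m z * f z) (fun z => m z * f' z).
Proof.
have s0 : smooth ((fun=> 0) : R * R -> R) by move=> k; exact: Ck_cst.
have b0 z : `|(fun=> 0 : R) z| <= 0 by rewrite normr0.
have := wderMb (or_intror erefl) sm s0 dmy lg_abs_le b0 W.
by move/wder_eq; apply => // z; rewrite mul0r add0r.
Qed.

(* Kato smoothing: the flux of the weighted mass has a sign, so no bound on [fx], [fy] is needed. *)
Lemma logistic_energy f fx fxx fxxx fy fxy fxyy :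
  wder ex f fx -> wder ex fx fxx -> wder ex fxx fxxx ->
  wder ey f fy -> wder ex fy fxy -> wder ey fxy fxyy ->
  null2 (fun z => 2 * (m z * f z * (fxxx z + fxyy z)) -
    (3 * (lg1 z * fx z ^+ 2) + lg1 z * fy z ^+ 2 - lg3 z * f z ^+ 2)).
Proof.
move=> W1 W2 W3 V1 V2 V3; have ax : axis (ex : R * R) by left.
have ay : axis (ey : R * R) by right.
have N1 := null2Z 2 (null2_parts ax (wx0 W1) W3).
have N2 := null2Z (- 2) (null2_parts ax (wx1 W1) W2).
have N3 := null2Z (- 1) (null2_parts ax (wx0 W2) W2).
have N4 := null2_parts ax (wx2 W1) W1.
have N5 := null2Z 2 (null2_parts ay (wy0 V1) V3).
have N6 := null2Z (- 1) (null2_parts ax (wx0 V2) V2).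
apply: (null2_eq (null2D (null2D (null2D N1 N2) (null2D N3 N4)) (null2D N5 N6))).
move=> z /=; move: (lg1 z) (lg2 z) (lg3 z) (m z) => m1 m2 m3 a.
move: (f z) (fx z) (fxx z) (fxxx z) (fy z) (fxy z) (fxyy z) => x0 x1 x2 x3 y1 y2 y3.
by ring.
Qed.

(** One derivative is moved from [f1] to [m f], then Young's inequality leaves the whole weight on
    [f]. As [m] approximates [ew c], the weight [ew c] on [f] buys only [ew (c / 2)] on [f1]. *)
Lemma logistic_interpolation v f f1 f2 : axis v -> wder v f f1 -> wder v f1 f2 ->
  inL2 (fun z => ew c z * f z) ->
  \int[leb2]_z (m z * f1 z ^+ 2) <=
    (1 + c ^+ 2) * \int[leb2]_z (ew c z * f z) ^+ 2 +
    (\int[leb2]_z f2 z ^+ 2 + \int[leb2]_z f1 z ^+ 2).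
Proof.
move=> av W1 W2 E2; have [f2' f12 _] := W1; have [_ f22 _] := W2.
(* Derivative of the weight along [v]: it is [lg1] along [ex] and 0 along [ey]. *)
pose l z := v.1 * lg1 z.
have v1 : `|v.1| <= 1 by case: av => -> /=; rewrite ?normr1// normr0.
have dl z : is_derive z v m (l z).
  by have := is_derive_lg c e0 z v; rewrite /l /lg1 -/m mulrA [v.1 * c]mulrC.
have sl : smooth l by move=> k; apply: CkZ; exact: smooth_lg1.
have lb z : `|l z| <= `|c| * m z.
  by rewrite normrM -[leRHS]mul1r; apply: ler_pM => //; exact: lg1_le.
have lbb z : `|l z| <= `|c| * e^-1 by apply: (lgk_bound (z := z)).
have [Ni N0] := null2_parts av (wderMb av sm sl dl lg_abs_le lbb W1) W2.
have im1 : integrable2 (fun z => m z * f1 z ^+ 2).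
  by apply: integrable2_bdM (inL2_sqr f12); [exact: measurable_smooth|exact: lg_abs_le].
have iE := integrable2Z (1 + c ^+ 2) (inL2_sqr E2).
have iR : integrable2 (fun z => (1 + c ^+ 2) * (ew c z * f z) ^+ 2 +
    (f2 z ^+ 2 + f1 z ^+ 2)).
  by apply: integrable2D => //; apply: integrable2D; exact: inL2_sqr.
rewrite -int2Z; last exact: inL2_sqr.
rewrite -(int2D (inL2_sqr f22) (inL2_sqr f12)) -int2D//; last first.
  by apply: integrable2D; exact: inL2_sqr.
rewrite -[leLHS]subr0 -N0 -int2B//.
apply: int2_le => //; first exact: integrable2B.
move=> z; have := lb z; have := lg_le_ew c e0 z; rewrite -/(m z); have := m0 z.
have := ew_gt0 c z; move: (m z) (ew c z) (l z) (f z) (f1 z) (f2 z) => a E p x y w.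
move=> E0 a0 aE pa.
have pE : `|p| <= `|c| * E by rewrite (le_trans pa)// ler_wpM2l.
have h1 : - (a * x * w) <= 2^-1 * (E * x) ^+ 2 + 2^-1 * w ^+ 2.
  have : (a * x) ^+ 2 <= (E * x) ^+ 2.
    by rewrite !exprMn ler_wpM2r ?sqr_ge0// lerXn2r ?nnegrE// ltW.
  have := sqr_ge0 (a * x + w); rewrite sqrrD; move: ((E * x) ^+ 2) => q.
  by rewrite -mulr_natl; lra.
have h2 : - (p * x * y) <= 2^-1 * (c ^+ 2 * (E * x) ^+ 2) + 2^-1 * y ^+ 2.
  have : (p * x) ^+ 2 <= c ^+ 2 * (E * x) ^+ 2.
    rewrite -[c ^+ 2]real_normK ?num_real// -exprMn mulrA.
    rewrite -[leLHS]real_normK ?num_real// -[leRHS]real_normK ?num_real//.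
    rewrite lerXn2r ?nnegrE// !normrM normr_id (gtr0_norm E0).
    by rewrite ler_wpM2r.
  have := sqr_ge0 (p * x + y); rewrite sqrrD; move: (c ^+ 2 * (E * x) ^+ 2) => q.
  by rewrite -mulr_natl; lra.
have q0 : 0 <= c ^+ 2 * (E * x) ^+ 2 by rewrite mulr_ge0 ?sqr_ge0.
have := sqr_ge0 (E * x); have := sqr_ge0 w; have := sqr_ge0 y.
rewrite (_ : a * y ^+ 2 - _ = - (p * x * y) + - (a * x * w)); last by ring.
move: h1 h2 q0; rewrite mulrDl mul1r.
move: ((E * x) ^+ 2) (c ^+ 2 * _) => q r; lra.
Qed.

End logistic_weight.

Lemma ew_sqr c z : ew c z ^+ 2 = ew (2 * c) z.
Proof. by rewrite expr2 -ewD mulr_natl mulr2n. Qed.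

Lemma measurable_ew c : measurable_fun [set: T2] (ew c).
Proof. exact: measurable_smooth (smooth_ew c). Qed.

(** Lets [e] tend to 0 by Fatou's lemma; the exponent is halved because [ew c] is the square of
    [ew (c / 2)]. *)
Lemma fatou_ew c f (C : R) : inL2 f ->
  (forall e, 0 < e -> \int[leb2]_z (lg c e z * f z ^+ 2) <= C) ->
  inL2 (fun z => ew (c / 2) z * f z) /\ \int[leb2]_z (ew (c / 2) z * f z) ^+ 2 <= C.
Proof.
move=> f2 H.
have E : (fun z => ew c z * f z ^+ 2) = (fun z => (ew (c / 2) z * f z) ^+ 2).
  by apply/funext => z; rewrite exprMn ew_sqr [2 * _]mulrC divfK.
have n0 (n : nat) : 0 < n.+1%:R^-1 :> R by rewrite invr_gt0.
have [|n z|n|z|I1 I2] := @fatou_int2 _ (fun n z => lg c n.+1%:R^-1 z * f z ^+ 2)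
   (fun z => ew c z * f z ^+ 2) C.
- move=> n; apply: integrable2_bdM (inL2_sqr f2).
    by apply: measurable_smooth; exact: smooth_lg.
  by move=> z; exact: lg_abs_le.
- by rewrite mulr_ge0 ?sqr_ge0// ltW// lg_gt0.
- exact: H.
- by apply: cvgM; [exact: lg_cvg|exact: cvg_cst].
split; last by rewrite -E.
apply: inL2P; last by rewrite -E.
by apply: measurable_funM; [exact: measurable_ew|exact: inL2_measurable].
Qed.

Lemma weighted_interpolation v c f f1 f2 : axis v -> wder v f f1 -> wder v f1 f2 ->
  inL2 (fun z => ew c z * f z) ->
  inL2 (fun z => ew (c / 2) z * f1 z) /\
  \int[leb2]_z (ew (c / 2) z * f1 z) ^+ 2 <=
    (1 + c ^+ 2) * \int[leb2]_z (ew c z * f z) ^+ 2 +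
    (\int[leb2]_z f2 z ^+ 2 + \int[leb2]_z f1 z ^+ 2).
Proof.
move=> av W1 W2 E2; have [_ f12 _] := W1; apply: fatou_ew => // e e0.
exact: logistic_interpolation W2 E2.
Qed.

End weighted_slices.

(** * Exponential decay of the solution and its derivatives *)

Section decay.
Context {R : realType}.
Local Notation T2 := (measurableTypeR R * measurableTypeR R)%type.
Implicit Types (m : R * R -> R) (f g h : R -> R * R -> R) (z v : R * R) (c e s t : R).
Context (u : R -> R * R -> R) (B M : R).
Hypothesis hH4 : C0H 4 u.
Hypothesis hC1 : C1L2 u.
Hypothesis hZK : ZK_solution u.
Hypothesis M0 : 0 <= M.
Hypothesis hM : forall t, t \in `[0, 1] -> {ae leb2, forall z, `|Du u 1 0 t z| <= M}.
Hypothesis supp0 : {ae leb2, forall z, ~ `|z.1| <= B -> u 0 z = 0}.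
Hypothesis supp1 : {ae leb2, forall z, ~ `|z.1| <= B -> u 1 z = 0}.

Let hL2 : C0L2 u. Proof. by case: hC1. Qed.

Lemma wder_Du_x i t : t \in `[0, 1] -> (i.+1 <= 4)%N ->
  wder ex (Du u i 0 t) (Du u i.+1 0 t).
Proof.
move=> tI i4; apply: (is_wderiv_wder_x (f := u t) (i := i)).
  by apply: (Du_is_wderiv hH4 tI); rewrite addn0 ltnW.
by apply: (Du_is_wderiv hH4 tI); rewrite addn0.
Qed.

Lemma wder_Du_y i j t : t \in `[0, 1] -> (i + j.+1 <= 4)%N ->
  wder ey (Du u i j t) (Du u i j.+1 t).
Proof.
move=> tI i4; apply: (is_wderiv_wder_y (f := u t)).
  by apply: (Du_is_wderiv hH4 tI); rewrite (leq_trans _ i4)// leq_add2l.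
exact: (Du_is_wderiv hH4 tI).
Qed.

Lemma wder_Du_xy i j t : t \in `[0, 1] -> (i.+1 + j <= 4)%N ->
  wder ex (Du u i j t) (Du u i.+1 j t).
Proof.
move=> tI; elim: j => [|j IH] ij; first by apply: wder_Du_x => //; rewrite -(addn0 i.+1).
have ij' : (i.+1 + j <= 4)%N by rewrite (leq_trans _ ij)// leq_add2l.
apply: (wder_comm (IH ij')); apply: wder_Du_y => //.
by rewrite (leq_trans _ ij)// leq_add2r.
Qed.

Let f2 t : t \in `[0, 1] -> inL2 (u t). Proof. by case: hL2 => H _; exact: H. Qed.

Section truncated_energy.
Context (c e : R) (e0 : 0 < e).
Let k t := \int[leb2]_z (lg c e z * u t z * u t z).
(** [|c|^3] controls the third derivative of the weight, and [2 M] the nonlinear term [2 m u^2 u_x],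
    both relative to [m u^2]. *)
Let A := `|c| ^+ 3 + 2 * M.
Let A0 : 0 <= A. Proof. by rewrite addr_ge0 ?mulr_ge0// exprn_ge0. Qed.

Let ml : measurable_fun [set: T2] (lg c e).
Proof. by apply: measurable_smooth; exact: smooth_lg. Qed.

Let lgb z : `|lg c e z| <= e^-1. Proof. exact: lg_abs_le. Qed.

Let contG : L2cont (fun t z => lg c e z * u t z).
Proof. by apply: (L2cont_bdM ml lgb); exact: L2cont_C0L2. Qed.

Let ck : cont01 k.
Proof. by apply: cont01_pairing contG _; exact: L2cont_C0L2. Qed.

Let dk t : 0 < t < 1 ->
  is_derive t 1 k (2 * \int[leb2]_z (lg c e z * u t z * dt u t z)).
Proof.
move=> tI; apply: (symmetric_pairing_is_derive hC1 contG) => // s r sI rI.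
by congr (Rintegral _ _ _); apply/funext => z; ring.
Qed.

(** The flux [lg1 (3 u_x^2 + u_y^2)] has the sign of [c] and is dropped, which leaves a bound from
    above for [c >= 0] and from below for [c <= 0]. *)
Let dk_le t : t \in `[0, 1] ->
  (0 <= c -> 2 * \int[leb2]_z (lg c e z * u t z * dt u t z) <= A * k t) /\
  (c <= 0 -> - (A * k t) <= 2 * \int[leb2]_z (lg c e z * u t z * dt u t z)).
Proof.
move=> tI.
have le4 n : (n < 4)%N -> (n.+1 <= 4)%N by [].
have := logistic_energy c e0 (wder_Du_x tI (le4 0 isT)) (wder_Du_x tI (le4 1 isT))
  (wder_Du_x tI (le4 2 isT)) (wder_Du_y (i := 0) (j := 0) tI (le4 0 isT))
  (wder_Du_xy (i := 0) (j := 1) tI (le4 1 isT)) (wder_Du_y (i := 1) (j := 1) tI (le4 2 isT)).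
rewrite -[Du u 0 0 t]/(u t) => -[Ni N0].
have mu2 := inL2_bdM ml lgb (f2 tI).
have vt : inL2 (dt u t) by case: hC1 => _ _ [H _]; exact: H.
have iv := integrable2M mu2 vt; have iu := integrable2M mu2 (f2 tI).
have iAu := integrable2Z A iu.
have i2v := integrable2Z 2 iv; have iNAu := integrable2N iAu.
have AE : {ae leb2, forall z, `|Du u 1 0 t z| <= M /\ dt u t z =
    - (Du u 3 0 t z + Du u 1 2 t z + Du u 1 0 t z * u t z)}.
  by apply: ae2_imp2 (hM tI) (ZK_ae hH4 hZK tI) => z; split.
have pw z : `|Du u 1 0 t z| <= M ->
    `|lg3 c e z * u t z ^+ 2 - 2 * (lg c e z * u t z ^+ 2 * Du u 1 0 t z)| <=
    A * (lg c e z * u t z * u t z).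
  move=> H; have K : 0 <= lg c e z * u t z ^+ 2 by rewrite mulr_ge0 ?sqr_ge0// ltW// lg_gt0.
  have -> : A * (lg c e z * u t z * u t z) = `|c| ^+ 3 * lg c e z * u t z ^+ 2 +
      2 * (lg c e z * u t z ^+ 2 * M) by rewrite /A; ring.
  apply: (le_trans (ler_normB _ _)); apply: lerD.
    by rewrite normrM [X in _ * X <= _]ger0_norm ?sqr_ge0// ler_wpM2r ?sqr_ge0// lg3_le.
  by rewrite normrM [`|2|]ger0_norm// ler_wpM2l// normrM ger0_norm// ler_wpM2l.
have E (D : R) z : D = - (Du u 3 0 t z + Du u 1 2 t z + Du u 1 0 t z * u t z) ->
    2 * (lg c e z * u t z * D) + (2 * (lg c e z * u t z *
      (Du u 3 0 t z + Du u 1 2 t z)) - (3 * (lg1 c e z * Du u 1 0 t z ^+ 2) +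
      lg1 c e z * Du u 0 1 t z ^+ 2 - lg3 c e z * u t z ^+ 2)) =
    (lg3 c e z * u t z ^+ 2 - 2 * (lg c e z * u t z ^+ 2 * Du u 1 0 t z)) -
    lg1 c e z * (3 * Du u 1 0 t z ^+ 2 + Du u 0 1 t z ^+ 2).
  move=> ->; move: (Du u 3 0 t z) (Du u 1 2 t z) (Du u 1 0 t z) (Du u 0 1 t z).
  move: (lg1 c e z) (lg3 c e z) (lg c e z) (u t z) => *; ring.
have S z : 0 <= 3 * Du u 1 0 t z ^+ 2 + Du u 0 1 t z ^+ 2.
  by apply: addr_ge0; [apply: mulr_ge0 => //; exact: sqr_ge0|exact: sqr_ge0].
split=> c0.
  rewrite -[X in X <= _]addr0 -N0 -!int2Z// -int2D//.
  apply: int2_ae_le => //; first exact: integrable2D.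
  apply: ae2_imp AE => z [Hx Hd]; rewrite (E _ z Hd).
  have := pw z Hx; rewrite ler_norml => /andP[_ P]; apply: le_trans P.
  rewrite gerBl; apply: mulr_ge0 (S z).
  exact: lg1_ge0.
rewrite -[X in _ <= X]addr0 -N0 -!int2Z// -int2N// -int2D//.
apply: int2_ae_le => //; first exact: integrable2D.
apply: ae2_imp AE => z [Hx Hd]; rewrite (E _ z Hd).
have := pw z Hx; rewrite ler_norml => /andP[P _]; apply: (le_trans P).
rewrite lerDl oppr_ge0; apply: mulr_le0_ge0 (S z).
exact: lg1_le0.
Qed.

(** Decay to the right is propagated forward from time 0, decay to the left backward from time 1;
    this is how both end times enter. *)
Lemma truncated_energy_bound t : t \in `[0, 1] ->
  (0 <= c -> k t <= expR A * k 0) /\ (c <= 0 -> k t <= expR A * k 1).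
Proof.
rewrite in_itv/= => /andP[t0 t1].
have k0 s : 0 <= k s.
  by apply: int2_ge0 => z; rewrite -mulrA -expr2 mulr_ge0 ?sqr_ge0// ltW// lg_gt0.
have eA : 1 <= expR A by rewrite -expR0 ler_expR.
have dth (a s : R) : is_derive s 1 (fun s => a * s) a.
  by apply: is_derive_eq; rewrite /GRing.scale/=; ring.
have I s : 0 < s < 1 -> s \in `[0, 1] by move=> /andP[a b]; rewrite in_itv/= !ltW.
split=> c0.
  move: t0; rewrite le_eqVlt => /predU1P[<-|t0]; first exact: ler_peMl.
  have [s /andP[s0 st]] := cont01_exp_MVT ck (lexx 0) t0 t1 dk (dth (- A)).
  have sI : 0 < s < 1 by rewrite s0 (lt_le_trans st).
  have [/(_ c0) + _] := dk_le (I s sI); move=> Hs E.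
  have : expR (- A * t) * k t - expR (- A * 0) * k 0 <= 0.
    rewrite E subr0 mulr_le0_ge0// ?(ltW t0)// mulr_ge0_le0 ?expR_ge0//.
    by rewrite mulNr addrC subr_le0.
  rewrite mulr0 expR0 mul1r subr_le0 mulNr expRN => H.
  apply: (@le_trans _ _ (expR (A * t) * k 0)).
    by rewrite -ler_pdivrMl ?expR_gt0.
  by rewrite ler_wpM2r// ler_expR ler_piMr.
move: t1; rewrite le_eqVlt => /predU1P[->|t1]; first exact: ler_peMl.
have [s /andP[ts s1]] := cont01_exp_MVT ck t0 t1 (lexx 1) dk (dth A).
have sI : 0 < s < 1 by rewrite s1 (le_lt_trans t0 ts).
have [_ /(_ c0) +] := dk_le (I s sI); move=> Hs E.
have : 0 <= expR (A * 1) * k 1 - expR (A * t) * k t.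
  rewrite E mulr_ge0// ?subr_ge0 ?(ltW t1)// mulr_ge0 ?expR_ge0//.
  by rewrite -lerBlDl sub0r.
rewrite mulr1 subr_ge0; apply: le_trans; rewrite ler_peMl//.
by rewrite -expR0 ler_expR mulr_ge0.
Qed.

End truncated_energy.

Definition weight_bounded (f : R -> R * R -> R) c : Prop := exists C : R,
  forall t, t \in `[0, 1] -> inL2 (fun z => ew c z * f t z) /\
    nrm (fun z => ew c z * f t z) <= C.

Lemma lg_box c e z : 0 < e -> `|z.1| <= B -> lg c e z <= expR (`|c| * B).
Proof.
move=> e0 zB; apply: (le_trans (lg_le_ew c e0 z)).
by rewrite /ew ler_expR (le_trans (ler_norm _))// normrM ler_wpM2l.
Qed.

(** At the end times the weight is bounded on the support uniformly in [e], so the truncation can be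
    removed. The exponent [2 c] appears because the mass carries the square of the weight. *)
Lemma weight_bounded_u c : weight_bounded u c.
Proof.
pose A := `|2 * c| ^+ 3 + 2 * M; pose D := expR (`|2 * c| * B).
pose N := \int[leb2]_z u 0 z ^+ 2 + \int[leb2]_z u 1 z ^+ 2.
have N0 t : 0 <= \int[leb2]_z u t z ^+ 2 by apply: int2_ge0 => z; exact: sqr_ge0.
have K e s : 0 < e -> s \in `[0, 1] ->
    {ae leb2, forall z, ~ `|z.1| <= B -> u s z = 0} ->
    \int[leb2]_z (lg (2 * c) e z * u s z * u s z) <= D * \int[leb2]_z u s z ^+ 2.
  move=> e0 sI H; rewrite -int2Z; last exact: inL2_sqr (f2 sI).
  have mu2 : inL2 (fun z => lg (2 * c) e z * u s z).
    apply: inL2_bdM (f2 sI); last exact: lg_abs_le.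
    by apply: measurable_smooth; exact: smooth_lg.
  apply: int2_ae_le.
  - exact: integrable2M mu2 (f2 sI).
  - by apply: integrable2Z; exact: inL2_sqr (f2 sI).
  - apply: ae2_imp H => z Hz; rewrite -mulrA -expr2.
    have [zB|/negP zB] := boolP (`|z.1| <= B).
      by rewrite ler_wpM2r ?sqr_ge0// lg_box.
    by rewrite (Hz zB) expr0n/= !mulr0.
have F e t : 0 < e -> t \in `[0, 1] ->
    \int[leb2]_z (lg (2 * c) e z * u t z ^+ 2) <= expR A * (D * N).
  move=> e0 tI; have [B1 B2] := truncated_energy_bound (2 * c) e0 tI.
  have -> : (fun z => lg (2 * c) e z * u t z ^+ 2) =
      (fun z => lg (2 * c) e z * u t z * u t z).
    by apply/funext => z; rewrite -mulrA expr2.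
  have I0 : (0 : R) \in `[0, 1] by rewrite in_itv/= lexx ler01.
  have I1 : (1 : R) \in `[0, 1] by rewrite in_itv/= lexx ler01.
  have [c0|c0] := leP 0 (2 * c).
    apply: (le_trans (B1 c0)); rewrite ler_wpM2l ?expR_ge0//.
    by apply: (le_trans (K _ _ e0 I0 supp0)); rewrite ler_wpM2l ?expR_ge0// lerDl.
  apply: (le_trans (B2 (ltW c0))); rewrite ler_wpM2l ?expR_ge0//.
  by apply: (le_trans (K _ _ e0 I1 supp1)); rewrite ler_wpM2l ?expR_ge0// lerDr.
exists (Num.sqrt (expR A * (D * N))) => t tI.
have [] := fatou_ew (f2 tI) (fun e => (F e t)^~ tI).
have -> : 2 * c / 2 = c by rewrite mulrC mulKf.
move=> L2 LC; split => //; apply: nrm_le; first exact: sqrtr_ge0.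
by rewrite sqr_sqrtr// mulr_ge0 ?expR_ge0// mulr_ge0 ?expR_ge0// addr_ge0.
Qed.

(** A derivative costs half of the exponent, which is harmless as the exponent is arbitrary. *)
Lemma weight_bounded_step v f g h c : axis v ->
  (forall t, t \in `[0, 1] -> wder v (f t) (g t) /\ wder v (g t) (h t)) ->
  (exists C : R, forall t, t \in `[0, 1] -> nrm (g t) <= C) ->
  (exists C : R, forall t, t \in `[0, 1] -> nrm (h t) <= C) ->
  weight_bounded f (2 * c) -> weight_bounded g c.
Proof.
move=> av W [Cg HCg] [Ch HCh] [C HC].
exists (Num.sqrt ((1 + (2 * c) ^+ 2) * C ^+ 2 + (Ch ^+ 2 + Cg ^+ 2))) => t tI.
have [W1 W2] := W t tI; have [F2 FC] := HC t tI.
have [] := weighted_interpolation av W1 W2 F2.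
have -> : 2 * c / 2 = c by rewrite mulrC mulKf.
move=> L2 LC; split => //; apply: nrm_le; first exact: sqrtr_ge0.
have sq (f' : R * R -> R) (C' : R) : nrm f' <= C' -> \int[leb2]_z f' z ^+ 2 <= C' ^+ 2.
  by move=> H; rewrite -sqr_nrm lerXn2r ?nnegrE ?nrm_ge0// (le_trans (nrm_ge0 f')).
rewrite sqr_sqrtr; last first.
  by apply: addr_ge0; [apply: mulr_ge0; rewrite ?addr_ge0 ?sqr_ge0|rewrite addr_ge0 ?sqr_ge0].
apply: (le_trans LC); apply: lerD; last by apply: lerD; apply: sq; [exact: HCh|exact: HCg].
by rewrite ler_wpM2l ?addr_ge0 ?sqr_ge0//; exact: sq.
Qed.

(** Interpolation for a derivative of order [n] uses one of order [n + 1] in L^2, so [H^4] gives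
    weighted bounds up to order three. *)
Lemma weight_bounded_Du i j c : (i + j <= 3)%N -> weight_bounded (fun t => Du u i j t) c.
Proof.
have bd a b : (a + b <= 4)%N -> exists C : R, forall t, t \in `[0, 1] -> nrm (Du u a b t) <= C.
  by move=> ab; exact: (Du_bounded hH4 hL2 ab).
elim: j c => [|j IH] c ij; last first.
  have ij4 : (i + j.+2 <= 4)%N by rewrite addnS.
  have ij3 : (i + j.+1 <= 4)%N by rewrite (leq_trans ij).
  apply: (@weight_bounded_step ey _ _ (fun t => Du u i j.+2 t)).
  - by right.
  - by move=> t tI; split; exact: wder_Du_y.
  - exact: bd.
  - exact: bd.
  - by apply: IH; rewrite (leq_trans _ ij)// leq_add2l.
elim: i c ij => [|i IH] c ij; first exact: weight_bounded_u.
have i3 : (i.+1 <= 3)%N by rewrite addn0 in ij.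
apply: (@weight_bounded_step ex _ _ (fun t => Du u i.+2 0 t)).
- by left.
- by move=> t tI; split; apply: wder_Du_x => //; rewrite ltnW.
- by apply: bd; rewrite addn0 ltnW.
- by apply: bd; rewrite addn0.
- by apply: IH; rewrite addn0 ltnW.
Qed.

End decay.

(** * The Carleman estimate *)

Section carleman.
Context {R : realType}.
Local Notation T2 := (measurableTypeR R * measurableTypeR R)%type.
Implicit Types (f g gx gxx gy gyy w wx wxx wy wyy : R * R -> R) (z v : R * R).
Context (P : R * R -> R) (a : R).

(* [P] stands for [a x + b], so that [d_x (P ^ k)] is [k a P ^ (k - 1)]; for [k = 0] the junk
   [P ^ k.-1] is multiplied by [0]. *)
Definition xder f f' : Prop := forall k,
  [/\ inL2 (fun z => P z ^+ k * f z), inL2 (fun z => P z ^+ k * f' z) &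
    wder ex (fun z => P z ^+ k * f z)
      (fun z => k%:R * a * P z ^+ k.-1 * f z + P z ^+ k * f' z)].

Definition yder f f' : Prop := forall k,
  [/\ inL2 (fun z => P z ^+ k * f z), inL2 (fun z => P z ^+ k * f' z) &
    wder ey (fun z => P z ^+ k * f z) (fun z => P z ^+ k * f' z)].

Lemma xder0 f f' : xder f f' -> wder ex f f'.
Proof.
move=> /(_ 0%N)[_ _]; move/wder_eq; apply => z; first by rewrite mul1r.
by rewrite !mul0r add0r mul1r.
Qed.

Lemma yder0 f f' : yder f f' -> wder ey f f'.
Proof. by move=> /(_ 0%N)[_ _]; move/wder_eq; apply => z; rewrite mul1r. Qed.

Lemma nullX k f f' g g' : xder f f' -> xder g g' ->
  null2 (fun z => (k%:R * a * P z ^+ k.-1 * f z + P z ^+ k * f' z) * g z +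
    P z ^+ k * f z * g' z).
Proof.
move=> /(_ k)[_ _ W] /xder0 W'.
by have := null2_parts (or_introl erefl) W W'.
Qed.

Lemma nullY k f f' g g' : yder f f' -> yder g g' ->
  null2 (fun z => P z ^+ k * f' z * g z + P z ^+ k * f z * g' z).
Proof.
move=> /(_ k)[_ _ W] /yder0 W'.
by have := null2_parts (or_intror erefl) W W'.
Qed.

Lemma xderD f f' g g' : xder f f' -> xder g g' ->
  xder (fun z => f z + g z) (fun z => f' z + g' z).
Proof.
move=> Hf Hg k; have [f2 f2' W] := Hf k; have [g2 g2' W'] := Hg k.
have E (p q : R * R -> R) : (fun z => P z ^+ k * p z + P z ^+ k * q z) =
    (fun z => P z ^+ k * (p z + q z)) by apply/funext => z; rewrite mulrDr.
split; first by rewrite -E; exact: inL2D.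
  by rewrite -E; exact: inL2D.
apply: (wder_eq (wderD (or_introl erefl) W W')) => z /=; first by rewrite mulrDr.
by rewrite addrACA -!mulrDr.
Qed.

Lemma xderZ (c : R) f f' : xder f f' -> xder (fun z => c * f z) (fun z => c * f' z).
Proof.
move=> Hf k; have [f2 f2' W] := Hf k.
have E (p : R * R -> R) : (fun z => c * (P z ^+ k * p z)) =
    (fun z => P z ^+ k * (c * p z)) by apply/funext => z; rewrite mulrCA.
split; first by rewrite -E; exact: inL2Z.
  by rewrite -E; exact: inL2Z.
apply: (wder_eq (wderZ c (or_introl erefl) W)) => z /=; first by rewrite mulrCA.
by rewrite mulrDr !(mulrCA c).
Qed.

Lemma yderD f f' g g' : yder f f' -> yder g g' ->
  yder (fun z => f z + g z) (fun z => f' z + g' z).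
Proof.
move=> Hf Hg k; have [f2 f2' W] := Hf k; have [g2 g2' W'] := Hg k.
have E (p q : R * R -> R) : (fun z => P z ^+ k * p z + P z ^+ k * q z) =
    (fun z => P z ^+ k * (p z + q z)) by apply/funext => z; rewrite mulrDr.
split; first by rewrite -E; exact: inL2D.
  by rewrite -E; exact: inL2D.
by apply: (wder_eq (wderD (or_intror erefl) W W')) => z /=; rewrite mulrDr.
Qed.

Lemma yderZ (c : R) f f' : yder f f' -> yder (fun z => c * f z) (fun z => c * f' z).
Proof.
move=> Hf k; have [f2 f2' W] := Hf k.
have E (p : R * R -> R) : (fun z => c * (P z ^+ k * p z)) =
    (fun z => P z ^+ k * (c * p z)) by apply/funext => z; rewrite mulrCA.
split; first by rewrite -E; exact: inL2Z.
  by rewrite -E; exact: inL2Z.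
by apply: (wder_eq (wderZ c (or_intror erefl) W)) => z /=; rewrite mulrCA.
Qed.

Lemma xder_eq f f' g g' : xder f f' -> f =1 g -> f' =1 g' -> xder g g'.
Proof. by move=> H /funext <- /funext <-. Qed.

Lemma yder_eq f f' g g' : yder f f' -> f =1 g -> f' =1 g' -> yder g g'.
Proof. by move=> H /funext <- /funext <-. Qed.

(** The hypothesis at power [k + 1] gives the conclusion at power [k], which is why [xder] ranges
    over all powers of [P]. *)
Lemma xderP f f' : xder f f' -> xder (fun z => P z * f z) (fun z => a * f z + P z * f' z).
Proof.
move=> Hf k; have [f2 _ _] := Hf k; have [g2 g2' W] := Hf k.+1.
have E (p : R * R -> R) : (fun z => P z ^+ k.+1 * p z) = (fun z => P z ^+ k * (P z * p z)).
  by apply/funext => z; rewrite exprSr mulrA.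
split; first by rewrite -E.
  have -> : (fun z => P z ^+ k * (a * f z + P z * f' z)) =
      (fun z => a * (P z ^+ k * f z) + P z ^+ k.+1 * f' z).
    by apply/funext => z; rewrite exprSr; ring.
  by apply: inL2D => //; exact: inL2Z.
apply: (wder_eq W) => z; first by rewrite exprSr mulrA.
case: k {f2 g2 g2' W E} => [|k]; first by rewrite /= !mul0r add0r; ring.
by rewrite /= [in RHS]exprSr -natr1 !exprSr; ring.
Qed.

Lemma yderP f f' : yder f f' -> yder (fun z => P z * f z) (fun z => P z * f' z).
Proof.
move=> Hf k; have [g2 g2' W] := Hf k.+1.
have E (p : R * R -> R) : (fun z => P z ^+ k.+1 * p z) = (fun z => P z ^+ k * (P z * p z)).
  by apply/funext => z; rewrite exprSr mulrA.
by split; rewrite -!E.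
Qed.

Section quadratic_identity.
Context (w wx wy wxx wxy wyy wxxx wxxy wxyy : R * R -> R) (c : R).
Hypotheses (Xw : xder w wx) (Xwx : xder wx wxx) (Xwxx : xder wxx wxxx).
Hypotheses (Xwy : xder wy wxy) (Xwxy : xder wxy wxxy) (Xwyy : xder wyy wxyy).
Hypotheses (Yw : yder w wy) (Ywy : yder wy wyy) (Ywx : yder wx wxy).
Hypotheses (Ywxy : yder wxy wxyy) (Ywxx : yder wxx wxxy).

(** Conjugation replaces [d_x] by [d_x - P], with [P' = a]. This is the symmetric part of
    [(d_x - P)^3 + (d_x - P) d_y^2], lowered by the constant [c], later the derivative of the phase;
    the antisymmetric part follows. *)
Definition carleman_sym z := - 3 * (P z * wxx z) - 3 * a * wx z - P z * wyy z -
  (P z ^+ 3 + c) * w z.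

Definition carleman_antisym z := wxxx z + wxyy z + 3 * (P z ^+ 2 * wx z) +
  3 * a * (P z * w z).

(* A sum of squares up to the terms in [P * wy] and [w]. The coefficients of the total
   derivatives below were found by solving a linear system. *)
Lemma carleman_commutator : null2 (fun z => 2 * (carleman_sym z * carleman_antisym z) -
  (9 * a * wxx z ^+ 2 + 6 * a * wxy z ^+ 2 + a * wyy z ^+ 2 +
   18 * a * (P z * wx z) ^+ 2 - 6 * a * (P z * wy z) ^+ 2 +
   9 * a * (P z ^+ 2 * w z) ^+ 2 - 3 * a ^+ 3 * w z ^+ 2)).
Proof.
apply: (null2_eq (null2D
    (null2D
    (null2D
    (null2D
    (null2Z (- 3) (nullX 1 Xwxx Xwxx)) (null2Z (- 6 * a) (nullX 0 Xwx Xwxx))) (null2D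
    (null2Z (1 * c) (nullX 0 Xwx Xwx)) (null2D
    (null2Z (2) (nullX 1 Xwxy Xwxy)) (null2Z (- 8) (nullX 3 Xwx Xwx))))) (null2D
    (null2D
    (null2Z (- 12 * a) (nullX 2 Xw Xwx)) (null2D
    (null2Z (3 * a ^+ 2) (nullX 1 Xw Xw)) (null2Z (- 2) (nullX 1 Xwyy Xwxx)))) (null2D
    (null2Z (- 2 * a) (nullX 0 Xwy Xwxy)) (null2D
    (null2Z (- 1) (nullX 1 Xwyy Xwyy)) (null2Z (4) (nullX 3 Xwy Xwy)))))) (null2D
    (null2D
    (null2D
    (null2Z (- 2) (nullX 3 Xw Xwxx)) (null2D
    (null2Z (- 2 * c) (nullX 0 Xw Xwxx)) (null2Z (- 3) (nullX 5 Xw Xw)))) (null2D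
    (null2Z (- 3 * c) (nullX 2 Xw Xw)) (null2D
    (null2Z (1 * c) (nullX 0 Xwy Xwy)) (null2Z (- 4) (nullY 1 Ywxx Ywxy))))) (null2D
    (null2D
    (null2Z (- 6 * a) (nullY 0 Ywx Ywxy)) (null2D
    (null2Z (2 * a) (nullY 0 Ywy Ywxx)) (null2Z (- 6) (nullY 3 Ywy Ywx)))) (null2D
    (null2Z (- 6 * a) (nullY 2 Ywy Yw)) (null2D
    (null2Z (- 2) (nullY 3 Yw Ywxy)) (null2Z (- 2 * c) (nullY 0 Yw Ywxy)))))))).
move=> z /=; rewrite /carleman_sym /carleman_antisym.
move: (w z) (wx z) (wy z) (wxx z) (wxy z) (wyy z) (wxxx z) (wxxy z) (wxyy z) (P z).
by move=> u x y xx xy yy xxx xxy xyy p; ring.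
Qed.

(* Absorbs the term in [P * wy] which has the bad sign in [carleman_commutator]. *)
Lemma carleman_sym_pairing : null2 (fun z => (P z * wy z) ^+ 2 -
  carleman_sym z * (P z * w z) + 3 * (P z * wx z) ^+ 2 - (P z ^+ 2 * w z) ^+ 2 -
  c * (P z * w z * w z) - 3 / 2 * a ^+ 2 * w z ^+ 2).
Proof.
apply: (null2_eq (null2D
    (null2Z (3) (nullX 2 Xw Xwx)) (null2D
    (null2Z (- 3 / 2 * a) (nullX 1 Xw Xw)) (null2Z (1) (nullY 2 Ywy Yw))))).
move=> z /=; rewrite /carleman_sym.
move: (w z) (wx z) (wy z) (wxx z) (wxy z) (wyy z) (wxxx z) (wxxy z) (wxyy z) (P z).
by move=> u x y xx xy yy xxx xxy xyy p; field.
Qed.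

Let L2x f f1 (k : nat) (H : xder f f1) : inL2 (fun z => P z ^+ k * f z).
Proof. by have [? _ _] := H k. Qed.

Let L2xd f f1 (k : nat) (H : xder f f1) : inL2 (fun z => P z ^+ k * f1 z).
Proof. by have [_ ? _] := H k. Qed.

Let inL2_eq f g : inL2 f -> f =1 g -> inL2 g.
Proof. by move=> H /funext <-. Qed.

Lemma inL2_carleman_sym : inL2 carleman_sym.
Proof.
apply: (@inL2_eq (fun z => - 3 * (P z ^+ 1 * wxx z) + - (3 * a) * (P z ^+ 0 * wx z) +
    (- 1 * (P z ^+ 1 * wyy z) + (- 1 * (P z ^+ 3 * w z) + - c * (P z ^+ 0 * w z))))).
  apply: inL2D; first by apply: inL2D; apply: inL2Z; [exact: L2x Xwxx|exact: L2x Xwx].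
  apply: inL2D; first by apply: inL2Z; exact: L2x Xwyy.
  by apply: inL2D; apply: inL2Z; exact: L2x Xw.
by move=> z; rewrite /carleman_sym; ring.
Qed.

Lemma inL2_carleman_antisym : inL2 carleman_antisym.
Proof.
apply: (@inL2_eq (fun z => P z ^+ 0 * wxxx z + P z ^+ 0 * wxyy z +
    (3 * (P z ^+ 2 * wx z) + 3 * a * (P z ^+ 1 * w z)))).
  apply: inL2D; apply: inL2D; [exact: L2xd Xwxx|exact: L2xd Xwyy| |].
    by apply: inL2Z; exact: L2x Xwx.
  by apply: inL2Z; exact: L2x Xw.
by move=> z; rewrite /carleman_antisym; ring.
Qed.

(** Adding [- 6 a] times [carleman_sym_pairing] to the commutator identity cancels the term in
    [P wy] exactly and lowers [9 a P^4] to [3 a P^4]. With [S] the symmetric part, [- 2 S^2] absorbs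
    the two products: [- (S + q w)^2] leaves [q^2 w^2], hence [M^2], and [- (S - 6 a P w)^2 / 2]
    leaves [18 a^2 P^2 w^2]. *)
Lemma carleman_estimate (q : R * R -> R) (M : R) : 0 <= a ->
  inL2 (fun z => q z * w z) -> {ae leb2, forall z, `|q z| <= M} ->
  \int[leb2]_z (- 2 * (carleman_sym z * (carleman_antisym z + carleman_sym z + q z * w z)))
  <= \int[leb2]_z ((- 3 * a * P z ^+ 4 + 6 * a * c * P z + 12 * a ^+ 3 +
    18 * a ^+ 2 * P z ^+ 2 + M ^+ 2) * w z ^+ 2).
Proof.
move=> a0 qw qM; have S2 := inL2_carleman_sym; have A2 := inL2_carleman_antisym.
have [N1i N1] := carleman_commutator; have [N2i N2] := carleman_sym_pairing.
have iL : integrable2 (fun z => - 2 * (carleman_sym z *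
    (carleman_antisym z + carleman_sym z + q z * w z))).
  by apply: integrable2Z; apply: integrable2M => //; apply: inL2D => //; exact: inL2D.
have iN2 := integrable2Z (- 6 * a) N2i.
rewrite -[leLHS]addr0 -N1 -[leLHS]addr0 -[X in _ + X](mulr0 (- 6 * a)) -N2.
rewrite -int2Z// -int2D// -int2D//; last exact: integrable2D.
apply: int2_ae_le; first by do 2?apply: integrable2D.
  have w2 k l : integrable2 (fun z => P z ^+ k * w z * (P z ^+ l * w z)).
    by apply: integrable2M; apply: L2x; exact: Xw.
  have -> : (fun z => (- 3 * a * P z ^+ 4 + 6 * a * c * P z + 12 * a ^+ 3 +
      18 * a ^+ 2 * P z ^+ 2 + M ^+ 2) * w z ^+ 2) = (fun z =>
      - 3 * a * (P z ^+ 2 * w z * (P z ^+ 2 * w z)) +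
      6 * a * c * (P z ^+ 1 * w z * (P z ^+ 0 * w z)) +
      ((12 * a ^+ 3 + M ^+ 2) * (P z ^+ 0 * w z * (P z ^+ 0 * w z)) +
      18 * a ^+ 2 * (P z ^+ 1 * w z * (P z ^+ 1 * w z)))).
    by apply/funext => z; move: (P z) (w z) => p v; ring.
  by do 2?apply: integrable2D; apply: integrable2Z; exact: w2.
apply: ae2_imp qM => z qM; have : q z ^+ 2 <= M ^+ 2.
  by rewrite -[leLHS]real_normK ?num_real// lerXn2r ?nnegrE// (le_trans _ qM).
move: (carleman_sym z) (carleman_antisym z) => s t.
move: (w z) (wx z) (wy z) (wxx z) (wxy z) (wyy z) (P z) (q z) a0.
move=> v x y xx xy yy p r a0 rM.
have h1 : 0 <= a * (9 * xx ^+ 2 + 6 * xy ^+ 2 + yy ^+ 2 + 36 * (p * x) ^+ 2).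
  apply: mulr_ge0 => //; have := sqr_ge0 xx; have := sqr_ge0 xy.
  have := sqr_ge0 yy; have := sqr_ge0 (p * x); lra.
have h2 : 0 <= 2^-1 * (s - 6 * (a * p * v)) ^+ 2 + (s + r * v) ^+ 2.
  by apply: addr_ge0; [apply: mulr_ge0 => //; exact: sqr_ge0|exact: sqr_ge0].
have h3 : 0 <= (M ^+ 2 - r ^+ 2) * v ^+ 2.
  by apply: mulr_ge0; [rewrite subr_ge0|exact: sqr_ge0].
have h4 := sqr_ge0 s.
apply: (@le_trans _ _ (- (a * (9 * xx ^+ 2 + 6 * xy ^+ 2 + yy ^+ 2 + 36 * (p * x) ^+ 2)) -
  (2^-1 * (s - 6 * (a * p * v)) ^+ 2 + (s + r * v) ^+ 2) - 2^-1 * s ^+ 2 -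
  (M ^+ 2 - r ^+ 2) * v ^+ 2 + (- 3 * a * p ^+ 4 + 6 * a * c * p + 12 * a ^+ 3 +
    18 * a ^+ 2 * p ^+ 2 + M ^+ 2) * v ^+ 2)); last by lra.
by rewrite le_eqVlt; apply/orP; left; apply/eqP; field.
Qed.

End quadratic_identity.

(** The first two terms are in divergence form, [- 3 (P w_x)_x], and [P] does not depend on [y]. *)
Lemma carleman_sym_symmetric w wx wxx wy wyy g gx gxx gy gyy (c : R) :
  xder w wx -> xder wx wxx -> yder w wy -> yder wy wyy ->
  xder g gx -> xder gx gxx -> yder g gy -> yder gy gyy ->
  null2 (fun z => carleman_sym w wx wxx wyy c z * g z -
                  carleman_sym g gx gxx gyy c z * w z).
Proof.
move=> Xw Xwx Yw Ywy Xg Xgx Yg Ygy.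
apply: (null2_eq (null2D
  (null2D (null2Z (- 3) (nullX 1 Xwx Xg)) (null2Z 3 (nullX 1 Xgx Xw)))
  (null2D (null2Z (- 1) (nullY 1 Ywy Yg)) (null2Z 1 (nullY 1 Ygy Yw))))).
move=> z /=; rewrite /carleman_sym.
move: (w z) (wx z) (wy z) (wxx z) (wyy z) (g z) (gx z) (gy z) (gxx z) (gyy z) (P z).
by move=> *; ring.
Qed.

End carleman.

(** * Conjugation by the Gaussian weight *)

Section gaussian_weight.
Context {R : realType}.
Local Notation T2 := (measurableTypeR R * measurableTypeR R)%type.
Implicit Types (z v : R * R).
Context (a b : R).

Definition lin z : R := a * z.1 + b.
Definition gw z : R := expR (a / 2 * z.1 ^+ 2 + b * z.1).

Lemma is_derive_lin z v : is_derive z v lin (a * v.1).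
Proof.
have D0 : is_derive z v ((fun=> b) : R * R -> R) 0 by exact: is_derive_cst.
by have := is_deriveD (is_deriveZ a (is_derive_fst z v)) D0; rewrite addr0.
Qed.

Lemma is_derive_gw z v : is_derive z v gw (v.1 * (lin z * gw z)).
Proof.
pose f (x : R) := a / 2 * x ^+ 2 + b * x.
have D : is_derive (z.1) 1 (fun x : R => expR (f x)) (lin z * gw z).
  have D1 : is_derive z.1 (1 : R) f (lin z).
    by rewrite /f; apply: is_derive_eq; rewrite /GRing.scale/= /lin; field.
  apply: (is_derive_eq (is_derive1_comp (is_derive_expR (f z.1)) D1)).
  by rewrite /gw mulrC.
have := is_derive_scalar_comp D (is_derive_fst z v).
by rewrite mulrC.
Qed.

Lemma smooth_lin : smooth lin.
Proof.
by move=> k; apply: CkD; [apply: CkZ; exact: Ck_fst|exact: Ck_cst].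
Qed.

Lemma smooth_gw : smooth gw.
Proof.
have cont : continuous gw.
  move=> z; apply: (continuous_comp (f := fun z => a / 2 * z.1 ^+ 2 + b * z.1) (g := expR));
    last exact: continuous_expR.
  apply: cvgD; apply: cvgM; [exact: cvg_cst| |exact: cvg_cst|exact: cvg_fst].
  by apply: cvgM; exact: cvg_fst.
elim=> [|k IH]; first by split.
have d1 z : is_derive z ex gw (lin z * gw z).
  by have := is_derive_gw z ex; rewrite mul1r.
have d2 z : is_derive z ey gw 0.
  by have := is_derive_gw z ey; rewrite mul0r.
exact: (CkS_intro cont d1 d2 (CkM (smooth_lin k) IH) (Ck_cst k 0)).
Qed.

Lemma smoothX (f : R * R -> R) k : smooth f -> smooth (fun z => f z ^+ k).
Proof.
move=> sf; elim: k => [|k IH]; first by move=> n; under eq_fun do rewrite expr0; exact: Ck_cst.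
by under eq_fun do rewrite exprS; exact: smoothM.
Qed.

Lemma smooth_lin_gw k : smooth (fun z => lin z ^+ k * gw z).
Proof. by apply: smoothM; [apply: smoothX; exact: smooth_lin|exact: smooth_gw]. Qed.

Lemma is_derive_linX z v k : is_derive z v (fun z => lin z ^+ k)
  (k%:R * (a * v.1) * lin z ^+ k.-1).
Proof.
elim: k => [|k IH].
  by under eq_fun do rewrite expr0; rewrite !mul0r; exact: is_derive_cst.
under eq_fun do rewrite exprS.
apply: (is_derive_eq (is_deriveM (is_derive_lin z v) IH)).
rewrite /GRing.scale/=; case: k {IH} => [|k] /=; first by rewrite expr0; ring.
by rewrite -[in RHS]natr1 exprS; ring.
Qed.

Lemma is_derive_lin_gw z v k : is_derive z v (fun z => lin z ^+ k * gw z)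
  (v.1 * (k%:R * a * (lin z ^+ k.-1 * gw z) + lin z ^+ k.+1 * gw z)).
Proof.
apply: (is_derive_eq (is_deriveM (is_derive_linX z v k) (is_derive_gw z v))).
by rewrite /GRing.scale/= exprS; ring.
Qed.

Section slice.
(** [F i j] stands for [d_x^i d_y^j u] at a fixed time. *)
Context (F : nat -> nat -> R * R -> R).
Hypothesis F2 : forall k i j, (i + j <= 3)%N -> inL2 (fun z => lin z ^+ k * gw z * F i j z).
Hypothesis Fx : forall i j, (i + j <= 2)%N -> wder ex (F i j) (F i.+1 j).
Hypothesis Fy : forall i j, (i + j <= 2)%N -> wder ey (F i j) (F i j.+1).

Lemma xder_gw i j : (i + j <= 2)%N -> xder lin a (fun z => gw z * F i j z)
  (fun z => lin z * (gw z * F i j z) + gw z * F i.+1 j z).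
Proof.
move=> ij k; have ij3 : (i + j <= 3)%N by exact: leqW.
have A0 : (fun z => lin z ^+ k * (gw z * F i j z)) = (fun z => lin z ^+ k * gw z * F i j z).
  by apply/funext => z; rewrite mulrA.
have A1 : (fun z => lin z ^+ k * (lin z * (gw z * F i j z) + gw z * F i.+1 j z)) =
    (fun z => lin z ^+ k.+1 * gw z * F i j z + lin z ^+ k * gw z * F i.+1 j z).
  by apply/funext => z; rewrite exprSr; ring.
split; first by rewrite A0; exact: F2.
  by rewrite A1; apply: inL2D; exact: F2.
pose m' z := k%:R * a * (lin z ^+ k.-1 * gw z) + lin z ^+ k.+1 * gw z.
have sm' : smooth m'.
  by move=> n; apply: CkD; [apply: CkZ|]; exact: smooth_lin_gw.
have D z : is_derive z ex (fun z => lin z ^+ k * gw z) (m' z).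
  by have := is_derive_lin_gw z ex k; rewrite mul1r.
have L : inL2 (fun z => m' z * F i j z + lin z ^+ k * gw z * F i.+1 j z).
  have -> : (fun z => m' z * F i j z + lin z ^+ k * gw z * F i.+1 j z) = (fun z =>
    (k%:R * a * (lin z ^+ k.-1 * gw z * F i j z) + lin z ^+ k.+1 * gw z * F i j z) +
      lin z ^+ k * gw z * F i.+1 j z) by apply/funext => z; rewrite /m'; ring.
  by apply: inL2D; [apply: inL2D; [apply: inL2Z|]|]; exact: F2.
apply: (wder_eq (wderM (or_introl erefl) (smooth_lin_gw k) sm' D (Fx ij) (F2 k ij3) L)) => z /=.
  by rewrite mulrA.
by rewrite /m' exprSr; ring.
Qed.

Lemma yder_gw i j : (i + j <= 2)%N -> yder lin (fun z => gw z * F i j z)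
  (fun z => gw z * F i j.+1 z).
Proof.
move=> ij k; have ij3 : (i + j <= 3)%N by exact: leqW.
have ij1 : (i + j.+1 <= 3)%N by rewrite addnS.
have A0 (p q : nat) : (fun z => lin z ^+ k * (gw z * F p q z)) =
    (fun z => lin z ^+ k * gw z * F p q z).
  by apply/funext => z; rewrite mulrA.
split; [by rewrite A0; exact: F2|by rewrite A0; exact: F2|].
have s0 : smooth ((fun=> 0) : R * R -> R) by move=> n; exact: Ck_cst.
have D z : is_derive z ey (fun z => lin z ^+ k * gw z) ((fun=> 0) z).
  by have := is_derive_lin_gw z ey k; rewrite mul0r.
have L : inL2 (fun z => (fun=> 0) z * F i j z + lin z ^+ k * gw z * F i j.+1 z).
  by under eq_fun do rewrite mul0r add0r; exact: F2.
apply: (wder_eq (wderM (or_intror erefl) (smooth_lin_gw k) s0 D (Fy ij) (F2 k ij3) L)) => z /=.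
  by rewrite mulrA.
by rewrite mul0r add0r mulrA.
Qed.

(** The conjugated function [w = gw u] and its derivatives, expanded with [gw_x = lin gw] and
    [lin_x = a]. *)
Definition cj z := gw z * F 0 0 z.
Definition cjx z := gw z * (F 1 0 z + lin z * F 0 0 z).
Definition cjy z := gw z * F 0 1 z.
Definition cjxx z := gw z * (F 2 0 z + 2 * lin z * F 1 0 z + (lin z ^+ 2 + a) * F 0 0 z).
Definition cjxy z := gw z * (F 1 1 z + lin z * F 0 1 z).
Definition cjyy z := gw z * F 0 2 z.
Definition cjxxx z := gw z * (F 3 0 z + 3 * lin z * F 2 0 z +
  3 * (lin z ^+ 2 + a) * F 1 0 z + (lin z ^+ 3 + 3 * a * lin z) * F 0 0 z).
Definition cjxxy z := gw z * (F 2 1 z + 2 * lin z * F 1 1 z + (lin z ^+ 2 + a) * F 0 1 z).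
Definition cjxyy z := gw z * (F 1 2 z + lin z * F 0 2 z).

Let X00 := @xder_gw 0 0 isT.
Let X10 := @xder_gw 1 0 isT.
Let X20 := @xder_gw 2 0 isT.
Let X01 := @xder_gw 0 1 isT.
Let X11 := @xder_gw 1 1 isT.
Let X02 := @xder_gw 0 2 isT.
Let Y00 := @yder_gw 0 0 isT.
Let Y10 := @yder_gw 1 0 isT.
Let Y20 := @yder_gw 2 0 isT.
Let Y01 := @yder_gw 0 1 isT.
Let Y11 := @yder_gw 1 1 isT.

Lemma xder_cj : xder lin a cj cjx.
Proof. by apply: (xder_eq X00) => z //=; rewrite /cjx; ring. Qed.

Lemma xder_cjx : xder lin a cjx cjxx.
Proof. by apply: (xder_eq (xderD X10 (xderP X00))) => z /=; rewrite /cjx /cjxx; ring. Qed.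

Lemma xder_cjxx : xder lin a cjxx cjxxx.
Proof.
apply: (xder_eq (xderD (xderD X20 (xderZ 2 (xderP X10)))
  (xderD (xderP (xderP X00)) (xderZ a X00)))) => z /=; rewrite /cjxx /cjxxx; ring.
Qed.

Lemma xder_cjy : xder lin a cjy cjxy.
Proof. by apply: (xder_eq X01) => z //=; rewrite /cjxy; ring. Qed.

Lemma xder_cjxy : xder lin a cjxy cjxxy.
Proof. by apply: (xder_eq (xderD X11 (xderP X01))) => z /=; rewrite /cjxy /cjxxy; ring. Qed.

Lemma xder_cjyy : xder lin a cjyy cjxyy.
Proof. by apply: (xder_eq X02) => z //=; rewrite /cjxyy; ring. Qed.

Lemma yder_cj : yder lin cj cjy.
Proof. exact: Y00. Qed.

Lemma yder_cjy : yder lin cjy cjyy.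
Proof. exact: Y01. Qed.

Lemma yder_cjx : yder lin cjx cjxy.
Proof. by apply: (yder_eq (yderD Y10 (yderP Y00))) => z /=; rewrite /cjx /cjxy; ring. Qed.

Lemma yder_cjxy : yder lin cjxy cjxyy.
Proof. by apply: (yder_eq (yderD Y11 (yderP Y01))) => z /=; rewrite /cjxy /cjxyy; ring. Qed.

Lemma yder_cjxx : yder lin cjxx cjxxy.
Proof.
apply: (yder_eq (yderD (yderD Y20 (yderZ 2 (yderP Y10)))
  (yderD (yderP (yderP Y00)) (yderZ a Y00)))) => z /=; rewrite /cjxx /cjxxy; ring.
Qed.

(* The weight conjugates [d_x ^ 3 + d_x d_y ^ 2] into the sum of its
   antisymmetric and symmetric parts. *)
Lemma gw_conjugation z : gw z * (F 3 0 z + F 1 2 z) =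
  carleman_antisym lin a cj cjx cjxxx cjxyy z + carleman_sym lin a cj cjx cjxx cjyy 0 z.
Proof.
rewrite /carleman_antisym /carleman_sym /cj /cjx /cjxx /cjyy /cjxxx /cjxyy.
by move: (F 0 0 z) (F 1 0 z) (F 2 0 z) (F 3 0 z) (F 0 2 z) (F 1 2 z) (gw z) (lin z) => *; ring.
Qed.

End slice.
End gaussian_weight.

(** * The Carleman energy along the solution *)

Section carleman_in_time.
Context {R : realType}.
Local Notation T2 := (measurableTypeR R * measurableTypeR R)%type.
Implicit Types (z v : R * R) (t s : R).

Lemma inL2_ae_bdM (f g : R * R -> R) (M : R) : measurable_fun [set: T2] g ->
  {ae leb2, forall z, `|g z| <= M} -> inL2 f -> inL2 (fun z => g z * f z).
Proof.
move=> mg gM f2; have mf := inL2_measurable f2.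
(* Clipping [g] turns the a.e. bound into a pointwise one without changing [g] outside a null
   set. *)
pose q z := Num.max (- `|M|) (Num.min `|M| (g z)).
have mq : measurable_fun [set: T2] q.
  by apply: measurable_maxr => //; apply: measurable_minr.
have qM z : `|q z| <= `|M|.
  rewrite /q ler_norml le_max lexx /= ge_max ge_min lexx /= andbT.
  by rewrite (@le_trans _ _ 0)// oppr_le0.
have qf := inL2_bdM mq qM f2.
apply: (inL2_ae _ qf); first exact: measurable_funM.
apply: ae2_imp gM => z /(le_trans)/(_ (ler_norm M)); rewrite ler_norml => /andP[A1 A2].
by rewrite /q min_r// max_r.
Qed.

Context (u : R -> R * R -> R) (M a b q : R).
Hypothesis hH4 : C0H 4 u.
Hypothesis hC1 : C1L2 u.
Hypothesis hZK : ZK_solution u.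
Hypothesis hM : forall t, t \in `[0, 1] -> {ae leb2, forall z, `|Du u 1 0 t z| <= M}.
Hypothesis a0 : 0 <= a.

(** The interface between the estimate and the two regimes: for [a = 0] it follows from exponential
    decay, for general [a] from confinement to the strip. All powers are allowed because the proof
    of continuity in time squares the weight. *)
Definition gauss_bounded : Prop := forall k n i j, (i + j <= 3)%N -> exists C : R,
  forall t, t \in `[0, 1] ->
    inL2 (fun z => lin a b z ^+ k * gw a b z ^+ n * Du u i j t z) /\
    nrm (fun z => lin a b z ^+ k * gw a b z ^+ n * Du u i j t z) <= C.

Hypothesis HH : gauss_bounded.

Local Notation P := (lin a b).
Local Notation om := (gw a b).
Let hL2 : C0L2 u. Proof. by case: hC1. Qed.
Let F t i j := Du u i j t.
Let S c t := carleman_sym P a (cj a b (F t)) (cjx a b (F t)) (cjxx a b (F t)) (cjyy a b (F t)) c.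
(** Chosen so that the pairing of [G t] with [u t] is [<S_0 w, w>] for [w = om u]. *)
Let G t z := om z * S 0 t z.

Let L2W k n i j t : t \in `[0, 1] -> (i + j <= 3)%N ->
  inL2 (fun z => P z ^+ k * om z ^+ n * Du u i j t z).
Proof. by move=> tI ij; have [C /(_ t tI)[]] := HH k n ij. Qed.

(** For an increment [d] and a weight [W], [|W d|^2 = <W^2 d, d>]: the first factor is bounded by
    [gauss_bounded], the second is small in L^2. *)
Let cont_weight k n i j : (i + j <= 3)%N ->
  L2cont (fun t z => P z ^+ k * om z ^+ n * Du u i j t z).
Proof.
move=> ij; split; first by move=> t tI; exact: L2W.
move=> s e sI e0; have [C HC] := HH (k + k) (n + n) ij.
pose K := 2 * `|C| + 1; have K0 : 0 < K by rewrite ltr_wpDl// mulr_ge0.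
have eK : 0 < e ^+ 2 / K by rewrite divr_gt0// exprn_gt0.
have [d d0 Hd] := Du_continuous hH4 hL2 sI (leqW ij) eK.
exists d => // t tI td; have {}Hd := Hd t tI td.
have D2 : inL2 (fun z => Du u i j t z - Du u i j s z).
  by apply: inL2B; exact: (Du_inL2 hH4 _ (leqW ij)).
have [Wt Ct] := HC t tI; have [Ws Cs] := HC s sI.
have W2 := inL2B Wt Ws.
apply: nrm_le; first exact: ltW.
have -> : (fun z => (P z ^+ k * om z ^+ n * Du u i j t z -
    P z ^+ k * om z ^+ n * Du u i j s z) ^+ 2) = (fun z =>
    (P z ^+ (k + k) * om z ^+ (n + n) * Du u i j t z -
     P z ^+ (k + k) * om z ^+ (n + n) * Du u i j s z) * (Du u i j t z - Du u i j s z)).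
  by apply/funext => z; rewrite !exprD; ring.
apply: (le_trans (ler_norm _)); apply: (le_trans (nrm_CS W2 D2)).
apply: (@le_trans _ _ (K * (e ^+ 2 / K))); last by rewrite mulrC divfK// gt_eqF.
apply: ler_pM; rewrite ?nrm_ge0//.
apply: (le_trans (nrmB Wt Ws)); rewrite /K mulr_natl mulr2n.
apply: (@le_trans _ _ (`|C| + `|C|)); last by rewrite lerDl.
by apply: lerD; [apply: (le_trans Ct)|apply: (le_trans Cs)]; exact: ler_norm.
Qed.

Let U t z := om z ^+ 2 * u t z.

Let cont_U : L2cont U.
Proof.
have := cont_weight 0 2 (i := 0) (j := 0) isT; congr L2cont.
by apply/funext => t; apply/funext => z; rewrite expr0 mul1r.
Qed.

Lemma L2cont_kinetic_density : L2cont G.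
Proof.
have W k i j := cont_weight k 2 (i := i) (j := j).
have K := L2contD (L2contD (L2contD (L2contZ (- 3) (W 1%N 2%N 0%N isT))
    (L2contZ (- 6) (W 2%N 1%N 0%N isT))) (L2contD (L2contZ (- 4) (W 3%N 0%N 0%N isT))
    (L2contZ (- (6 * a)) (W 1%N 0%N 0%N isT))))
  (L2contD (L2contZ (- (3 * a)) (W 0%N 1%N 0%N isT)) (L2contZ (- 1) (W 1%N 0%N 2%N isT))).
move: K; congr L2cont; apply/funext => t; apply/funext => z.
rewrite /G /S /carleman_sym /cj /cjx /cjxx /cjyy /F.
move: (Du u 2 0 t z) (Du u 1 0 t z) (Du u 0 0 t z) (Du u 0 2 t z) (P z) (om z).
by move=> *; ring.
Qed.

Section slices.
Context (t : R) (tI : t \in `[0, 1]).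

Let F2 k i j : (i + j <= 3)%N -> inL2 (fun z => P z ^+ k * om z * F t i j z).
Proof. exact: (@L2W k 1). Qed.

Let Fx i j : (i + j <= 2)%N -> wder ex (F t i j) (F t i.+1 j).
Proof. by move=> ij; apply: (wder_Du_xy hH4 tI); rewrite addSn ltnS leqW. Qed.

Let Fy i j : (i + j <= 2)%N -> wder ey (F t i j) (F t i j.+1).
Proof. by move=> ij; apply: (wder_Du_y hH4 tI); rewrite addnS ltnS leqW. Qed.

Definition slice_Xw := xder_cj F2 Fx.
Definition slice_Xwx := xder_cjx F2 Fx.
Definition slice_Xwxx := xder_cjxx F2 Fx.
Definition slice_Xwy := xder_cjy F2 Fx.
Definition slice_Xwxy := xder_cjxy F2 Fx.
Definition slice_Xwyy := xder_cjyy F2 Fx.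
Definition slice_Yw := yder_cj F2 Fy.
Definition slice_Ywy := yder_cjy F2 Fy.
Definition slice_Ywx := yder_cjx F2 Fy.
Definition slice_Ywxy := yder_cjxy F2 Fy.
Definition slice_Ywxx := yder_cjxx F2 Fy.

Lemma inL2_slice_sym c : inL2 (S c t).
Proof. exact: (inL2_carleman_sym c slice_Xw slice_Xwx slice_Xwxx slice_Xwyy). Qed.

Lemma inL2_slice : inL2 (cj a b (F t)).
Proof.
have := L2W 0 1 (i := 0) (j := 0) tI isT; congr inL2.
by apply/funext => z; rewrite expr0 mul1r.
Qed.

(** Write [S_c] for the symmetric part and [A] for the antisymmetric one. Both brackets are pairings
    with [S_c w], and [om u_t + c w = - (A + S_c + u_x) w] by the equation; the left side is
    therefore [- 2 <S_c w, (A + S_c + u_x) w>]. *)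
Lemma slice_estimate c :
  2 * (\int[leb2]_z (G t z * dt u t z) - c * \int[leb2]_z (om z ^+ 2 * u t z * dt u t z)) +
  2 * c * (\int[leb2]_z (G t z * u t z) - c * \int[leb2]_z (om z ^+ 2 * u t z * u t z)) <=
  \int[leb2]_z ((- 3 * a * P z ^+ 4 + 6 * a * c * P z + 12 * a ^+ 3 +
    18 * a ^+ 2 * P z ^+ 2 + M ^+ 2) * cj a b (F t) z ^+ 2).
Proof.
have G2 : inL2 (G t) by case: L2cont_kinetic_density => + _; exact.
have U2 : inL2 (U t) by case: cont_U => + _; exact.
have v2 : inL2 (dt u t) by case: hC1 => _ _ [+ _]; exact.
have u2 : inL2 (u t) by case: hL2 => + _; exact.
have S2 := inL2_slice_sym c; have w2 := inL2_slice.
have qw : inL2 (fun z => F t 1 0 z * cj a b (F t) z).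
  apply: inL2_ae_bdM (hM tI) w2; apply: inL2_measurable.
  exact: (Du_inL2 hH4 tI).
have GE z : G t z - c * U t z = om z * S c t z.
  by rewrite /G /U /S /carleman_sym /cj /F -[Du u 0 0 t]/(u t); ring.
have E1 : \int[leb2]_z (G t z * dt u t z) - c * \int[leb2]_z (U t z * dt u t z) =
    \int[leb2]_z (om z * S c t z * dt u t z).
  have i1 := integrable2M G2 v2; have i2 := integrable2M U2 v2.
  rewrite -int2Z// -int2B//; last exact: integrable2Z.
  by congr (Rintegral _ _ _); apply/funext => z; rewrite -GE; ring.
have E2 : \int[leb2]_z (G t z * u t z) - c * \int[leb2]_z (U t z * u t z) =
    \int[leb2]_z (S c t z * cj a b (F t) z).
  have i1 := integrable2M G2 u2; have i2 := integrable2M U2 u2.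
  rewrite -int2Z// -int2B//; last exact: integrable2Z.
  congr (Rintegral _ _ _); apply/funext => z.
  have -> : S c t z * cj a b (F t) z = om z * S c t z * u t z.
    by rewrite /cj /F -[Du u 0 0 t]/(u t); ring.
  by rewrite -GE; ring.
rewrite -/(U t) E1 E2.
have oS2 : inL2 (fun z => om z * S c t z).
  have := inL2B G2 (inL2Z c U2); congr inL2.
  by apply/funext => z; exact: GE.
have A2 : inL2 (carleman_antisym P a (cj a b (F t)) (cjx a b (F t)) (cjxxx a b (F t)) (cjxyy a b (F t))).
  exact: (inL2_carleman_antisym slice_Xw slice_Xwx slice_Xwxx slice_Xwyy).
have est := carleman_estimate c slice_Xw slice_Xwx slice_Xwxx slice_Xwy slice_Xwxy
  slice_Xwyy slice_Yw slice_Ywy slice_Ywx slice_Ywxy slice_Ywxx a0 qw (hM tI).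
apply: le_trans est.
have i1 := integrable2M oS2 v2; have i2 := integrable2M S2 w2.
rewrite -!int2Z// -int2D; [|exact: integrable2Z|exact: integrable2Z].
apply: int2_ae_le.
- by apply: integrable2D; exact: integrable2Z.
- apply: integrable2Z; apply: integrable2M => //.
  by apply: inL2D => //; exact: inL2D.
apply: ae2_imp (ZK_ae hH4 hZK tI) => z ->.
have C := gw_conjugation a b (F t) z.
rewrite le_eqVlt; apply/orP; left; apply/eqP.
have ES : carleman_sym P a (cj a b (F t)) (cjx a b (F t)) (cjxx a b (F t)) (cjyy a b (F t)) 0 z
  = S c t z + c * cj a b (F t) z by rewrite /S /carleman_sym; ring.
rewrite -/(S c t z).
move: C; rewrite ES; move: (carleman_antisym _ _ _ _ _ _ _) => A.
rewrite /cj -[Du u 3 0 t z]/(F t 3 0 z) -[Du u 1 2 t z]/(F t 1 2 z).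
rewrite -[Du u 1 0 t z]/(F t 1 0 z) -[u t z]/(F t 0 0 z).
move: (F t 3 0 z) (F t 1 2 z) (F t 1 0 z) (F t 0 0 z) (om z) (S c t z).
move=> f30 f12 f10 f00 o s C.
have -> : A = o * (f30 + f12) - (s + c * (o * f00)) by rewrite C; ring.
by ring.
Qed.

End slices.

Let kin t := \int[leb2]_z (G t z * u t z).
Let mass t := \int[leb2]_z (U t z * u t z).

Lemma massE t : mass t = \int[leb2]_z (om z * u t z) ^+ 2.
Proof. by congr (Rintegral _ _ _); apply/funext => z; rewrite /U; ring. Qed.

Let G_sym s r : s \in `[0, 1] -> r \in `[0, 1] ->
  \int[leb2]_z (G s z * u r z) = \int[leb2]_z (G r z * u s z).
Proof.
move=> sI rI.
have [_] := carleman_sym_symmetric 0 (slice_Xw sI) (slice_Xwx sI) (slice_Yw sI)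
  (slice_Ywy sI) (slice_Xw rI) (slice_Xwx rI) (slice_Yw rI) (slice_Ywy rI).
rewrite int2B; last 2 first.
- exact: integrable2M (inL2_slice_sym sI 0) (inL2_slice rI).
- exact: integrable2M (inL2_slice_sym rI 0) (inL2_slice sI).
move/eqP; rewrite subr_eq0 => /eqP E.
transitivity (\int[leb2]_z (S 0 s z * cj a b (F r) z)).
  by congr (Rintegral _ _ _); apply/funext => z; rewrite /G /cj /F -[Du u 0 0 r]/(u r); ring.
rewrite E -/(S 0 r).
by congr (Rintegral _ _ _); apply/funext => z; rewrite /G /cj /F -[Du u 0 0 s]/(u s); ring.
Qed.

Let cont_u : L2cont u. Proof. exact: L2cont_C0L2. Qed.

Let kin_deriv t : 0 < t < 1 -> is_derive t 1 kin (2 * \int[leb2]_z (G t z * dt u t z)).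
Proof. by move=> tI; exact: (symmetric_pairing_is_derive hC1 L2cont_kinetic_density G_sym). Qed.

Let mass_deriv t : 0 < t < 1 -> is_derive t 1 mass (2 * \int[leb2]_z (U t z * dt u t z)).
Proof.
move=> tI; apply: (symmetric_pairing_is_derive hC1 cont_U) => // s r _ _.
by congr (Rintegral _ _ _); apply/funext => z; rewrite /U; ring.
Qed.

Definition phase t := q * (t * (1 - t)).
Definition dphase t := q * (1 - 2 * t).

Let is_derive_phase t : is_derive t 1 (fun t => 2 * phase t) (2 * dphase t).
Proof.
by rewrite /phase /dphase; apply: is_derive_eq; rewrite /GRing.scale/=; ring.
Qed.

Let is_derive_dphase t : is_derive t 1 dphase (- (2 * q)).
Proof.
by rewrite /dphase; apply: is_derive_eq; rewrite /GRing.scale/=; ring.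
Qed.

Definition carleman_kinetic t := \int[leb2]_z (G t z * u t z).
Definition carleman_mass t := \int[leb2]_z (om z * u t z) ^+ 2.
(** The quadratic form of [S_0 - theta'] at [w], without the factor [exp (2 theta)]. *)
Definition carleman_energy t := carleman_kinetic t - dphase t * carleman_mass t.

Let energy_deriv t : 0 < t < 1 -> is_derive t 1 carleman_energy
  (2 * \int[leb2]_z (G t z * dt u t z) -
   (- (2 * q) * mass t + dphase t * (2 * \int[leb2]_z (U t z * dt u t z)))).
Proof.
move=> tI.
have -> : carleman_energy = fun t => kin t - dphase t * mass t.
  by apply/funext => s; rewrite massE.
apply: (is_derive_eq (is_deriveB (kin_deriv tI) (is_deriveM (is_derive_dphase t) (mass_deriv tI)))).
by rewrite /GRing.scale/=; ring.
Qed.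

Let cont_energy : cont01 carleman_energy.
Proof.
have ck : cont01 kin by exact: cont01_pairing L2cont_kinetic_density cont_u.
have cm : cont01 mass by exact: cont01_pairing cont_U cont_u.
have -> : carleman_energy = fun t => kin t - dphase t * mass t.
  by apply/funext => s; rewrite massE.
move=> s e sI e0; have e3 : 0 < e / 3 by rewrite divr_gt0.
pose K := `|q| + 1; have K0 : 0 < K by rewrite ltr_wpDl.
pose L := 2 * `|q| * `|mass s| + 1.
have L0 : 0 < L by rewrite ltr_wpDl// !mulr_ge0.
have eK : 0 < e / 3 / K by rewrite divr_gt0.
have [d d0 Hd] := ck s _ sI e3; have [h h0 Hh] := cm s _ sI eK.
exists (Num.min (Num.min d h) (e / 3 / L)); first by rewrite !lt_min d0 h0 divr_gt0.
move=> t tI; rewrite !le_min => /andP[/andP[td th] tL].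
have -> : kin t - dphase t * mass t - (kin s - dphase s * mass s) =
  (kin t - kin s) + (- (dphase t * (mass t - mass s)) + 2 * q * mass s * (t - s)).
  by rewrite /dphase; ring.
have b1 : `|kin t - kin s| <= e / 3 by exact: Hd.
have b2 : `|dphase t * (mass t - mass s)| <= e / 3.
  rewrite normrM; apply: (@le_trans _ _ (K * (e / 3 / K))); last first.
    by rewrite mulrC divfK// gt_eqF.
  apply: ler_pM => //; last exact: Hh.
  rewrite /dphase normrM /K (@le_trans _ _ `|q|)// ?lerDl// ler_piMr//.
  by move: tI; rewrite in_itv/= ler_norml => /andP[p r]; apply/andP; split; lra.
have b3 : `|2 * q * mass s * (t - s)| <= e / 3.
  rewrite normrM; apply: (@le_trans _ _ (L * (e / 3 / L))); last first.
    by rewrite mulrC divfK// gt_eqF.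
  by apply: ler_pM => //; rewrite /L !normrM [`|2|]ger0_norm// lerDl.
apply: (le_trans (ler_normD _ _)).
apply: (@le_trans _ _ (e / 3 + (e / 3 + e / 3))); last by lra.
apply: lerD => //; apply: (le_trans (ler_normD _ _)).
by apply: lerD => //; rewrite normrN.
Qed.

(** The additional [2 q] is [- theta''], produced by differentiating the coefficient [theta'] of the
    mass. *)
Lemma carleman_energy_decay x y : 0 <= x -> x < y -> y <= 1 -> exists2 s, x < s < y &
  expR (2 * phase y) * carleman_energy y - expR (2 * phase x) * carleman_energy x <=
  (y - x) * (expR (2 * phase s) *
    \int[leb2]_z ((- 3 * a * P z ^+ 4 + 6 * a * dphase s * P z + 12 * a ^+ 3 +
      18 * a ^+ 2 * P z ^+ 2 + M ^+ 2 + 2 * q) * (om z * u s z) ^+ 2)).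
Proof.
move=> x0 xy y1.
have [s /andP[xs sy] ->] := cont01_exp_MVT cont_energy x0 xy y1 energy_deriv is_derive_phase.
exists s; first by rewrite xs.
have sI : s \in `[0, 1] by rewrite in_itv/= (le_trans x0 (ltW xs)) (le_trans (ltW sy) y1).
rewrite mulrC ler_wpM2l ?subr_ge0 ?(ltW xy)// ler_wpM2l ?expR_ge0//.
have est := slice_estimate sI (dphase s).
have w2 k l : integrable2 (fun z => P z ^+ k * cj a b (F s) z * (P z ^+ l * cj a b (F s) z)).
  by apply: integrable2M; have [+ _ _] := slice_Xw sI k; have [+ _ _] := slice_Xw sI l.
have iR : integrable2 (fun z => (- 3 * a * P z ^+ 4 + 6 * a * dphase s * P z + 12 * a ^+ 3 +
      18 * a ^+ 2 * P z ^+ 2 + M ^+ 2) * cj a b (F s) z ^+ 2).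
  have -> : (fun z => (- 3 * a * P z ^+ 4 + 6 * a * dphase s * P z + 12 * a ^+ 3 +
      18 * a ^+ 2 * P z ^+ 2 + M ^+ 2) * cj a b (F s) z ^+ 2) = (fun z =>
      - 3 * a * (P z ^+ 2 * cj a b (F s) z * (P z ^+ 2 * cj a b (F s) z)) +
      6 * a * dphase s * (P z ^+ 1 * cj a b (F s) z * (P z ^+ 0 * cj a b (F s) z)) +
      ((12 * a ^+ 3 + M ^+ 2) * (P z ^+ 0 * cj a b (F s) z * (P z ^+ 0 * cj a b (F s) z)) +
      18 * a ^+ 2 * (P z ^+ 1 * cj a b (F s) z * (P z ^+ 1 * cj a b (F s) z)))).
    by apply/funext => z; move: (P z) (cj a b (F s) z) => p v; ring.
  by apply: integrable2D; apply: integrable2D; apply: integrable2Z; exact: w2.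
have -> : (fun z => (- 3 * a * P z ^+ 4 + 6 * a * dphase s * P z + 12 * a ^+ 3 +
      18 * a ^+ 2 * P z ^+ 2 + M ^+ 2 + 2 * q) * (om z * u s z) ^+ 2) = (fun z =>
    (- 3 * a * P z ^+ 4 + 6 * a * dphase s * P z + 12 * a ^+ 3 +
      18 * a ^+ 2 * P z ^+ 2 + M ^+ 2) * cj a b (F s) z ^+ 2 +
    2 * q * (cj a b (F s) z) ^+ 2).
  by apply/funext => z; rewrite /cj -[F s 0 0]/(u s); move: (om z) (u s z) (P z) => *; ring.
have i2 := integrable2Z (2 * q) (inL2_sqr (inL2_slice sI)).
rewrite (int2D iR i2).
rewrite int2Z; last exact: inL2_sqr (inL2_slice sI).
have E1 : \int[leb2]_z (cj a b (F s) z) ^+ 2 = mass s by rewrite massE.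
have E2 : \int[leb2]_z (om z ^+ 2 * u s z * u s z) = mass s by [].
have E3 : carleman_energy s = \int[leb2]_z (G s z * u s z) - dphase s * mass s.
  by rewrite massE.
rewrite E1 E3; move: est; rewrite E2 -/(U s).
move=> est; apply: le_trans (lerD est (lexx (2 * q * mass s))).
by rewrite le_eqVlt; apply/orP; left; apply/eqP; ring.
Qed.

End carleman_in_time.

(** * Vanishing of the solution *)

Section boundary.
Context {R : realType}.
Local Notation T2 := (measurableTypeR R * measurableTypeR R)%type.
Implicit Types (z v : R * R) (t s q : R) (f g : R * R -> R).

(** [exp (e x)] exceeds its Taylor term of degree [n + 1], and [1 + x <= 2 x] once [x >= 1]. *)
Lemma expR_beats_poly n (c e C x0 : R) : 0 < c -> 0 < e ->
  exists x, [/\ x0 <= x, 0 <= x & C * (1 + x) ^+ n < c * expR (e * x)].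
Proof.
move=> c0 e0; pose K := c * (e ^+ n.+1 / n.+1`!%:R).
have K0 : 0 < K by rewrite mulr_gt0// divr_gt0 ?exprn_gt0// ltr0n fact_gt0.
pose x := Num.max 1 (Num.max x0 ((2 ^+ n * `|C| + 1) / K)).
have x1 : 1 <= x by rewrite le_max lexx.
have x0' : x0 <= x by rewrite !le_max lexx /= orbT.
have xK : 2 ^+ n * `|C| + 1 <= K * x.
  by rewrite [leRHS]mulrC -ler_pdivrMr// /x !le_max lexx !orbT.
have xp : 0 <= x by exact: le_trans x1.
exists x; split => //.
have h1 : K * x ^+ n.+1 <= c * expR (e * x).
  rewrite /K -mulrA ler_wpM2l ?(ltW c0)//.
  have := expR_ge1Dxn n (mulr_ge0 (ltW e0) xp); apply: le_trans.
  by rewrite exprMn mulrAC lerDr.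
have h2 : C * (1 + x) ^+ n <= 2 ^+ n * `|C| * x ^+ n.
  apply: (@le_trans _ _ (`|C| * (2 * x) ^+ n)).
    apply: (@le_trans _ _ (`|C| * (1 + x) ^+ n)).
      by rewrite ler_wpM2r ?ler_norm// exprn_ge0// addr_ge0.
    by rewrite ler_wpM2l// lerXn2r ?nnegrE ?addr_ge0 ?mulr_ge0//; lra.
  by rewrite exprMn mulrCA mulrA.
apply: le_lt_trans h2 _; apply: lt_le_trans h1.
rewrite exprS [ltRHS]mulrA ltr_pM2r ?exprn_gt0 ?(lt_le_trans ltr01)//.
by apply: lt_le_trans xK; rewrite ltrDl.
Qed.

Lemma nrm_normr f : nrm (fun z => `|f z|) = nrm f.
Proof. by rewrite /nrm; under eq_Rintegral do rewrite real_normK ?num_real//. Qed.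

Lemma telescope_le (e0 e1 X Y p1 p2 p3 k n0 n1 : R) : X - e0 <= - p1 -> Y - X <= - p2 ->
  e1 - Y <= - p3 -> 0 <= p1 -> 0 <= p3 -> k <= p2 -> e0 <= n0 -> - e1 <= n1 ->
  k <= n0 + n1.
Proof. by move=> *; lra. Qed.

Lemma dphase_le q s : s \in `[0, 1] -> `|dphase q s| <= `|q|.
Proof.
move=> sI; rewrite /dphase normrM ler_piMr//.
by move: sI; rewrite in_itv/= ler_norml => /andP[p r]; apply/andP; split; lra.
Qed.

Lemma int2_abs_le f g : integrable2 f -> integrable2 g ->
  {ae leb2, forall z, `|f z| <= g z} -> `|\int[leb2]_z f z| <= \int[leb2]_z g z.
Proof.
move=> fi gi fg; rewrite ler_norml lerNl -int2N//.
apply/andP; split.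
  apply: int2_ae_le => //; first exact: integrable2N.
  by apply: ae2_imp fg => z; rewrite ler_norml => /andP[h _]; rewrite lerNl.
by apply: int2_ae_le => //; apply: ae2_imp fg => z; rewrite ler_norml => /andP[].
Qed.

(** The mean value theorem selects an unknown time, so a lower bound on a whole time interval is
    needed. *)
Lemma L2cont_lower u t : L2cont u -> 0 < t < 1 -> 0 < nrm (u t) ->
  exists x y : R, [/\ 0 < x, x < y, y < 1 &
    forall s, x < s < y -> nrm (u t) / 2 <= nrm (u s)].
Proof.
move=> [u2 H] /andP[t0 t1] n0; have tI : t \in `[0, 1] by rewrite in_itv/= !ltW.
have n2 : 0 < nrm (u t) / 2 by rewrite divr_gt0.
have [d d0 Hd] := H t _ tI n2.
pose e := Num.min d (Num.min (t / 2) ((1 - t) / 2)).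
have e0 : 0 < e by rewrite !lt_min d0 !divr_gt0// subr_gt0.
have ed : e <= d by rewrite /e ge_min lexx.
have et : e <= t / 2 by rewrite /e !ge_min lexx orbT.
have e1 : e <= (1 - t) / 2 by rewrite /e !ge_min lexx !orbT.
exists (t - e), (t + e); split; [lra|lra|lra|].
move=> s /andP[s1 s2]; have sI : s \in `[0, 1] by rewrite in_itv/=; apply/andP; split; lra.
have : `|s - t| <= d by rewrite ler_norml; apply/andP; split; lra.
move=> /(Hd s sI) K; have := nrm_dist (u2 s sI) (u2 t tI).
rewrite ler_norml => /andP[A _]; move: A K.
by move: (nrm (fun z => _)) (nrm (u s)) (nrm (u t)) => *; lra.
Qed.

Context (u : R -> R * R -> R) (M a b q B : R).
Hypothesis hH4 : C0H 4 u.
Hypothesis hC1 : C1L2 u.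
Hypothesis hZK : ZK_solution u.
Hypothesis hM : forall t, t \in `[0, 1] -> {ae leb2, forall z, `|Du u 1 0 t z| <= M}.
Hypothesis a0 : 0 <= a.
Hypothesis B0 : 0 <= B.
Hypothesis HH : gauss_bounded u a b.

(** By Cauchy-Schwarz it bounds the integral of [(|u_xx| + |u_x| + |u| + |u_yy|) |u|], which is all
    that the energy sees where the weights are bounded. *)
Definition data_size t : R :=
  (nrm (Du u 2 0 t) + nrm (Du u 1 0 t) + nrm (u t) + nrm (Du u 0 2 t)) * nrm (u t).

Lemma gw_box z : `|z.1| <= B -> gw a b z ^+ 2 <= expR (a * B ^+ 2 + 2 * (`|b| * B)).
Proof.
move=> zB; rewrite /gw expr2 -expRD ler_expR.
have -> : a / 2 * z.1 ^+ 2 + b * z.1 + (a / 2 * z.1 ^+ 2 + b * z.1) =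
  a * z.1 ^+ 2 + 2 * (b * z.1) by field.
apply: lerD.
  by rewrite ler_wpM2l// -[leLHS]real_normK ?num_real// lerXn2r ?nnegrE.
rewrite ler_wpM2l// (le_trans (ler_norm _))// normrM ler_wpM2l//.
Qed.

(** [L] majorizes [|lin|], [a] and 1 in the box, so [L^3] majorizes all their products that occur.
    After expansion the four coefficients are at most 3, 9, 10 and 1 times [L^3]; 23 is the sum. *)
Lemma carleman_boundary_pointwise z (f20 f10 f f02 : R) (L := a * B + `|b| + a + 1) :
  `|z.1| <= B ->
  `|- 3 * (lin a b z * (f20 + 2 * lin a b z * f10 + (lin a b z ^+ 2 + a) * f)) -
     3 * a * (f10 + lin a b z * f) - lin a b z * f02 - lin a b z ^+ 3 * f| <=
  23 * L ^+ 3 * (`|f20| + `|f10| + `|f| + `|f02|).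
Proof.
move=> zB; have : `|lin a b z| <= a * B + `|b|.
  by apply: (le_trans (ler_normD _ _)); rewrite normrM (ger0_norm a0) lerD2r ler_wpM2l.
move: (lin a b z) => p pB.
have aB0 : 0 <= a * B by exact: mulr_ge0.
have pL : `|p| <= L by rewrite (le_trans pB)// /L -addrA lerDl addr_ge0.
have aL : a <= L by rewrite /L; have := normr_ge0 b; lra.
have L1 : 1 <= L by rewrite /L lerDr !addr_ge0.
have L0 : 0 <= L by exact: le_trans L1.
have p0 := normr_ge0 p.
have m2 x y : 0 <= x -> 0 <= y -> x <= L -> y <= L -> x * y <= L ^+ 2.
  by move=> x0 y0 xL yL; rewrite expr2; exact: ler_pM.
have L12 : L <= L ^+ 2 by rewrite expr2 ler_peMl.
have L23 : L ^+ 2 <= L ^+ 3 by rewrite [L ^+ 3]exprS ler_peMl// exprn_ge0.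
have L13 : L <= L ^+ 3 by exact: le_trans L23.
have pp : `|p| * `|p| <= L ^+ 2 by exact: m2.
have ap : a * `|p| <= L ^+ 2 by exact: m2.
have ppp : `|p| * (`|p| * `|p|) <= L ^+ 3 by rewrite exprS; apply: ler_pM => //; exact: mulr_ge0.
have -> : - 3 * (p * (f20 + 2 * p * f10 + (p ^+ 2 + a) * f)) - 3 * a * (f10 + p * f) -
    p * f02 - p ^+ 3 * f = - (3 * p * f20) + (- ((6 * (p * p) + 3 * a) * f10)) +
    (- ((4 * (p * (p * p)) + 6 * (a * p)) * f)) + (- (p * f02)) by ring.
have tri (x y : R) X Y : `|x| <= X -> `|y| <= Y -> `|x + y| <= X + Y.
  by move=> hx hy; apply: (le_trans (ler_normD _ _)); exact: lerD.
apply: (@le_trans _ _ (23 * L ^+ 3 * `|f20| + 23 * L ^+ 3 * `|f10| +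
   23 * L ^+ 3 * `|f| + 23 * L ^+ 3 * `|f02|)); last by rewrite !mulrDr.
have k3 : `|3 : R| = 3 by rewrite ger0_norm.
have k4 : `|4 : R| = 4 by rewrite ger0_norm.
have k6 : `|6 : R| = 6 by rewrite ger0_norm.
have an : `|a| = a by rewrite ger0_norm.
apply: (tri); [apply: (tri); [apply: (tri)|]|]; rewrite normrN normrM; apply: ler_wpM2r => //.
- by rewrite normrM k3; lra.
- apply: (@le_trans _ _ (6 * (`|p| * `|p|) + 3 * a)); last by lra.
  by apply: (tri); rewrite normrM ?k6 ?k3 ?an// normrM.
- apply: (@le_trans _ _ (4 * (`|p| * (`|p| * `|p|)) + 6 * (a * `|p|))); last by lra.
  by apply: (tri); rewrite normrM ?k6 ?k4 ?an// !normrM// an.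
- by lra.
Qed.

Lemma carleman_energy_boundary s (L := a * B + `|b| + a + 1) : s \in `[0, 1] ->
  {ae leb2, forall z, ~ `|z.1| <= B -> u s z = 0} ->
  `|carleman_energy u a b q s| <=
    expR (a * B ^+ 2 + 2 * (`|b| * B)) * (23 * L ^+ 3 + `|q|) * data_size s.
Proof.
move=> sI supp; pose E := expR (a * B ^+ 2 + 2 * (`|b| * B)).
have u2 : inL2 (u s) by case: hC1 => [[+ _] _ _]; exact.
have in2 i j : (i + j <= 4)%N -> inL2 (Du u i j s) by exact: Du_inL2.
pose N z := `|Du u 2 0 s z| + `|Du u 1 0 s z| + `|u s z| + `|Du u 0 2 s z|.
have N2 : inL2 N.
  by apply: inL2D; [apply: inL2D; [apply: inL2D|]|]; apply: inL2_normr => //; exact: in2.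
have un2 := inL2_normr u2.
have Nn : nrm N <= nrm (Du u 2 0 s) + nrm (Du u 1 0 s) + nrm (u s) + nrm (Du u 0 2 s).
  have n20 := inL2_normr (in2 2%N 0%N isT); have n10 := inL2_normr (in2 1%N 0%N isT).
  have n02 := inL2_normr (in2 0%N 2%N isT).
  apply: (le_trans (nrmD (inL2D (inL2D n20 n10) un2) n02)); rewrite nrm_normr lerD2r.
  apply: (le_trans (nrmD (inL2D n20 n10) un2)); rewrite nrm_normr lerD2r.
  by apply: (le_trans (nrmD n20 n10)); rewrite !nrm_normr.
have iN := integrable2M N2 un2.
have Nle : \int[leb2]_z (N z * `|u s z|) <= data_size s.
  apply: (le_trans (ler_norm _)); apply: (le_trans (nrm_CS N2 un2)).
  by rewrite nrm_normr ler_wpM2r ?nrm_ge0.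
pose F i j := Du u i j s.
pose G z := gw a b z * carleman_sym (lin a b) a (cj a b F) (cjx a b F) (cjxx a b F) (cjyy a b F) 0 z.
have G2 : inL2 G by have [+ _] := L2cont_kinetic_density hH4 hC1 HH; exact.
have kE : carleman_kinetic u a b s = \int[leb2]_z (G z * u s z) by [].
have iG := integrable2M G2 u2.
have L1 : 1 <= L by rewrite /L lerDr !addr_ge0// mulr_ge0.
have L3 : 0 <= 23 * L ^+ 3 by rewrite mulr_ge0// exprn_ge0// (le_trans _ L1).
have EL : 0 <= E * (23 * L ^+ 3) by rewrite mulr_ge0// expR_ge0.
have kin_le : `|carleman_kinetic u a b s| <= E * (23 * L ^+ 3) * data_size s.
  apply: le_trans (ler_wpM2l EL Nle); rewrite kE -int2Z//.
  apply: int2_abs_le => //; first exact: integrable2Z.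
  apply: ae2_imp supp => z Hz; have [zB|/negP zB] := boolP (`|z.1| <= B); last first.
    by rewrite (Hz zB) mulr0 normr0 !mulr0.
  have -> : G z * u s z = gw a b z ^+ 2 * ((- 3 * (lin a b z * (F 2%N 0%N z +
      2 * lin a b z * F 1%N 0%N z + (lin a b z ^+ 2 + a) * F 0%N 0%N z)) -
     3 * a * (F 1%N 0%N z + lin a b z * F 0%N 0%N z) - lin a b z * F 0%N 2%N z -
     lin a b z ^+ 3 * F 0%N 0%N z) * u s z).
    rewrite /G /carleman_sym /cj /cjx /cjxx /cjyy.
    move: (F 2%N 0%N z) (F 1%N 0%N z) (F 0%N 0%N z) (F 0%N 2%N z) (gw a b z) (lin a b z) (u s z).
    by move=> *; ring.
  rewrite normrM -[E * _ * _]mulrA; apply: ler_pM => //.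
    by rewrite ger0_norm ?sqr_ge0// gw_box.
  by rewrite normrM [leRHS]mulrA ler_wpM2r// carleman_boundary_pointwise.
have mass_le : carleman_mass u a b s <= E * data_size s.
  have uE : \int[leb2]_z u s z ^+ 2 <= data_size s.
    rewrite -sqr_nrm expr2 ler_wpM2r ?nrm_ge0//.
    by rewrite -[leLHS]addr0 -[X in X + 0]add0r; do 2?apply: lerD; rewrite ?addr_ge0 ?nrm_ge0.
  apply: (@le_trans _ _ (E * \int[leb2]_z u s z ^+ 2)); last by rewrite ler_wpM2l ?expR_ge0.
  rewrite -int2Z; last exact: inL2_sqr.
  apply: int2_ae_le.
  - have := HH 0 1 (i := 0) (j := 0) isT => -[C /(_ s sI)[+ _]] => /inL2_sqr.
    by congr integrable2; apply/funext => z; rewrite expr0 mul1r.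
  - by apply: integrable2Z; exact: inL2_sqr.
  apply: ae2_imp supp => z Hz; have [zB|/negP zB] := boolP (`|z.1| <= B); last first.
    by rewrite (Hz zB) !mulr0 expr0n mulr0.
  by rewrite exprMn ler_wpM2r ?sqr_ge0// gw_box.
have mass0 : 0 <= carleman_mass u a b s by apply: int2_ge0 => z; exact: sqr_ge0.
have dq := dphase_le q sI.
rewrite /carleman_energy; apply: (le_trans (ler_normB _ _)).
rewrite mulrDr mulrDl; apply: lerD => //.
rewrite normrM (ger0_norm mass0) [E * `|q|]mulrC -mulrA.
by apply: ler_pM.
Qed.

(* The phase vanishes at both ends, so only the unweighted energies remain there. *)
Lemma carleman_squeeze (k x y : R) : 0 < x -> x < y -> y < 1 ->
  (forall s, 0 < s < 1 -> \int[leb2]_z ((- 3 * a * lin a b z ^+ 4 +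
    6 * a * dphase q s * lin a b z + 12 * a ^+ 3 + 18 * a ^+ 2 * lin a b z ^+ 2 +
    M ^+ 2 + 2 * q) * (gw a b z * u s z) ^+ 2) <=
    - carleman_mass u a b s) ->
  (forall s, x < s < y -> k <= expR (2 * phase q s) * carleman_mass u a b s) ->
  k * (y - x) <= `|carleman_energy u a b q 0| + `|carleman_energy u a b q 1|.
Proof.
move=> x0 xy y1 neg low.
have D := carleman_energy_decay q hH4 hC1 hZK hM a0 HH.
have m0 s : 0 <= carleman_mass u a b s by apply: int2_ge0 => z; exact: sqr_ge0.
have drop p r : 0 <= p -> p < r -> r <= 1 -> exists2 s, p < s < r &
    expR (2 * phase q r) * carleman_energy u a b q r -
    expR (2 * phase q p) * carleman_energy u a b q p <=
    - ((r - p) * (expR (2 * phase q s) * carleman_mass u a b s)).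
  move=> p0 pr r1; have [s sI H] := D p r p0 pr r1; exists s => //.
  apply: (le_trans H); rewrite -mulrN ler_wpM2l ?subr_ge0 ?(ltW pr)//.
  rewrite -mulrN ler_wpM2l ?expR_ge0//; apply: neg.
  by move: sI => /andP[ps sr]; rewrite (le_lt_trans p0 ps) (lt_le_trans sr r1).
have pos p r s : p < r -> 0 <= (r - p) * (expR (2 * phase q s) * carleman_mass u a b s).
  by move=> pr; rewrite mulr_ge0 ?subr_ge0 ?(ltW pr)// mulr_ge0 ?expR_ge0.
(* On the outer intervals only the monotonicity is used; the middle one carries the lower bound
   [k]. *)
have [s1 _ D1] := drop 0 x (lexx 0) x0 (ltW (lt_trans xy y1)).
have [s2 s2I D2] := drop x y (ltW x0) xy (ltW y1).
have [s3 _ D3] := drop y 1 (ltW (lt_trans x0 xy)) y1 (lexx 1).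
have P1 := pos 0 x s1 x0; have P3 := pos y 1 s3 y1.
have K : k * (y - x) <= (y - x) * (expR (2 * phase q s2) * carleman_mass u a b s2).
  by rewrite mulrC ler_wpM2l ?subr_ge0 ?(ltW xy)//; exact: low.
have e0 : expR (2 * phase q 0) = 1 by rewrite /phase mul0r !mulr0 expR0.
have e1 : expR (2 * phase q 1) = 1 by rewrite /phase subrr !mulr0 expR0.
rewrite e0 mul1r in D1; rewrite e1 mul1r in D3.
have N0 := ler_norm (carleman_energy u a b q 0).
have N1 := ler_norm (- carleman_energy u a b q 1); rewrite normrN in N1.
exact: telescope_le D1 D2 D3 P1 P3 K N0 N1.
Qed.

End boundary.

(** * Locality of weak derivatives *)

Section half_plane.
Context {R : realType}.
Local Notation T2 := (measurableTypeR R * measurableTypeR R)%type.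
Implicit Types (z v : R * R) (f g m phi : R * R -> R) (k B : R).

(** Test functions are multiplied by a smooth cutoff positive exactly on the half-plane. Where the
    product or its derivative is nonzero, [f] vanishes, so the cutoff times [g] is orthogonal to
    every test function. *)
Lemma wder_half_plane v f g k B : axis v -> wder v f g ->
  {ae leb2, forall z, B < k * z.1 -> f z = 0} ->
  {ae leb2, forall z, B < k * z.1 -> g z = 0}.
Proof.
move=> av W f0; have [f2 g2 _] := W.
pose l z := k * z.1 + - B; pose m z := flat 1 (l z).
have sm : smooth m.
  by move=> n; apply: Ck_flat; apply: CkD; [apply: CkZ; exact: Ck_fst|exact: Ck_cst].
have m0 z : ~ B < k * z.1 -> flat 1 (l z) = 0.
  by move=> /negP; rewrite /flat /l subr_gt0 => /negbTE ->.
have dm z : is_derive z v m (flat ('X^2 * (1 - 1^`())) (l z) * (k * v.1)).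
  apply: (is_derive_scalar_comp (is_derive_flat 1 (l z))).
  have D0 : is_derive z v ((fun=> - B) : R * R -> R) 0 by exact: is_derive_cst.
  by have := is_deriveD (is_deriveZ k (is_derive_fst z v)) D0; rewrite addr0.
have mb z : `|m z| <= 1 by rewrite ger0_norm ?flat1_ge0 ?flat1_le1.
have mg2 : inL2 (fun z => m z * g z) by exact: inL2_bdM (measurable_smooth sm) mb g2.
have : {ae leb2, forall z, m z * g z = 0}.
  apply: (inL2_test_eq mg2 inL2_0) => phi tphi.
  have tm := test_smoothM sm tphi; have [_ _ /(_ _ tm) H] := W.
  have -> : (fun z => m z * g z * phi z) = (fun z => g z * (m z * phi z)).
    by apply/funext => z; ring.
  have -> : (fun z => 0 * phi z) = (fun=> 0 : R) by apply/funext => z; rewrite mul0r.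
  have Z : \int[leb2]_z (fun=> 0 : R) z = 0 by rewrite /Rintegral integral0.
  rewrite Z -[LHS]opprK -H; apply/eqP; rewrite oppr_eq0; apply/eqP; rewrite -[RHS]Z.
  apply: int2_ae; first by apply: integrable2_test => //; exact: test_D.
    exact: integrable0.
  apply: ae2_imp f0 => z f0; have [zB|/negP zB] := boolP (B < k * z.1).
    by rewrite f0// mul0r.
  have [_ ->] := is_deriveM (dm z) (test_is_derive z av tphi).
  have -> : m z = 0 by exact: m0.
  have -> : flat ('X^2 * (1 - 1^`())) (l z) = 0.
    by rewrite /flat /l subr_gt0 (negbTE (introN idP zB)).
  by rewrite scale0r mul0r scaler0 addr0 mulr0.
apply: ae2_imp => z /eqP; rewrite mulf_eq0 => /orP[|/eqP//] /eqP m00 zB.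
by move: m00; rewrite /m /flat /l subr_gt0 zB hornerC mul1r => /eqP; rewrite gt_eqF// expR_gt0.
Qed.

Lemma measurable_half_plane k B : measurable ([set z | B < k * z.1] : set T2).
Proof.
apply: open_measurable2.
have -> : [set z : R * R | B < k * z.1] = (fun z => k * z.1) @^-1` [set x | B < x] by [].
apply: open_comp; last exact: open_gt.
by move=> z _; apply: cvgM; [exact: cvg_cst|exact: cvg_fst].
Qed.

Lemma nrm_indic_eq0 (A : set (R * R)) f : measurable (A : set T2) -> inL2 f ->
  nrm (fun z => \1_A z * f z) = 0 -> {ae leb2, forall z, A z -> f z = 0}.
Proof.
move=> mA f2 n0; have b z : `|\1_A z : R| <= 1.
  by rewrite indicE; case: (_ \in _); rewrite ?normr1// normr0.
have mi : measurable_fun [set: T2] (\1_A : T2 -> R) by exact: measurable_indic.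
have L := inL2_bdM mi b f2.
have := int2_sqr_eq0 L; rewrite -sqr_nrm n0 expr0n => /(_ erefl).
by apply: ae2_imp => z + Az; rewrite indic1// mul1r.
Qed.

End half_plane.

(** * Confinement to the strip by exponential weights *)

Section off_strip.
Context {R : realType}.
Local Notation T2 := (measurableTypeR R * measurableTypeR R)%type.
Implicit Types (z v : R * R) (t s : R).
Context (u : R -> R * R -> R) (M B : R).
Hypothesis hH4 : C0H 4 u.
Hypothesis hC1 : C1L2 u.
Hypothesis hZK : ZK_solution u.
Hypothesis M0 : 0 <= M.
Hypothesis B0 : 0 <= B.
Hypothesis hM : forall t, t \in `[0, 1] -> {ae leb2, forall z, `|Du u 1 0 t z| <= M}.
Hypothesis supp0 : {ae leb2, forall z, ~ `|z.1| <= B -> u 0 z = 0}.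
Hypothesis supp1 : {ae leb2, forall z, ~ `|z.1| <= B -> u 1 z = 0}.

Let hL2 : C0L2 u. Proof. by case: hC1. Qed.

(** For [a = 0], [lin] is the constant [b] and the powers of [gw] are pure exponentials. *)
Lemma gauss_bounded_exponential b : gauss_bounded u 0 b.
Proof.
move=> k n i j ij.
have [C HC] := weight_bounded_Du hH4 hC1 hZK M0 hM supp0 supp1 (n%:R * b) ij.
have E t : (fun z => lin 0 b z ^+ k * gw 0 b z ^+ n * Du u i j t z) =
    (fun z => b ^+ k * (ew (n%:R * b) z * Du u i j t z)).
  apply/funext => z; rewrite /lin /gw /ew mul0r add0r -expRM_natl mulrA.
  by congr (_ * expR _ * _); rewrite mul0r mul0r add0r mulrA.
exists (`|b ^+ k| * C) => t tI; rewrite E; have [w2 wC] := HC t tI.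
by split; [exact: inL2Z|rewrite nrmZ// ler_wpM2l].
Qed.

Let I0 : (0 : R) \in `[0, 1]. Proof. by rewrite in_itv/= lexx ler01. Qed.
Let I1 : (1 : R) \in `[0, 1]. Proof. by rewrite in_itv/= lexx ler01. Qed.

Lemma data_size_ge0 t : 0 <= data_size u t.
Proof. by rewrite mulr_ge0 ?nrm_ge0// !addr_ge0 ?nrm_ge0. Qed.

Lemma carleman_energies_le (a b q : R) : 0 <= a -> gauss_bounded u a b ->
  `|carleman_energy u a b q 0| + `|carleman_energy u a b q 1| <=
  expR (a * B ^+ 2 + 2 * (`|b| * B)) *
    ((23 + `|q|) * (data_size u 0 + data_size u 1) * (a * B + `|b| + a + 1) ^+ 3).
Proof.
move=> a0 HH.
have E0 := carleman_energy_boundary q hH4 hC1 a0 B0 HH I0 supp0.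
have E1 := carleman_energy_boundary q hH4 hC1 a0 B0 HH I1 supp1.
apply: (le_trans (lerD E0 E1)); rewrite -mulrDr -[leLHS]mulrA ler_wpM2l ?expR_ge0//.
rewrite [leRHS]mulrAC ler_wpM2r ?addr_ge0 ?data_size_ge0// [leRHS]mulrDl lerD2l ler_peMr//.
by rewrite exprn_ege1// lerDr !addr_ge0// mulr_ge0.
Qed.

(* If [u] had mass beyond [B + e], the weights [expR (l x)] would make it exceed the
   boundary energies, which grow like [expR (2 l B)] up to polynomial factors. *)
Lemma vanish_beyond (sg e t : R) : `|sg| = 1 -> 0 < e -> 0 < t < 1 ->
  {ae leb2, forall z, B + e < sg * z.1 -> u t z = 0}.
Proof.
move=> sg1 e0 t01; have tI : t \in `[0, 1] by rewrite in_itv/= !ltW; case/andP: t01.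
pose A := [set z : R * R | B + e < sg * z.1].
have mA : measurable (A : set T2) by exact: measurable_half_plane.
have u2 s : s \in `[0, 1] -> inL2 (u s) by case: hL2 => + _; exact.
apply: (nrm_indic_eq0 mA (u2 t tI)); apply/eqP; rewrite -[_ == _]negbK.
apply/negP => n0; pose v s z := \1_A z * u s z.
have {}n0 : 0 < nrm (v t) by rewrite lt_def n0 nrm_ge0.
have b1 z : `|\1_A z : R| <= 1.
  by rewrite indicE; case: (_ \in _); rewrite ?normr1// normr0.
have mi : measurable_fun [set: T2] (\1_A : T2 -> R) by exact: measurable_indic.
have cv : L2cont v by apply: (L2cont_bdM mi b1); exact: L2cont_C0L2.
have [x [y [x0 xy y1 low]]] := L2cont_lower cv t01 n0.
(* Then [M^2 + 2 q = -1]; all other terms of the polynomial carry a factor [a = 0]. *)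
pose q := - ((M ^+ 2 + 1) / 2).
pose c := expR (- (2 * `|q|)) * (nrm (v t) / 2) ^+ 2 * (y - x).
have c0 : 0 < c.
  by rewrite mulr_gt0 ?subr_gt0// mulr_gt0 ?expR_gt0// exprn_gt0// divr_gt0.
pose C := (23 + `|q|) * (data_size u 0 + data_size u 1).
(* The gain [exp (2 e l)] is the ratio of [exp (2 l (B + e))] inside to [exp (2 l B)] at the ends;
   degree 3 comes from the cube in the boundary bound. *)
have [l [_ l0 Hl]] := @expR_beats_poly _ 3 c (2 * e) C 0 c0 (mulr_gt0 (ltr0n _ 2) e0).
have HH := gauss_bounded_exponential (sg * l).
have wL2 s : s \in `[0, 1] -> inL2 (fun z => gw 0 (sg * l) z * u s z).
  move=> sI; have [C' /(_ s sI)[+ _]] := HH 0%N 1%N 0%N 0%N isT; congr inL2.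
  by apply/funext => z; rewrite expr0 mul1r.
have I s : 0 < s < 1 -> s \in `[0, 1] by move=> /andP[? ?]; rewrite in_itv/= !ltW.
have neg s : 0 < s < 1 -> \int[leb2]_z ((- 3 * 0 * lin 0 (sg * l) z ^+ 4 +
    6 * 0 * dphase q s * lin 0 (sg * l) z + 12 * 0 ^+ 3 + 18 * 0 ^+ 2 * lin 0 (sg * l) z ^+ 2 +
    M ^+ 2 + 2 * q) * (gw 0 (sg * l) z * u s z) ^+ 2) <= - carleman_mass u 0 (sg * l) s.
  move=> /I sI; rewrite /carleman_mass -int2N; last exact: inL2_sqr (wL2 s sI).
  rewrite le_eqVlt; apply/orP; left; apply/eqP; congr (Rintegral _ _ _).
  apply/funext => z; move: (lin 0 (sg * l) z) (gw 0 (sg * l) z) (u s z) (dphase q s).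
  by rewrite /q => p g w d; field.
have lowk s : x < s < y ->
    expR (- (2 * `|q|)) * (expR (2 * l * (B + e)) * (nrm (v t) / 2) ^+ 2) <=
    expR (2 * phase q s) * carleman_mass u 0 (sg * l) s.
  move=> sxy; have s01 : 0 < s < 1.
    by move: sxy => /andP[xs sy]; rewrite (lt_trans x0 xs) (lt_trans sy y1).
  have sI := I s s01; have vs2 : inL2 (v s) by exact: inL2_bdM mi b1 (u2 s sI).
  apply: ler_pM; [exact: expR_ge0|by rewrite mulr_ge0 ?expR_ge0 ?sqr_ge0| |].
    rewrite ler_expR lerNl -mulrN ler_wpM2l// (le_trans (ler_norm _))// normrN.
    rewrite /phase normrM ler_piMr//.
    move: sI; rewrite in_itv/= => /andP[s0 s1].
    by rewrite ger0_norm ?mulr_ge0 ?subr_ge0// mulr_ile1// ?subr_ge0// lerBlDr lerDl.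
  apply: (@le_trans _ _ (expR (2 * l * (B + e)) * nrm (v s) ^+ 2)).
    rewrite ler_wpM2l ?expR_ge0// lerXn2r ?nnegrE ?nrm_ge0 ?divr_ge0 ?nrm_ge0//.
    exact: low.
  rewrite sqr_nrm -int2Z; last exact: inL2_sqr.
  apply: int2_le => [||z]; first by apply: integrable2Z; exact: inL2_sqr.
    exact: inL2_sqr (wL2 s sI).
  rewrite /v; have [Az|nAz] := pselect (A z); last first.
    by rewrite (indic0z nAz) mul0r expr0n mulr0 sqr_ge0.
  rewrite (indic1 Az) mul1r exprMn ler_wpM2r ?sqr_ge0//.
  rewrite /gw expr2 -expRD ler_expR mul0r mul0r add0r.
  have -> : sg * l * z.1 + sg * l * z.1 = 2 * l * (sg * z.1) by ring.
  by rewrite ler_wpM2l ?mulr_ge0// ltW.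
have K := carleman_squeeze hH4 hC1 hZK hM (lexx 0) HH x0 xy y1 neg lowk.
have := le_trans K (carleman_energies_le q (lexx 0) HH).
rewrite normrM sg1 mul1r (ger0_norm l0) !mul0r !add0r addr0 [l + 1]addrC -/C.
have -> : 2 * l * (B + e) = 2 * (l * B) + 2 * e * l by ring.
rewrite expRD.
have -> : expR (- (2 * `|q|)) * (expR (2 * (l * B)) * expR (2 * e * l) * (nrm (v t) / 2) ^+ 2) *
  (y - x) = expR (2 * (l * B)) * (c * expR (2 * e * l)) by rewrite /c; ring.
by rewrite ler_pM2l ?expR_gt0// leNgt Hl.
Qed.

Lemma off_strip t : t \in `[0, 1] -> {ae leb2, forall z, ~ `|z.1| <= B -> u t z = 0}.
Proof.
rewrite in_itv/= !le_eqVlt => /andP[/predU1P[<-//|t0] /predU1P[->//|t1]].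
have t01 : 0 < t < 1 by rewrite t0.
have en (n : nat) : 0 < n.+1%:R^-1 :> R by rewrite invr_gt0.
have P : {ae leb2, forall z, forall n : nat, B + n.+1%:R^-1 < 1 * z.1 -> u t z = 0}.
  by apply: ae_foralln => n; apply: vanish_beyond => //; rewrite normr1.
have N : {ae leb2, forall z, forall n : nat, B + n.+1%:R^-1 < - 1 * z.1 -> u t z = 0}.
  by apply: ae_foralln => n; apply: vanish_beyond => //; rewrite normrN1.
apply: ae2_imp2 P N => z Pz Nz /negP; rewrite -ltNge => zB.
have [n Hn] : exists n : nat, B + n.+1%:R^-1 < `|z.1|.
  exists (Num.truncn ((`|z.1| - B)^-1)); rewrite addrC -ltrBrDr.
  rewrite invf_plt ?posrE ?subr_gt0//.
  exact: truncnS_gt.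
move: Hn; have [z0|z0] := leP 0 z.1; first by rewrite (ger0_norm z0) -{1}[z.1]mul1r; exact: Pz.
by rewrite (ltr0_norm z0) -mulN1r; exact: Nz.
Qed.

Lemma Du_off_strip i j t : t \in `[0, 1] -> (i + j <= 4)%N ->
  {ae leb2, forall z, ~ `|z.1| <= B -> Du u i j t z = 0}.
Proof.
move=> tI; have H (f : R * R -> R) : {ae leb2, forall z, ~ `|z.1| <= B -> f z = 0} <->
  {ae leb2, forall z, B < 1 * z.1 -> f z = 0} /\ {ae leb2, forall z, B < - 1 * z.1 -> f z = 0}.
  split=> [H|[H1 H2]].
    split; apply: ae2_imp H => z Hz zB; apply: Hz; apply/negP; rewrite -ltNge.
      by apply: (lt_le_trans zB); rewrite mul1r ler_norm.
    by apply: (lt_le_trans zB); rewrite mulN1r -normrN ler_norm.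
  apply: ae2_imp2 H1 H2 => z H1 H2 /negP; rewrite -ltNge.
  have [z0|z0] := leP 0 z.1; first by rewrite (ger0_norm z0) -{1}[z.1]mul1r; exact: H1.
  by rewrite (ltr0_norm z0) -mulN1r; exact: H2.
have step v f g : axis v -> wder v f g -> {ae leb2, forall z, ~ `|z.1| <= B -> f z = 0} ->
    {ae leb2, forall z, ~ `|z.1| <= B -> g z = 0}.
  move=> av W /H[H1 H2]; apply/H; split.
    exact: (wder_half_plane av W H1).
  exact: (wder_half_plane av W H2).
elim: j => [|j IH] ij; last first.
  apply: (step ey _ _ (or_intror erefl) (wder_Du_y hH4 tI ij)).
  by apply: IH; rewrite (leq_trans _ ij)// leq_add2l.
elim: i ij => [|i IH] ij; first exact: off_strip.
rewrite addn0 in ij; apply: (step ex _ _ (or_introl erefl) (wder_Du_x hH4 tI ij)).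
by apply: IH; rewrite addn0 ltnW.
Qed.

End off_strip.

(** * Vanishing inside the strip by Gaussian weights *)

Section inside_strip.
Context {R : realType}.
Local Notation T2 := (measurableTypeR R * measurableTypeR R)%type.
Implicit Types (z v : R * R) (t s : R).

(** As [1 <= a <= p], each term other than [- 3 a p^4] is at most a multiple of [p^4]. The multiples
    add up to [6 K + 12 + 18 + N + 2 K], and [31] leaves one to spare. *)
Lemma carleman_coefficient_le (a K N p d : R) : 0 <= K -> 0 <= N ->
  8 * K + 31 + N <= a -> a <= p -> `|d| <= K * a ->
  - 3 * a * p ^+ 4 + 6 * a * d * p + 12 * a ^+ 3 + 18 * a ^+ 2 * p ^+ 2 + N +
    2 * (K * a) <= - 1.
Proof.
move=> K0 N0 aK ap dK; have a1 : 1 <= a by lra.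
have p1 : 1 <= p by exact: le_trans ap.
have a0 : 0 <= a by exact: le_trans a1.
have p0 : 0 <= p by exact: le_trans p1.
have pa3 : a ^+ 3 <= p ^+ 3 by rewrite lerXn2r ?nnegrE.
have pa2 : a ^+ 2 <= p ^+ 2 by rewrite lerXn2r ?nnegrE.
have p3 : p ^+ 3 <= p ^+ 4 by rewrite [leRHS]exprSr ler_peMr ?exprn_ge0.
have p2 : p ^+ 2 <= p ^+ 3 by rewrite [leRHS]exprSr ler_peMr ?exprn_ge0.
have pp2 : p <= p ^+ 2 by rewrite expr2 ler_peMr.
have T1 : a ^+ 2 * p <= p ^+ 4.
  by apply: le_trans p3; rewrite [leRHS]exprSr ler_wpM2r.
have T2 : a ^+ 3 <= p ^+ 4 by exact: le_trans pa3 p3.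
have T3 : a ^+ 2 * p ^+ 2 <= p ^+ 4.
  by rewrite (_ : p ^+ 4 = p ^+ 2 * p ^+ 2) ?ler_wpM2r ?exprn_ge0// -exprD.
have T5 : a <= p ^+ 4 by rewrite (le_trans ap)// (le_trans pp2)// (le_trans p2).
have T4 : 1 <= p ^+ 4 by exact: le_trans T5.
have dp : 6 * a * d * p <= 6 * K * (a ^+ 2 * p).
  have -> : 6 * K * (a ^+ 2 * p) = 6 * a * p * (K * a) by ring.
  rewrite mulrAC ler_wpM2l ?mulr_ge0//; exact: le_trans (ler_norm d) dK.
have P4 : 0 <= p ^+ 4 by rewrite exprn_ge0.
have H1 : 6 * K * (a ^+ 2 * p) <= 6 * K * p ^+ 4 by rewrite ler_wpM2l// mulr_ge0.
have H4 : N <= N * p ^+ 4 by rewrite ler_peMr.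
have H5 : 2 * (K * a) <= 2 * K * p ^+ 4 by rewrite mulrA ler_wpM2l// mulr_ge0.
have H6 : (8 * K + 31 + N) * p ^+ 4 <= a * p ^+ 4 by rewrite ler_wpM2r.
have H7 : 18 * a ^+ 2 * p ^+ 2 <= 18 * p ^+ 4 by rewrite -mulrA ler_wpM2l.
have H8 : 1 <= a * p ^+ 4 by rewrite (le_trans T4)// ler_peMl.
move: dp H1 H4 H5 H6 H7 H8 T2 T4; rewrite !mulrDl -!mulrA.
move: (a * (d * p)) (a ^+ 2 * p) (K * p ^+ 4) (N * p ^+ 4) (a * p ^+ 4) (a ^+ 2 * p ^+ 2) (K * (a ^+ 2 * p)).
move: (p ^+ 4) (a ^+ 3) (K * a) => *; lra.
Qed.

Context (u : R -> R * R -> R) (M B : R).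
Hypothesis hH4 : C0H 4 u.
Hypothesis hC1 : C1L2 u.
Hypothesis hZK : ZK_solution u.
Hypothesis M0 : 0 <= M.
Hypothesis B0 : 0 <= B.
Hypothesis hM : forall t, t \in `[0, 1] -> {ae leb2, forall z, `|Du u 1 0 t z| <= M}.
Hypothesis supp0 : {ae leb2, forall z, ~ `|z.1| <= B -> u 0 z = 0}.
Hypothesis supp1 : {ae leb2, forall z, ~ `|z.1| <= B -> u 1 z = 0}.

Let hL2 : C0L2 u. Proof. by case: hC1. Qed.

(** All derivatives vanish off the strip, so the weight may be multiplied by the indicator of the
    strip, which makes it bounded. *)
Lemma gauss_bounded_strip a b : gauss_bounded u a b.
Proof.
move=> k n i j ij; have [C HC] := Du_bounded hH4 hL2 (leqW ij).
pose A : set (R * R) := [set z | `|z.1| <= B].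
have mA : measurable (A : set T2).
  have -> : A = ~` ([set z | B < 1 * z.1] `|` [set z | B < - 1 * z.1]).
    apply/seteqP; split => z /=; rewrite mul1r mulN1r.
      by rewrite /A /= ler_norml => /andP[z1 z2] [] /lt_geF; rewrite ?z2// lerNl z1.
    move=> /not_orP[/negP + /negP +]; rewrite -!leNgt => z2 z1.
    by rewrite /A /= ler_norml z2 lerNl z1.
  by apply: measurableC; apply: measurableU; exact: measurable_half_plane.
pose W z := lin a b z ^+ k * gw a b z ^+ n.
have mW : measurable_fun [set: T2] W.
  by apply: measurable_smooth; apply: smoothM; apply: smoothX; [exact: smooth_lin|exact: smooth_gw].
pose D := (`|a| * B + `|b|) ^+ k * expR (`|a / 2| * B ^+ 2 + `|b| * B) ^+ n.
have WD z : `|z.1| <= B -> `|W z| <= D.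
  move=> zB; rewrite normrM !normrX; apply: ler_pM; rewrite ?exprn_ge0//.
    rewrite lerXn2r ?nnegrE ?addr_ge0 ?mulr_ge0//.
    by rewrite (le_trans (ler_normD _ _))// normrM lerD2r ler_wpM2l.
  rewrite lerXn2r ?nnegrE ?expR_ge0// ger0_norm ?expR_ge0// ler_expR.
  by apply: lerD; apply: (le_trans (ler_norm _));
    rewrite [leLHS]normrM ler_wpM2l// normrX lerXn2r ?nnegrE.
pose V z := \1_A z * W z.
have mV : measurable_fun [set: T2] V by apply: measurable_funM => //; exact: measurable_indic.
have VD z : `|V z| <= D.
  rewrite /V; have [Az|nAz] := pselect (A z); first by rewrite (indic1 Az) mul1r WD.
  by rewrite (indic0z nAz) mul0r normr0 mulr_ge0 ?exprn_ge0 ?expR_ge0// addr_ge0 ?mulr_ge0.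
exists (D * `|C|) => t tI; have f2 := Du_inL2 hH4 tI (leqW ij).
have V2 := inL2_bdM mV VD f2.
have E : {ae leb2, forall z, V z * Du u i j t z = lin a b z ^+ k * gw a b z ^+ n * Du u i j t z}.
  apply: ae2_imp (Du_off_strip hH4 hC1 hZK M0 B0 hM supp0 supp1 tI (leqW ij)) => z H.
  rewrite /V; have [Az|nAz] := pselect (A z); first by rewrite (indic1 Az) mul1r.
  by rewrite (H nAz) !mulr0.
have W2 : inL2 (fun z => lin a b z ^+ k * gw a b z ^+ n * Du u i j t z).
  by apply: (inL2_ae _ V2 E); apply: measurable_funM => //; exact: inL2_measurable.
split => //; rewrite -(nrm_ae V2 W2 E); apply: (le_trans (nrm_bdM mV VD f2)).
have D0 : 0 <= D := le_trans (normr_ge0 _) (VD 0).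
by rewrite ler_wpM2l// (le_trans (HC t tI))// ler_norm.
Qed.

(* With the parabolic phase [K a t (1 - t)] and the Gaussian weight centred outside the strip,
   the interior dominates the boundary energies as [a] tends to infinity. *)
Lemma vanish_inside t : 0 < t < 1 -> nrm (u t) = 0.
Proof.
move=> t01; have tI : t \in `[0, 1] by rewrite in_itv/= !ltW; case/andP: t01.
have u2 s : s \in `[0, 1] -> inL2 (u s) by case: hL2 => + _; exact.
have I s : 0 < s < 1 -> s \in `[0, 1] by move=> /andP[? ?]; rewrite in_itv/= !ltW.
apply/eqP; rewrite -[_ == _]negbK; apply/negP => n0.
have {}n0 : 0 < nrm (u t) by rewrite lt_def n0 nrm_ge0.
have [x [y [x0 xy y1 low]]] := L2cont_lower (L2cont_C0L2 hL2) t01 n0.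
(* A lower bound of [s (1 - s)] for [x < s < y]. *)
pose r := x * (1 - y); have r0 : 0 < r by rewrite mulr_gt0// subr_gt0.
(* With [b = a (B + 1)] one has [2 b B = a Q], so [gw^2] is at least [exp (- a Q)] on the strip. *)
pose Q := 2 * ((B + 1) * B).
have Q0 : 0 <= Q by rewrite !mulr_ge0// addr_ge0.
(* The phase gains [2 K r a] in the exponent. This pays for [a (B^2 + Q)] at the ends and for the
   loss [a Q] inside, leaving a net factor [exp a]. *)
pose K := (B ^+ 2 + Q + Q + 1) / (2 * r).
have N0 : 0 <= B ^+ 2 + Q + Q + 1 by rewrite !addr_ge0// exprn_ge0.
have K0 : 0 <= K by apply: divr_ge0 => //; rewrite mulr_ge0// ltW.
have Kr : 2 * (K * r) = B ^+ 2 + Q + Q + 1 by rewrite /K; field; rewrite gt_eqF.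
pose c := (nrm (u t) / 2) ^+ 2 * (y - x).
have c0 : 0 < c by rewrite mulr_gt0 ?subr_gt0// exprn_gt0// divr_gt0.
pose C := (23 + K) * (data_size u 0 + data_size u 1) * (2 * B + 2) ^+ 3.
(* Degree 4: three from the cube in the boundary bound and one from [|q| = K a]. The lower bound on
   [a] is the one required by [carleman_coefficient_le]. *)
have [a [aK a0 Ha]] := @expR_beats_poly _ 4 c 1 C (8 * K + 31 + M ^+ 2) c0 ltr01.
pose b := a * (B + 1); pose q := K * a.
have b0 : 0 <= b by rewrite mulr_ge0// addr_ge0.
have q0 : 0 <= q by rewrite mulr_ge0.
have HH := gauss_bounded_strip a b.
have off s (sI : s \in `[0, 1]) := off_strip hH4 hC1 hZK M0 B0 hM supp0 supp1 sI.
have w2 k s : s \in `[0, 1] -> inL2 (fun z => lin a b z ^+ k * gw a b z * u s z).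
  by move=> sI; have [C' /(_ s sI)[]] := HH k 1%N 0%N 0%N isT.
have gu2 s : s \in `[0, 1] -> inL2 (fun z => gw a b z * u s z).
  by move=> sI; have := w2 0%N s sI; congr inL2; apply/funext => z; rewrite mul1r.
have neg s : 0 < s < 1 -> \int[leb2]_z ((- 3 * a * lin a b z ^+ 4 +
    6 * a * dphase q s * lin a b z + 12 * a ^+ 3 + 18 * a ^+ 2 * lin a b z ^+ 2 +
    M ^+ 2 + 2 * q) * (gw a b z * u s z) ^+ 2) <= - carleman_mass u a b s.
  move=> /I sI; have g2 := gu2 s sI; rewrite /carleman_mass -int2N; last exact: inL2_sqr.
  apply: int2_ae_le; last 2 first.
  - by apply: integrable2N; exact: inL2_sqr.
  - apply: ae2_imp (off s sI) => z H; have [zB|/negP zB] := boolP (`|z.1| <= B); last first.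
      by rewrite (H zB) mulr0 expr0n mulr0 oppr0.
    rewrite -[leRHS]mulN1r ler_wpM2r ?sqr_ge0//; apply: carleman_coefficient_le => //.
    + exact: sqr_ge0.
    + rewrite /lin /b -mulrDr ler_peMr//.
      by move: zB; rewrite ler_norml => /andP[z1 _]; rewrite addrA lerDr -lerBlDr sub0r.
    + by rewrite (le_trans (dphase_le q sI))// ger0_norm.
  have c2 : inL2 (fun z => (- 3 * a * (lin a b z ^+ 4 * gw a b z * u s z) +
      6 * a * dphase q s * (lin a b z ^+ 1 * gw a b z * u s z)) +
      ((12 * a ^+ 3 + M ^+ 2 + 2 * q) * (lin a b z ^+ 0 * gw a b z * u s z) +
      18 * a ^+ 2 * (lin a b z ^+ 2 * gw a b z * u s z))).
    by apply: inL2D; apply: inL2D; apply: inL2Z; exact: w2.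
  have := integrable2M c2 g2; congr integrable2; apply/funext => z.
  by move: (lin a b z) (gw a b z) (u s z) => *; ring.
have lowk s : x < s < y -> expR (2 * (K * a * r)) * (expR (- (a * Q)) * (nrm (u t) / 2) ^+ 2) <=
    expR (2 * phase q s) * carleman_mass u a b s.
  move=> sxy; have s01 : 0 < s < 1.
    by move: sxy => /andP[xs sy]; rewrite (lt_trans x0 xs) (lt_trans sy y1).
  have sI := I s s01.
  apply: ler_pM; [exact: expR_ge0|by rewrite mulr_ge0 ?expR_ge0 ?sqr_ge0| |].
    rewrite ler_expR ler_wpM2l// /phase ler_wpM2l//.
    by move: sxy => /andP[xs sy]; apply: ler_pM; rewrite ?lerB ?(ltW x0) ?subr_ge0 ?(ltW y1) ?(ltW xs) ?(ltW sy).
  apply: (@le_trans _ _ (expR (- (a * Q)) * nrm (u s) ^+ 2)).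
    rewrite ler_wpM2l ?expR_ge0// lerXn2r ?nnegrE ?nrm_ge0 ?divr_ge0 ?nrm_ge0//.
    exact: low.
  rewrite sqr_nrm -int2Z; last exact: inL2_sqr (u2 s sI).
  apply: int2_ae_le.
  - by apply: integrable2Z; exact: inL2_sqr (u2 s sI).
  - exact: inL2_sqr (gu2 s sI).
  apply: ae2_imp (off s sI) => z H; have [zB|/negP zB] := boolP (`|z.1| <= B); last first.
    by rewrite (H zB) mulr0 expr0n mulr0.
  rewrite exprMn ler_wpM2r ?sqr_ge0// /gw expr2 -expRD ler_expR.
  have -> : a / 2 * z.1 ^+ 2 + b * z.1 + (a / 2 * z.1 ^+ 2 + b * z.1) =
    a * z.1 ^+ 2 + 2 * (b * z.1) by field.
  rewrite -[leLHS]add0r; apply: lerD; first by rewrite mulr_ge0// sqr_ge0.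
  have -> : - (a * Q) = 2 * (b * - B) by rewrite /Q /b; ring.
  by rewrite ler_wpM2l// ler_wpM2l//; move: zB; rewrite ler_norml => /andP[].
have Sq := carleman_squeeze hH4 hC1 hZK hM a0 HH x0 xy y1 neg lowk.
have := le_trans Sq (carleman_energies_le hH4 hC1 B0 supp0 supp1 q a0 HH).
apply/negP; rewrite -ltNge (ger0_norm b0) (ger0_norm q0).
have D0 : 0 <= data_size u 0 + data_size u 1 by rewrite addr_ge0 ?data_size_ge0.
apply: (@le_lt_trans _ _ (expR (a * B ^+ 2 + 2 * (b * B)) * (C * (1 + a) ^+ 4))).
  rewrite ler_wpM2l ?expR_ge0//.
  have -> : C * (1 + a) ^+ 4 = (23 + K) * (1 + a) * (data_size u 0 + data_size u 1) *
    ((2 * B + 2) * (1 + a)) ^+ 3 by rewrite /C; ring.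
  have h1 : 23 + q <= (23 + K) * (1 + a).
    have := mulr_ge0 K0 a0; rewrite /q; move: K0 a0 => *.
    by rewrite mulrDl mulrDr mulr1 mulrDr mulr1; lra.
  have h2 : a * B + b + a + 1 <= (2 * B + 2) * (1 + a).
    have -> : (2 * B + 2) * (1 + a) = a * B + b + a + 1 + (2 * B + 1) by rewrite /b; ring.
    by rewrite lerDl addr_ge0// mulr_ge0.
  have p1 : 0 <= 23 + q by rewrite addr_ge0.
  have p2 : 0 <= a * B + b + a + 1 by do 3?apply: addr_ge0 => //; exact: mulr_ge0.
  apply: ler_pM; [exact: mulr_ge0|exact: exprn_ge0|by rewrite ler_wpM2r|].
  by rewrite lerXn2r ?nnegrE// (le_trans p2).
have -> : expR (2 * (K * a * r)) * (expR (- (a * Q)) * (nrm (u t) / 2) ^+ 2) * (y - x) =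
    expR (2 * (K * a * r) + - (a * Q)) * c by rewrite expRD /c; ring.
have -> : 2 * (K * a * r) + - (a * Q) = a * B ^+ 2 + 2 * (b * B) + 1 * a.
  rewrite (_ : 2 * (K * a * r) = a * (2 * (K * r))); last by move: (K) => k; ring.
  by rewrite Kr /b /Q; ring.
by rewrite [in ltRHS]expRD -mulrA ltr_pM2l ?expR_gt0// [expR _ * c]mulrC.
Qed.

Lemma vanish_closed t : t \in `[0, 1] -> nrm (u t) = 0.
Proof.
move=> tI; apply/eqP; rewrite -[_ == _]negbK; apply/negP => n0.
have {}n0 : 0 < nrm (u t) / 2 by rewrite divr_gt0// lt_def n0 nrm_ge0.
have [u2 cu] := L2cont_C0L2 hL2; have [d d0 Hd] := cu t _ tI n0.
pose l := Num.min 1 d; have l0 : 0 < l by rewrite lt_min ltr01.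
have l1 : l <= 1 by rewrite ge_min lexx.
have ld : l <= d by rewrite ge_min lexx orbT.
(* Moves [t] towards [1/2] by at most [d]; the result is interior even when [t] is 0 or 1. *)
pose s := t + l * (2^-1 - t).
have [t0 t1] : 0 <= t /\ t <= 1 by move: tI; rewrite in_itv/= => /andP[].
have s01 : 0 < s < 1 by rewrite /s; apply/andP; split; nra.
have sI : s \in `[0, 1] by move: s01 => /andP[? ?]; rewrite in_itv/= !ltW.
have sd : `|s - t| <= d.
  by rewrite /s addrC addKr ler_norml; apply/andP; split; nra.
have := le_trans (nrm_dist (u2 s sI) (u2 t tI)) (Hd s sI sd).
by rewrite (vanish_inside s01) sub0r normrN ger0_norm ?nrm_ge0//; move: (nrm (u t)) n0 => n; lra.
Qed.

End inside_strip.

Unset Implicit Arguments.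

Theorem theorem2 (R : realType) (u : R -> R * R -> R) (B : R)
    (hH4 : C0H 4 u) (hC1 : C1L2 u) (hZK : ZK_solution u) (hB : 0 < B)
    (hsupp0 : ess_supp (u 0) `<=` `[- B, B] `*` `[- B, B])
    (hsupp1 : ess_supp (u 1) `<=` `[- B, B] `*` `[- B, B]) :
  forall t : R, t \in `[0, 1] -> {ae leb2, forall z, u t z = 0}.
Proof.
have hL2 : C0L2 u by case: hC1.
have [M M0 hM] := Dx_bounded (isT : (3 <= 4)%N) hH4 hL2.
have box s : ess_supp (u s) `<=` `[- B, B] `*` `[- B, B] ->
    {ae leb2, forall z, ~ `|z.1| <= B -> u s z = 0}.
  move=> /ess_supp_ae0; apply: ae2_imp => z Hz zB; apply: Hz => -[+ _].
  by rewrite /= in_itv/= -ler_norml.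
move=> t tI; have [u2 _] := hL2.
apply: (int2_sqr_eq0 (u2 t tI)); rewrite -sqr_nrm.
rewrite (vanish_closed hH4 hC1 hZK M0 (ltW hB) hM (box 0 hsupp0) (box 1 hsupp1) tI).
by rewrite expr0n.
Qed.
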